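(* Let $\mathcal{X}$ be a pair of graphs, and consider the classes of graphs and the collections of pairs defined in the context. For each of the following choices of a class, every $\mathcal{X}$-free graph of the class is perfect if and only if $\mathcal{X}$ belongs to the corresponding collection. (1) For each of $\mathcal{G}_5$, $\mathcal{G}_o$, $\mathcal{G}_{c,5}$, the collection is $\mathcal{P}_1$. (2) For each of $\mathcal{G}_\alpha$, $\mathcal{G}_{o,\alpha}$, it is $\mathcal{P}_2$. (3) For $\mathcal{G}_{c,\alpha}$, it is $\mathcal{P}_{2c}$. (4) For $\mathcal{G}_{c,o}$, it is $\mathcal{P}_3$. (5) For $\mathcal{G}_{c,o,\alpha}$, it is $\mathcal{P}_4$. Similarly, every $\mathcal{X}$-free graph of the class is $\omega$-colourable if and only if $\mathcal{X}$ belongs to the collection as follows. (6) For each of $\mathcal{G}_5$, $\mathcal{G}_o$, $\mathcal{G}_{c,5}$, it is $\Omega_1$. (7) For each of $\mathcal{G}_\alpha$, $\mathcal{G}_{o,\alpha}$, it is $\Omega_2$. (8) For $\mathcal{G}_{c,\alpha}$, it is $\Omega_{2c}$. (9) For $\mathcal{G}_{c,o}$, it is $\Omega_3$. (10) For $\mathcal{G}_{c,o,\alpha}$, it is $\Omega_4$.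
   Context: Graphs are finite and simple and considered up to isomorphism (``distinct from $H$'' means not isomorphic to $H$). A graph $G$ is $\omega$-colourable if its chromatic number $\chi(G)$ equals its clique number $\omega(G)$; it is perfect if $\chi(G')=\omega(G')$ for every induced subgraph $G'$ of $G$. For a pair $\mathcal{X}$ of graphs, $G$ is $\mathcal{X}$-free if it contains no member of $\mathcal{X}$ as an induced subgraph. A graph is of independence at least $3$ if it contains an independent set of size $3$. $K_n, P_n, C_n$ denote the complete graph, path and cycle on $n$ vertices; $K_{1,3}$ is the complete bipartite graph with parts of sizes $1,3$; $\overline{G}$ is the complement of $G$; $G\cup H$ is disjoint union and $kG$ is the disjoint union of $k$ copies of $G$. $K_{1,3}^+$ is obtained from $K_{1,3}$ by subdividing one edge; $D$ is $K_4$ minus an edge; $Z_1$ is obtained from $K_3$ by adding a pendant edge; $Z_2$ is obtained from $Z_1$ by subdividing the pendant edge. Classes: $\mathcal{G}_5$: all graphs distinct from $C_5$; $\mathcal{G}_o$: all graphs distinct from an odd cycle; $\mathcal{G}_{c,5}$: all connected graphs distinct from $C_5$; $\mathcal{G}_\alpha$: all graphs of independence at least $3$; $\mathcal{G}_{o,\alpha}$: all graphs of independence at least $3$ distinct from an odd cycle; $\mathcal{G}_{c,\alpha}$: all connected graphs of independence at least $3$; $\mathcal{G}_{c,o}$: all connected graphs distinct from an odd cycle; $\mathcal{G}_{c,o,\alpha}$: all connected graphs of independence at least $3$ distinct from an odd cycle. Collections of pairs: - $\mathcal{P}_1$: all pairs $\mathcal{X}$ such that at least one graph of $\mathcal{X}$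 is an induced subgraph of $P_4$, or $\mathcal{X}$ is one of $\{3K_1,K_3\}$, $\{3K_1,Z_1\}$, $\{3K_1,D\}$, $\{K_1\cup P_3,K_3\}$, $\{K_1\cup P_3,Z_1\}$, $\{K_1\cup P_3,D\}$, $\{2K_1\cup K_2,K_3\}$, $\{2K_1\cup K_2,Z_1\}$. - $\mathcal{I}$: all pairs of graphs with at least one member equal to $3K_1$. - $\mathcal{P}_2$: all pairs $\mathcal{X}$ that belong to $\mathcal{P}_1$ or to $\mathcal{I}$, or such that one member of $\mathcal{X}$ is $K_1\cup P_3$ and the other is an induced subgraph of $\overline{K_3\cup P_4}$. - $\mathcal{P}_{2c}$: all pairs of $\mathcal{P}_2$ and $\{K_{1,3},2K_2\}$ and $\{K_{1,3},P_5\}$. - $\mathcal{P}_3$: all pairs of $\mathcal{P}_1$ and $\{K_{1,3},K_3\}$, $\{K_{1,3},Z_1\}$, $\{K_{1,3}^+,K_3\}$, $\{K_{1,3}^+,Z_1\}$. - $\mathcal{P}_4$: all pairs of $\mathcal{P}_{2c}$ and $\mathcal{P}_3$ and $\{K_{1,3},K_1\cup K_3\}$, $\{K_{1,3},Z_2\}$. - $\Omega_1$: all pairs of $\mathcal{P}_1$ and $\{2K_1\cup K_2,D\}$. - $\Omega_2$: all pairs of $\mathcal{P}_2$ and $\{2K_1\cup K_2,D\}$ and $\{2K_1\cup K_2,\overline{K_1\cup P_4}\}$. - $\Omega_{2c}$: all pairs of $\mathcal{P}_{2c}$ and $\{2K_1\cup K_2,D\}$ and $\{2K_1\cup K_2,\overline{K_1\cup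 P_4}\}$. - $\Omega_3$: all pairs of $\mathcal{P}_3$ and $\{2K_1\cup K_2,D\}$. - $\Omega_4$: all pairs of $\mathcal{P}_4$ and $\{2K_1\cup K_2,D\}$ and $\{2K_1\cup K_2,\overline{K_1\cup P_4}\}$. *)

(* Defs.v *)
From mathcomp Require Import all_boot.

Set Implicit Arguments.
Unset Strict Implicit.
Unset Printing Implicit Defensive.

Declare Scope graph_scope.
Delimit Scope graph_scope with graph.

Record sgraph := SGraph {
  vertex :> finType;
  adj : rel vertex;
  adj_sym : symmetric adj;
  adj_irrefl : irreflexive adj }.

Notation "x -- y" := (adj x y) (at level 30) : graph_scope.
Local Open Scope graph_scope.

Section SymGraph.
Variables (T : finType) (r : rel T).

Definition sym_rel : rel T := fun x y => (x != y) && (r x y || r y x).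

Lemma sym_rel_sym : symmetric sym_rel.
Proof. by move=> x y; rewrite /sym_rel eq_sym orbC. Qed.

Lemma sym_rel_irrefl : irreflexive sym_rel.
Proof. by move=> x; rewrite /sym_rel eqxx. Qed.

(* Loops of [r] are dropped and its symmetric closure is taken, so a graph may
   be given by listing each edge in one direction only. *)
Definition sym_graph : sgraph := SGraph sym_rel_sym sym_rel_irrefl.

End SymGraph.

Definition isomorphic (G H : sgraph) : Prop :=
  exists2 f : G -> H, bijective f & forall x y, (f x -- f y) = (x -- y).

Notation "G ≃ H" := (isomorphic G H) (at level 70, no associativity)
  : graph_scope.

Section Induced.
Variables (G : sgraph) (S : {set G}).

Definition induced_rel : rel {x : G | x \in S} := fun x y => val x -- val y.

Lemma induced_rel_sym : symmetric induced_rel.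
Proof. by move=> x y; rewrite /induced_rel adj_sym. Qed.

Lemma induced_rel_irrefl : irreflexive induced_rel.
Proof. by move=> x; rewrite /induced_rel adj_irrefl. Qed.

Definition induced : sgraph := SGraph induced_rel_sym induced_rel_irrefl.

End Induced.

Definition induced_subgraph (H G : sgraph) : Prop :=
  exists S : {set G}, H ≃ induced S.

Definition connected (G : sgraph) : Prop :=
  forall x y : G, connect (@adj G) x y.

Section Invariants.
Variable G : sgraph.

Definition clique (S : {set G}) : bool :=
  [forall x in S, forall y in S, (x != y) ==> (x -- y)].

Definition independent (S : {set G}) : bool :=
  [forall x in S, forall y in S, ~~ (x -- y)].

Definition clique_number : nat := \max_(S : {set G} | clique S) #|S|.

Definition colourable (k : nat) : bool :=
  [exists f : {ffun G -> 'I_k}, forall x, forall y, (x -- y) ==> (f x != f y)].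

Lemma colourable_ex : exists k, colourable k.
Proof.
exists #|G|; apply/existsP; exists [ffun x => enum_rank x].
apply/forallP => x; apply/forallP => y; apply/implyP => xy.
rewrite !ffunE (inj_eq enum_rank_inj); apply/eqP => exy.
by move: xy; rewrite exy adj_irrefl.
Qed.

Definition chromatic_number : nat := ex_minn colourable_ex.

End Invariants.

Definition omega_colourable (G : sgraph) : Prop :=
  chromatic_number G = clique_number G.

Definition perfect (G : sgraph) : Prop :=
  forall S : {set G}, omega_colourable (induced S).

Definition Kn (n : nat) : sgraph := sym_graph (fun _ _ : 'I_n => true).

Definition Pn (n : nat) : sgraph :=
  sym_graph (fun i j : 'I_n => j == i.+1 :> nat).

(* Only meaningful for n >= 3. *)
Definition Cn (n : nat) : sgraph := sym_graph (fun i j : 'I_n => j == ordS i).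

Definition Kmn (m n : nat) : sgraph :=
  sym_graph (fun x y : 'I_m + 'I_n =>
    match x, y with inl _, inr _ => true | _, _ => false end).

Definition compl (G : sgraph) : sgraph := sym_graph (fun x y : G => ~~ (x -- y)).

Definition disj_union (G H : sgraph) : sgraph :=
  sym_graph (fun a b : G + H =>
    match a, b with
    | inl x, inl y => x -- y
    | inr x, inr y => x -- y
    | _, _ => false
    end).

Definition copies (k : nat) (G : sgraph) : sgraph :=
  sym_graph (fun a b : 'I_k * G => (a.1 == b.1) && (a.2 -- b.2)).

Definition delete_edge (G : sgraph) (u v : G) : sgraph :=
  sym_graph (fun x y : G => (x -- y) && ([set x; y] != [set u; v])).

(* In the next two constructions [None] is the new vertex; [subdivide_edge u v]
   is meant for adjacent [u] and [v]. *)
Definition add_pendant (G : sgraph) (u : G) : sgraph :=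
  sym_graph (fun a b : option G =>
    match a, b with
    | Some x, Some y => x -- y
    | None, Some y => y == u
    | _, _ => false
    end).

Definition subdivide_edge (G : sgraph) (u v : G) : sgraph :=
  sym_graph (fun a b : option G =>
    match a, b with
    | Some x, Some y => (x -- y) && ([set x; y] != [set u; v])
    | None, Some y => y \in [set u; v]
    | _, _ => false
    end).

Notation "G ⊎ H" := (disj_union G H) (at level 50, left associativity)
  : graph_scope.

Definition K13 : sgraph := Kmn 1 3.
Definition K13p : sgraph := @subdivide_edge K13 (inl ord0) (inr ord0).
Definition D : sgraph := @delete_edge (Kn 4) ord0 ord_max.
Definition Z1 : sgraph := @add_pendant (Kn 3) ord0.
Definition Z2 : sgraph := @subdivide_edge Z1 None (Some ord0).

Definition odd_cycle (G : sgraph) : Prop :=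
  exists n, [/\ 3 <= n, odd n & G ≃ Cn n].

Definition independence_ge3 (G : sgraph) : Prop :=
  exists S : {set G}, independent S /\ #|S| = 3.

Definition graph_class := sgraph -> Prop.

Definition G_5 : graph_class := fun G => ~ (G ≃ Cn 5).
Definition G_o : graph_class := fun G => ~ odd_cycle G.
Definition G_c5 : graph_class := fun G => connected G /\ ~ (G ≃ Cn 5).
Definition G_alpha : graph_class := fun G => independence_ge3 G.
Definition G_oalpha : graph_class :=
  fun G => independence_ge3 G /\ ~ odd_cycle G.
Definition G_calpha : graph_class :=
  fun G => connected G /\ independence_ge3 G.
Definition G_co : graph_class := fun G => connected G /\ ~ odd_cycle G.
Definition G_coalpha : graph_class :=
  fun G => [/\ connected G, independence_ge3 G & ~ odd_cycle G].

(* A pair is unordered and taken up to isomorphism of its members: every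
   predicate on [gpair] below is invariant under both. *)
Definition gpair : Type := sgraph * sgraph.

Definition X_free (X : gpair) (G : sgraph) : Prop :=
  ~ induced_subgraph X.1 G /\ ~ induced_subgraph X.2 G.

Definition is_pair (X : gpair) (H1 H2 : sgraph) : Prop :=
  (X.1 ≃ H1 /\ X.2 ≃ H2) \/ (X.1 ≃ H2 /\ X.2 ≃ H1).

Definition coll_P1 (X : gpair) : Prop :=
  (induced_subgraph X.1 (Pn 4) \/ induced_subgraph X.2 (Pn 4)) \/
  is_pair X (copies 3 (Kn 1)) (Kn 3) \/
  is_pair X (copies 3 (Kn 1)) Z1 \/
  is_pair X (copies 3 (Kn 1)) D \/
  is_pair X (Kn 1 ⊎ Pn 3) (Kn 3) \/
  is_pair X (Kn 1 ⊎ Pn 3) Z1 \/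
  is_pair X (Kn 1 ⊎ Pn 3) D \/
  is_pair X (copies 2 (Kn 1) ⊎ Kn 2) (Kn 3) \/
  is_pair X (copies 2 (Kn 1) ⊎ Kn 2) Z1.

Definition coll_I (X : gpair) : Prop :=
  X.1 ≃ copies 3 (Kn 1) \/ X.2 ≃ copies 3 (Kn 1).

Definition coll_P2 (X : gpair) : Prop :=
  coll_P1 X \/ coll_I X \/
  (X.1 ≃ Kn 1 ⊎ Pn 3 /\ induced_subgraph X.2 (compl (Kn 3 ⊎ Pn 4))) \/
  (X.2 ≃ Kn 1 ⊎ Pn 3 /\ induced_subgraph X.1 (compl (Kn 3 ⊎ Pn 4))).

Definition coll_P2c (X : gpair) : Prop :=
  coll_P2 X \/
  is_pair X K13 (copies 2 (Kn 2)) \/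
  is_pair X K13 (Pn 5).

Definition coll_P3 (X : gpair) : Prop :=
  coll_P1 X \/
  is_pair X K13 (Kn 3) \/
  is_pair X K13 Z1 \/
  is_pair X K13p (Kn 3) \/
  is_pair X K13p Z1.

Definition coll_P4 (X : gpair) : Prop :=
  coll_P2c X \/ coll_P3 X \/
  is_pair X K13 (Kn 1 ⊎ Kn 3) \/
  is_pair X K13 Z2.

Definition coll_Omega1 (X : gpair) : Prop :=
  coll_P1 X \/ is_pair X (copies 2 (Kn 1) ⊎ Kn 2) D.

Definition coll_Omega2 (X : gpair) : Prop :=
  coll_P2 X \/
  is_pair X (copies 2 (Kn 1) ⊎ Kn 2) D \/
  is_pair X (copies 2 (Kn 1) ⊎ Kn 2) (compl (Kn 1 ⊎ Pn 4)).

Definition coll_Omega2c (X : gpair) : Prop :=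
  coll_P2c X \/
  is_pair X (copies 2 (Kn 1) ⊎ Kn 2) D \/
  is_pair X (copies 2 (Kn 1) ⊎ Kn 2) (compl (Kn 1 ⊎ Pn 4)).

Definition coll_Omega3 (X : gpair) : Prop :=
  coll_P3 X \/ is_pair X (copies 2 (Kn 1) ⊎ Kn 2) D.

Definition coll_Omega4 (X : gpair) : Prop :=
  coll_P4 X \/
  is_pair X (copies 2 (Kn 1) ⊎ Kn 2) D \/
  is_pair X (copies 2 (Kn 1) ⊎ Kn 2) (compl (Kn 1 ⊎ Pn 4)).

Definition every_free_perfect (C : graph_class) (X : gpair) : Prop :=
  forall G : sgraph, C G -> X_free X G -> perfect G.

Definition every_free_omega_colourable (C : graph_class) (X : gpair) : Prop :=
  forall G : sgraph, C G -> X_free X G -> omega_colourable G.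

(* Main.v *)
Require Import Defs.
From mathcomp Require Import all_boot all_order all_algebra zify ring.

(** Both implications are reduced to statements about small graphs.

    Necessity.  Suppose that every X-free graph of a class is omega-colourable.  A
    graph of the class with chi > omega then contains a member of X.  Start from one
    such graph: a member of X is among its finitely many induced subgraphs.  If this
    does not yet place X in the collection, another such graph avoids this member,
    hence contains the other one, and finitely many pairs remain.  Each of those
    outside the collection is refuted by a further graph.  Sixteen graphs suffice for
    all classes; they are derived from [C_5], [C_7] and the complement of [C_7],
    except for a line graph.  Finite graphs are encoded by the upper triangles of
    their adjacency matrices, so that the search ([search], [searchP]) is an
    evaluation.  For perfection there is one more graph, an omega-colourable but
    imperfect one, which excludes the pairs that only ensure omega-colourability
    ([perfect_exclude]).

    Sufficiency.  Since the induced subgraph relation is respected, few pairs matter: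
    a subgraph of [P_4] alone; the co-paw with the paw, the diamond or the complement
    of [K_3] and [P_4]; the co-diamond with the paw or the gem; the claw with [P_5] or
    the hammer [Z_2]; the fork [K_{1,3}^+] with the paw.  The strong perfect graph
    theorem is replaced by the theory of minimal imperfect graphs.  Gasparyan's linear
    algebra argument ([MI_families], [MI_structure]) gives the theorems of Lovasz and
    Padberg: such a graph has [alpha * omega + 1] vertices, every vertex is in exactly
    [omega] maximum cliques and [alpha] maximum stable sets, and the colour classes of
    an omega-colouring of [G - v] are unique, so that any two of them span a connected
    graph ([MI_kempe]).  Consequently, if [omega = 2] the graph is an odd cycle, and if
    [alpha = 2] its complement is one ([MI_hole], [MI_antihole]).  In a [P_4]-free
    graph two colour classes would be completely joined, which gives too large a
    clique ([P4_free_perfect]).  In a claw-free graph they span a path or an even cycle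
    on [2 * alpha] vertices, which contains a [P_5] if [alpha >= 3] ([claw_P5]) and
    leads to a contradiction without a hammer if moreover [omega >= 3]
    ([hammer_not_MI]).  What remains is to see how a vertex can be attached to an odd
    cycle or to its complement; [antihole_no_stable3] does this for claw-free graphs.
    The pairs with a paw or co-paw are reduced to [alpha <= 2], to [omega <= 2] or to
    [P_4]-free graphs by Olariu's theorem ([olariu]).  Finally a graph without
    co-diamond and gem, with a stable set of size 3, may be imperfect; but removing a
    maximum stable set lowers its clique number ([codiamond_gem]). *)

Set Implicit Arguments.
Unset Strict Implicit.
Unset Printing Implicit Defensive.
Local Open Scope nat_scope.
Local Open Scope graph_scope.

(** * Embeddings and adjacency codes *)

Definition embeds (H G : sgraph) : Prop :=
  exists2 f : H -> G, injective f & forall x y, (f x -- f y) = (x -- y).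

Lemma induced_subgraphP (H G : sgraph) : induced_subgraph H G <-> embeds H G.
Proof.
split=> [[S [f [g gK fK] fE]]|[f fI fE]].
  exists (fun x => val (f x)); last by move=> x y; rewrite -fE.
  by apply: inj_comp; [exact: val_inj | exact: can_inj gK].
exists [set f x | x : H].
have fS x : f x \in [set f x | x : H] by apply: imset_f.
exists (fun x => exist _ (f x) (fS x) : induced [set f x | x : H]) => //.
apply: inj_card_bij => [x y [] /fI //|].
by rewrite card_sig (card_imset _ fI) max_card.
Qed.

Lemma embeds_refl (G : sgraph) : embeds G G.
Proof. by exists id. Qed.

Lemma embeds_trans (G H K : sgraph) : embeds G H -> embeds H K -> embeds G K.
Proof.
move=> [f fI fE] [g gI gE]; exists (g \o f) => [|x y /=].
  exact: inj_comp.
by rewrite gE fE.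
Qed.

Lemma embeds_induced (G : sgraph) (S : {set G}) : embeds (induced S) G.
Proof. by exists val => //; exact: val_inj. Qed.

Lemma iso_embeds (G H : sgraph) : G ≃ H -> embeds G H.
Proof. by move=> [f /bij_inj fI fE]; exists f. Qed.

Lemma iso_sym (G H : sgraph) : G ≃ H -> H ≃ G.
Proof.
move=> [f [g gK fK] fE]; exists g => [|x y]; first by exists f.
by rewrite -fE !fK.
Qed.

(** The code of a list of vertices is the strict upper triangle of its
    adjacency matrix, so that two repetition-free lists with the same code
    span isomorphic subgraphs. *)
Definition code := seq (seq bool).

Fixpoint rows (G : sgraph) (xs : seq G) : code :=
  if xs is x :: ys then [seq x -- y | y <- ys] :: rows ys else [::].

Definition contains (p : code) (G : sgraph) : Prop :=
  exists2 xs : seq G, uniq xs & rows xs = p.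

Definition coded (H : sgraph) (p : code) : Prop :=
  exists hs : seq H, [/\ uniq hs, forall x, x \in hs & rows hs = p].

Lemma size_rows (G : sgraph) (xs : seq G) : size (rows xs) = size xs.
Proof. by elim: xs => //= x xs ->. Qed.

Lemma rows_map (H G : sgraph) (f : H -> G) (hs : seq H) :
  (forall x y, (f x -- f y) = (x -- y)) -> rows (map f hs) = rows hs.
Proof.
move=> fE; elim: hs => //= x hs ->; congr (_ :: _).
by rewrite -map_comp; apply: eq_map => y /=.
Qed.

Lemma rows_nth (H G : sgraph) (h0 : H) (g0 : G) (hs : seq H) (xs : seq G) i j :
  rows hs = rows xs -> i < size hs -> j < size hs ->
  (nth h0 hs i -- nth h0 hs j) = (nth g0 xs i -- nth g0 xs j).
Proof.
elim: hs xs i j => [|h hs IH] [|x xs] //= i j [E1 E2].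
have S : size hs = size xs by rewrite -size_rows E2 size_rows.
have E1n k : k < size hs -> (h -- nth h0 hs k) = (x -- nth g0 xs k).
  move=> lk; rewrite -(nth_map h0 false (adj h)) // E1 (nth_map g0) //.
  by rewrite -S.
case: i j => [|i] [|j] /=; rewrite ?ltnS ?adj_irrefl //; first by move=> _ /E1n.
  by move=> /E1n lk _; rewrite adj_sym lk adj_sym.
by move=> li lj; apply: IH.
Qed.

Lemma rows_embedding (H G : sgraph) (hs : seq H) (xs : seq G) :
  (forall x, x \in hs) -> uniq xs -> rows hs = rows xs ->
  exists f : H -> G, [/\ injective f, forall x y, (f x -- f y) = (x -- y) &
    forall x, f x \in xs].
Proof.
move=> hF xU E; have S : size hs = size xs by rewrite -size_rows E size_rows.
case: xs xU E S => [|g0 xs] xU E S.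
  have {}S (x : H) : False by have := hF x; rewrite (size0nil S).
  by exists (fun x => False_rect _ (S x)); split=> x; case: (S x).
have lt x : index x hs < size (g0 :: xs) by rewrite -S index_mem.
exists (fun x => nth g0 (g0 :: xs) (index x hs)); split=> [x y|x y|x].
- move/eqP; rewrite nth_uniq // => /eqP e.
  by rewrite -[x](nth_index x (hF x)) e nth_index.
- by rewrite -(rows_nth x g0 E) ?index_mem // !nth_index.
- by rewrite mem_nth.
Qed.

Lemma coded_embeds (H G : sgraph) p : coded H p -> (embeds H G <-> contains p G).
Proof.
move=> [hs [hU hF hE]]; split=> [[f fI fE]|[xs xU xE]].
  by exists (map f hs); rewrite ?map_inj_uniq // rows_map.
have [|f [fI fE _]] := rows_embedding hF xU; first by rewrite hE.
by exists f.
Qed.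

Lemma coded_iso (H G : sgraph) p : coded H p -> coded G p -> H ≃ G.
Proof.
move=> [hs [hU hF hE]] [xs [xU xF xE]].
have [|f [fI fE _]] := rows_embedding hF xU; first by rewrite hE.
have [|g [gI _ _]] := rows_embedding xF hU; first by rewrite xE.
by exists f => //; apply: inj_card_bij => //; apply: leq_card gI.
Qed.

Lemma coded_of_iso (H G : sgraph) p : H ≃ G -> coded G p -> coded H p.
Proof.
move=> /iso_sym [f [g fK gK] fE] [xs [xU xF xE]]; exists (map f xs); split.
- by rewrite map_inj_uniq //; exact: can_inj fK.
- by move=> x; rewrite -[x]gK map_f.
- by rewrite rows_map.
Qed.

(** A code is also a graph, on an initial segment of the integers, about which
    all the questions needed here are decided by evaluation. *)
Definition cadj (c : code) (i j : nat) : bool :=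
  if i < j then nth false (nth [::] c i) (j - i.+1)
  else if j < i then nth false (nth [::] c j) (i - j.+1) else false.

Lemma cadj_sym c : symmetric (cadj c).
Proof. by move=> i j; rewrite /cadj; case: ltngtP. Qed.

Lemma cadj_irrefl c : irreflexive (cadj c).
Proof. by move=> i; rewrite /cadj ltnn. Qed.

Definition cgraph (c : code) : sgraph :=
  @SGraph 'I_(size c) (fun i j => cadj c i j)
    (fun i j => cadj_sym c i j) (fun i => cadj_irrefl c i).

Fixpoint crows (c : code) (s : seq nat) : code :=
  if s is i :: t then [seq cadj c i j | j <- t] :: crows c t else [::].

Lemma rows_cgraph c (xs : seq (cgraph c)) :
  rows xs = crows c (map (@nat_of_ord _) xs).
Proof. by elim: xs => //= x xs ->; rewrite -map_comp. Qed.

Definition positions (c : code) (s : seq nat) : bool :=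
  uniq s && all (fun i => i < size c) s.

Lemma positionsP c s : positions c s ->
  exists xs : seq (cgraph c), map (@nat_of_ord _) xs = s.
Proof.
move=> /andP [_ /allP H].
have {}H : all (fun i => i < size c) s by apply/allP.
exists (pmap insub s); elim: s H => //= i s IH /andP [li /IH {}IH].
by rewrite insubT /= IH.
Qed.

Lemma crows_nth (G : sgraph) (x0 : G) (xs : seq G) s :
  all (fun i => i < size xs) s ->
  crows (rows xs) s = rows [seq nth x0 xs i | i <- s].
Proof.
have R i j : i < size xs -> j < size xs ->
    cadj (rows xs) i j = (nth x0 xs i -- nth x0 xs j).
  wlog lij : i j / i <= j => [W li lj|].
    by case: (leqP i j) => [/W->//|/ltnW/W W']; rewrite cadj_sym W' // adj_sym.
  move: lij; rewrite leq_eqVlt => /predU1P[->|lij].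
    by rewrite cadj_irrefl adj_irrefl.
  rewrite /cadj lij; elim: xs i j lij => //= x xs IH [|i] [|j] //= lij li lj.
    by rewrite subSS subn0 (nth_map x0).
  by rewrite subSS; apply: IH.
elim: s => //= i s IH /andP [li ls]; rewrite IH //; congr (_ :: _).
rewrite -map_comp; apply/eq_in_map => j js /=; rewrite R //.
by move/allP: ls; apply.
Qed.

Lemma size_crows c s : size (crows c s) = size s.
Proof. by elim: s => //= i s ->. Qed.

Lemma drop_crows c s t : drop (size s) (crows c (s ++ t)) = crows c t.
Proof. by elim: s => //=; rewrite drop0. Qed.

(** As [has], but stopping at the first success under call by value. *)
Definition some (T : Type) (a : pred T) (s : seq T) : bool := find a s < size s.

Lemma some_has (T : Type) (a : pred T) (s : seq T) : some a s = seq.has a s.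
Proof. by rewrite has_find. Qed.

(** A pattern is searched for from its last vertex to its first one: [ys] holds
    the images chosen so far, and [q] the remaining rows in reverse order. *)
Fixpoint extends (c q : code) (ys : seq nat) : bool :=
  if q is r :: q' then
    some (fun x => if (x \notin ys) && ([seq cadj c x y | y <- ys] == r)
                   then extends c q' (x :: ys) else false)
      (iota 0 (size c))
  else true.

Definition emb (p c : code) : bool :=
  if size p <= size c then extends c (rev p) [::] else false.

Lemma extendsP c q ys : positions c ys ->
  reflect (exists2 s, positions c (s ++ ys) & crows c (s ++ ys) = rev q ++ crows c ys)
    (extends c q ys).
Proof.
elim: q ys => [|r q IH] ys pys /=.
  by apply: ReflectT; exists [::].
rewrite some_has; apply: (iffP hasP) => [[x]|[s]].
  rewrite mem_iota add0n => /andP [_ lx]; case: ifP => // /andP [xy /eqP rE].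
  have pxy : positions c (x :: ys).
    by case/andP: pys => u a; rewrite /positions /= xy u lx a.
  move=> /(IH _ pxy) [s ps sE]; exists (rcons s x); rewrite cat_rcons //.
  by rewrite sE /= rE rev_cons cat_rcons.
rewrite rev_cons cat_rcons; case: (lastP s) => [|{}s x]; last first.
  rewrite cat_rcons => ps sE; have pxy : positions c (x :: ys).
    case/andP: ps => + a; rewrite cat_uniq => /and3P [_ _ u].
    by rewrite /positions u; move: a; rewrite all_cat => /andP [].
  have S : size s = size (rev q).
    by have := congr1 size sE; rewrite !(size_cat, size_crows) /= size_crows; lia.
  have [rE] : [seq cadj c x y | y <- ys] = r.
    have := congr1 (drop (size s)) sE; rewrite drop_crows S drop_size_cat //.
    by case.
  case/andP: (pxy) => /= /andP [xy _] /andP [lx _].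
  exists x; first by rewrite mem_iota.
  by rewrite xy rE eqxx /=; apply/IH => //; exists s; rewrite // sE /= rE.
move=> /= _ /(congr1 size) /eqP; rewrite size_cat /= -[X in X == _]add0n.
by rewrite -addSnnS eqn_add2r size_rev.
Qed.

Lemma embP p c : reflect (exists2 s, positions c s & crows c s = p) (emb p c).
Proof.
have E := extendsP (rev p) (isT : positions c [::]); rewrite /emb.
case: leqP => [_|lt].
  apply: (iffP E) => -[s]; first by rewrite !cats0 revK => ps pE; exists s.
  by move=> ps pE; exists s; rewrite !cats0 ?revK.
apply: ReflectF => -[s /andP [su sA] sE]; move: lt; rewrite ltnNge -sE size_crows.
rewrite -[X in _ <= X](size_iota 0) => /negP []; apply: uniq_leq_size su _.
by move=> i /(allP sA); rewrite mem_iota.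
Qed.

Lemma contains_rows (G : sgraph) p (xs : seq G) :
  uniq xs -> emb p (rows xs) -> contains p G.
Proof.
move=> xU /embP [s /andP [sU sA] sE].
case: xs xU sE sA => [|x0 xs] xU sE sA.
  by exists [::] => //; rewrite -sE; case: s sA {sU sE}.
rewrite size_rows in sA.
exists [seq nth x0 (x0 :: xs) i | i <- s]; last by rewrite -crows_nth.
rewrite map_inj_in_uniq // => i j /(allP sA) li /(allP sA) lj /eqP.
by rewrite nth_uniq // => /eqP.
Qed.

Lemma contains_emb (G : sgraph) p q : emb p q -> contains q G -> contains p G.
Proof. by move=> e [xs xU xE]; apply: (contains_rows xU); rewrite xE. Qed.

Lemma coded_contains (G : sgraph) p c :
  coded G c -> (contains p G <-> emb p c).
Proof.
move=> [xs [xU xF <-]]; split=> [[ys yU <-]|]; last exact: contains_rows.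
apply/embP; exists [seq index y xs | y <- ys].
  rewrite /positions map_inj_uniq ?yU /=.
    by apply/allP => i /mapP [y _ ->]; rewrite size_rows index_mem.
  by move=> x y e; rewrite -[x](nth_index x (xF x)) e nth_index.
case: ys yU => // y0 ys _; rewrite (crows_nth y0); last first.
  by apply/allP => i /mapP [y _ ->]; rewrite index_mem.
rewrite -map_comp map_id_in // => y _ /=; exact: nth_index.
Qed.

Lemma coded_rows (G : sgraph) : coded G (rows (enum G)).
Proof.
by exists (enum G); rewrite enum_uniq; split=> // x; rewrite mem_enum.
Qed.

Lemma contains_dec (G : sgraph) p : contains p G \/ ~ contains p G.
Proof.
case E: (emb p (rows (enum G))); [left | right].
  exact/(coded_contains _ (coded_rows G)).
by move/(coded_contains _ (coded_rows G)); rewrite E.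
Qed.

Lemma embeds_dec (H G : sgraph) : embeds H G \/ ~ embeds H G.
Proof.
have cH := coded_rows H; have [c|n] := contains_dec G (rows (enum H)).
  by left; apply/(coded_embeds _ cH).
by right; move/(coded_embeds _ cH).
Qed.

Definition free (p : code) (G : sgraph) : Prop := ~ contains p G.

Lemma free_emb (G : sgraph) p q : emb p q -> free p G -> free q G.
Proof. by move=> e F h; case: (F (contains_emb e h)). Qed.

Lemma free_embeds (H G : sgraph) p : embeds H G -> free p G -> free p H.
Proof.
move=> [f fI fE] F [xs xU xE]; apply: F; exists (map f xs).
  by rewrite map_inj_uniq.
by rewrite rows_map.
Qed.

Fixpoint subseqs (s : seq nat) : seq (seq nat) :=
  if s is i :: t then let r := subseqs t in r ++ [seq i :: u | u <- r]
  else [:: [::]].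

Lemma subseqsP s t : subseq t s -> t \in subseqs s.
Proof.
elim: s t => [|i s IH] [|j t] //=; rewrite mem_cat.
- by move=> _; rewrite IH ?sub0seq.
- case: eqP => [->|_] /IH H; last by rewrite H.
  by rewrite map_f ?orbT.
Qed.

Definition isob (h p : code) : bool :=
  if size h == size p then emb p h else false.

Fixpoint nub (s : seq code) : seq code :=
  if s is h :: t then let u := nub t in if some (isob h) u then u else h :: u
  else [::].

Lemma nubP h s : h \in s -> exists2 p, p \in nub s & p = h \/ isob h p.
Proof.
elim: s => //= g s IH; rewrite inE => /predU1P [->|/IH [p ps hp]].
  rewrite some_has; case: ifP => [/hasP [p ps gp]|_]; first by exists p => //; right.
  by exists g; [exact: mem_head | left].
by exists p => //; case: ifP => //; rewrite inE ps orbT.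
Qed.

Lemma coded_isob (H : sgraph) h p : coded H h -> isob h p -> coded H p.
Proof.
rewrite /isob => cH; case: eqP => // sz /(proj2 (coded_contains _ cH)) [xs xU xE].
have [hs [hU hF hE]] := cH; exists xs; split => // x.
have sub : {subset xs <= hs} by move=> y _.
have sz' : size hs <= size xs by rewrite -!size_rows hE xE sz.
by have [_ ->] := uniq_min_size xU sub sz'.
Qed.

(** Isomorphic codes are merged, which keeps the later searches short. *)
Definition subcodes (c : code) : seq code :=
  nub [seq crows c s | s <- subseqs (iota 0 (size c))].

Lemma embeds_subcodes (H : sgraph) c :
  embeds H (cgraph c) -> exists2 p, p \in subcodes c & coded H p.
Proof.
move=> [f fI fE]; pose S := [set f x | x : H].
pose xs := [seq x <- enum 'I_(size c) | x \in S].
have [g gK] : exists g : seq H, map f g = xs.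
  have : all [in S] xs by apply/allP => x; rewrite mem_filter => /andP [].
  elim: xs => [|x xs IH] /=; first by exists [::].
  by move=> /andP [/imsetP [h _ ->] /IH [g <-]]; exists (h :: g).
have cg : coded H (rows g).
  exists g; split => //.
    by rewrite -(map_inj_uniq fI) gK filter_uniq // enum_uniq.
  move=> x; rewrite -(mem_map fI) gK mem_filter mem_enum andbT.
  exact: imset_f.
have gs : rows g \in [seq crows c s | s <- subseqs (iota 0 (size c))].
  rewrite -(rows_map _ fE) gK rows_cgraph; apply: map_f; apply: subseqsP.
  rewrite -val_enum_ord; apply: map_subseq; exact: filter_subseq.
have [p ps pg] := nubP gs; exists p => //.
by case: pg => [->//|/(coded_isob cg)].
Qed.

Definition edge_code (n : nat) (es : seq (nat * nat)) : code :=
  [seq [seq ((i, j) \in es) || ((j, i) \in es) | j <- iota i.+1 (n - i.+1)]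
  | i <- iota 0 n].

(** * The graphs of the collections *)

Definition p_P4 := edge_code 4 [:: (0, 1); (1, 2); (2, 3)].
Definition p_3K1 := edge_code 3 [::].
Definition p_K3 := edge_code 3 [:: (0, 1); (0, 2); (1, 2)].
Definition p_paw := edge_code 4 [:: (0, 1); (0, 2); (1, 2); (0, 3)].
Definition p_diamond := edge_code 4 [:: (0, 1); (0, 2); (1, 2); (1, 3); (2, 3)].
Definition p_copaw := edge_code 4 [:: (1, 2); (2, 3)].
Definition p_codiamond := edge_code 4 [:: (2, 3)].
Definition p_claw := edge_code 4 [:: (0, 1); (0, 2); (0, 3)].
Definition p_2K2 := edge_code 4 [:: (0, 1); (2, 3)].
Definition p_P5 := edge_code 5 [:: (0, 1); (1, 2); (2, 3); (3, 4)].
Definition p_fork := edge_code 5 [:: (0, 4); (1, 4); (0, 2); (0, 3)].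
Definition p_K1K3 := edge_code 4 [:: (1, 2); (1, 3); (2, 3)].
Definition p_hammer :=
  edge_code 5 [:: (0, 1); (0, 2); (1, 2); (0, 4); (3, 4)].
Definition p_coK3P4 := edge_code 7
  [:: (0, 3); (0, 4); (0, 5); (0, 6); (1, 3); (1, 4); (1, 5); (1, 6);
      (2, 3); (2, 4); (2, 5); (2, 6); (3, 5); (3, 6); (4, 6)].
Definition p_gem := edge_code 5
  [:: (0, 1); (0, 2); (0, 3); (0, 4); (1, 3); (1, 4); (2, 4)].

Lemma set2_neq (T : finType) (x y u v : T) :
  ([set x; y] != [set u; v])
    = ~~ ((x == u) && (y == v) || (x == v) && (y == u)).
Proof.
congr (~~ _); apply/eqP/idP => [E|]; last first.
  by case/orP => /andP [/eqP-> /eqP->] //; rewrite setUC.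
have: [&& u \in [set x; y], v \in [set x; y], x \in [set u; v] & y \in [set u; v]].
  by rewrite {1 2}E -{3 4}E !inE !eqxx !orbT.
rewrite !inE ![_ == x]eq_sym ![_ == y]eq_sym.
by case: (x == u); case: (x == v); case: (y == u); case: (y == v).
Qed.

Lemma delete_edgeE (G : sgraph) (u v : G) (x y : delete_edge u v) :
  (x -- y) = adj (x : G) y && ~~ ((x == u) && (y == v) || (x == v) && (y == u)).
Proof.
have -> : (x -- y) = (x != y :> G) &&
    ((adj (x : G) y && ([set x; y] != [set u; v])) ||
     (adj (y : G) x && ([set y; x] != [set u; v]))) by [].
rewrite [[set y; x]]setUC [@adj G y x]adj_sym orbb set2_neq.
by case: (x =P y :> G) => [->|_] //=; rewrite adj_irrefl.
Qed.

Lemma subdivide_edgeE (G : sgraph) (u v : G) (a b : subdivide_edge u v) :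
  (a -- b) = match a, b with
    | Some x, Some y =>
        (x -- y) && ~~ ((x == u) && (y == v) || (x == v) && (y == u))
    | None, Some x | Some x, None => (x == u) || (x == v)
    | None, None => false
    end.
Proof.
have E (a' b' : option G) : adj (a' : subdivide_edge u v) b' = (a' != b') &&
    (match a', b' with
     | Some x, Some y => (x -- y) && ([set x; y] != [set u; v])
     | None, Some y => y \in [set u; v] | _, _ => false end
     || match b', a' with
     | Some x, Some y => (x -- y) && ([set x; y] != [set u; v])
     | None, Some y => y \in [set u; v] | _, _ => false end) by [].
rewrite E; case: a b => [x|] [y|]; rewrite ?inE ?orbF //=.
rewrite [[set y; x]]setUC [adj y x]adj_sym orbb set2_neq (inj_eq Some_inj).
by case: (x =P y :> G) => [->|_] //=; rewrite adj_irrefl.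
Qed.

Fixpoint rel_rows (T : Type) (r : rel T) (xs : seq T) : code :=
  if xs is x :: ys then [seq r x y | y <- ys] :: rel_rows r ys else [::].

Lemma rows_rel (G : sgraph) (r : rel G) (xs : seq G) :
  (forall x y, (x -- y) = r x y) -> rows xs = rel_rows r xs.
Proof. by move=> E; elim: xs => //= x xs ->; rewrite (eq_map (E x)). Qed.

Notation ordc n i := (@Ordinal n i isT).

Lemma coded_Pn4 : coded (Pn 4) p_P4.
Proof.
exists [:: ordc 4 0; ordc 4 1; ordc 4 2; ordc 4 3]; split; [by []| |by vm_compute].
by case; do 4?case=> //.
Qed.

Lemma coded_Pn5 : coded (Pn 5) p_P5.
Proof.
exists [:: ordc 5 0; ordc 5 1; ordc 5 2; ordc 5 3; ordc 5 4]; split; [by []| |by vm_compute].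
by case; do 5?case=> //.
Qed.

Lemma coded_Kn3 : coded (Kn 3) p_K3.
Proof.
exists [:: ordc 3 0; ordc 3 1; ordc 3 2]; split; [by []| |by vm_compute].
by case; do 3?case=> //.
Qed.

Lemma coded_Cn5 :
  coded (Cn 5) (edge_code 5 [:: (0, 1); (1, 2); (2, 3); (3, 4); (4, 0)]).
Proof.
exists [:: ordc 5 0; ordc 5 1; ordc 5 2; ordc 5 3; ordc 5 4]; split; [by []| |by vm_compute].
by case; do 5?case=> //.
Qed.

Lemma coded_3K1 : coded (copies 3 (Kn 1)) p_3K1.
Proof.
exists [:: (ordc 3 0, ordc 1 0); (ordc 3 1, ordc 1 0); (ordc 3 2, ordc 1 0)].
split; [by []| |by vm_compute].
by case; case; do 3?case=> //; move=> ?; case; case.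
Qed.

Lemma coded_2K2 : coded (copies 2 (Kn 2)) p_2K2.
Proof.
exists [:: (ordc 2 0, ordc 2 0); (ordc 2 0, ordc 2 1); (ordc 2 1, ordc 2 0); (ordc 2 1, ordc 2 1)].
split; [by []| |by vm_compute].
by case; case; do 2?case=> //; move=> ?; case; do 2?case.
Qed.

Lemma coded_claw : coded K13 p_claw.
Proof.
exists [:: inl (ordc 1 0); inr (ordc 3 0); inr (ordc 3 1); inr (ordc 3 2)].
split; [by []| |by vm_compute].
by case; case; do 3?case=> //.
Qed.

Lemma coded_diamond : coded D p_diamond.
Proof.
exists [:: ordc 4 0; ordc 4 1; ordc 4 2; ordc 4 3]; split; [by []| |].
  by case; do 4?case=> //.
by rewrite (rows_rel _ (@delete_edgeE _ _ _)).
Qed.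

Lemma coded_paw : coded Z1 p_paw.
Proof.
exists [:: Some (ordc 3 0); Some (ordc 3 1); Some (ordc 3 2); None].
split; [by []| |by vm_compute].
by case=> //; case; do 3?case=> //.
Qed.

Lemma coded_hammer : coded Z2 p_hammer.
Proof.
exists [:: Some (Some (ordc 3 0)); Some (Some (ordc 3 1)); Some (Some (ordc 3 2));
           Some None; None].
split; [by []| |].
  by case=> //; case=> //; case; do 3?case=> //.
by rewrite (rows_rel _ (@subdivide_edgeE _ _ _)).
Qed.

Lemma coded_fork : coded K13p p_fork.
Proof.
exists [:: Some (inl (ordc 1 0)); Some (inr (ordc 3 0)); Some (inr (ordc 3 1));
           Some (inr (ordc 3 2)); None].
split; [by []| |].
  by case=> //; case; case; do 3?case=> //.
by rewrite (rows_rel _ (@subdivide_edgeE _ _ _)).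
Qed.

Lemma coded_copaw : coded (Kn 1 ⊎ Pn 3) p_copaw.
Proof.
exists [:: inl (ordc 1 0); inr (ordc 3 0); inr (ordc 3 1); inr (ordc 3 2)].
split; [by []| |by vm_compute].
by case; case; do 3?case=> //.
Qed.

Lemma coded_codiamond : coded (copies 2 (Kn 1) ⊎ Kn 2) p_codiamond.
Proof.
exists [:: inl (ordc 2 0, ordc 1 0); inl (ordc 2 1, ordc 1 0); inr (ordc 2 0); inr (ordc 2 1)].
split; [by []| |by vm_compute].
case; last by case; do 2?case=> //.
by case; case; do 2?case=> //; move=> ?; case; case.
Qed.

Lemma coded_K1K3 : coded (Kn 1 ⊎ Kn 3) p_K1K3.
Proof.
exists [:: inl (ordc 1 0); inr (ordc 3 0); inr (ordc 3 1); inr (ordc 3 2)].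
split; [by []| |by vm_compute].
by case; case; do 3?case=> //.
Qed.

Lemma coded_coK3P4 : coded (compl (Kn 3 ⊎ Pn 4)) p_coK3P4.
Proof.
exists [:: inl (ordc 3 0); inl (ordc 3 1); inl (ordc 3 2);
           inr (ordc 4 0); inr (ordc 4 1); inr (ordc 4 2); inr (ordc 4 3)].
split; [by []| |by vm_compute].
by case; case; do 4?case=> //.
Qed.

Lemma coded_gem : coded (compl (Kn 1 ⊎ Pn 4)) p_gem.
Proof.
exists [:: inl (ordc 1 0); inr (ordc 4 0); inr (ordc 4 1); inr (ordc 4 2); inr (ordc 4 3)].
split; [by []| |by vm_compute].
by case; case; do 4?case=> //.
Qed.

(** * Cliques, stable sets and colourings *)

Lemma adj_neq (G : sgraph) (x y : G) : x -- y -> x != y.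
Proof. by apply: contraTneq => ->; rewrite adj_irrefl. Qed.

Lemma cliqueP (G : sgraph) (S : {set G}) :
  reflect {in S &, forall x y, x != y -> x -- y} (clique S).
Proof.
apply: (iffP forall_inP) => [H x y xS yS xy|H x xS].
  by move/forall_inP: (H x xS) => /(_ y yS); rewrite xy.
by apply/forall_inP => y yS; apply/implyP; apply: H.
Qed.

Lemma independentP (G : sgraph) (S : {set G}) :
  reflect {in S &, forall x y, ~~ (x -- y)} (independent S).
Proof.
apply: (iffP forall_inP) => [H x y xS yS|H x xS].
  by move/forall_inP: (H x xS) => /(_ y yS).
by apply/forall_inP => y yS; apply: H.
Qed.

Lemma colourableP (G : sgraph) k :
  reflect (exists f : G -> 'I_k, forall x y, x -- y -> f x != f y)
    (colourable G k).
Proof.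
apply: (iffP existsP) => [[f H]|[f H]].
  exists f => x y xy; move/forallP: H => /(_ x) /forallP /(_ y).
  by rewrite xy.
exists [ffun x => f x]; apply/forallP => x; apply/forallP => y.
by apply/implyP; rewrite !ffunE; apply: H.
Qed.

Lemma independent_sub (G : sgraph) (S T : {set G}) :
  S \subset T -> independent T -> independent S.
Proof.
move=> /subsetP ST /independentP H; apply/independentP => x y xS yS.
by apply: H; apply: ST.
Qed.

Lemma clique_le (G : sgraph) (S : {set G}) : clique S -> #|S| <= clique_number G.
Proof. by move=> H; rewrite /clique_number (bigmax_sup S). Qed.

Lemma max_clique (G : sgraph) :
  exists2 S : {set G}, clique S & #|S| = clique_number G.
Proof.
have c0 : clique (set0 : {set G}) by apply/cliqueP => x; rewrite inE.
case: (@arg_maxnP _ set0 (@clique G) (fun S : {set G} => #|S|) c0) => S cS Smax.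
exists S => //; apply/eqP; rewrite eqn_leq clique_le //=.
by apply/bigmax_leqP => T cT; apply: Smax.
Qed.

Lemma clique_indep_le1 (G : sgraph) (K S : {set G}) :
  clique K -> independent S -> #|K :&: S| <= 1.
Proof.
move=> /cliqueP cK /independentP iS; apply/card_le1P => x.
rewrite inE => /andP [xK xS] y; rewrite !inE; apply/andP/eqP => [[yK yS]|->//].
by apply/eqP/negPn/negP => xy; move/negP: (iS _ _ yS xS); apply; apply: cK.
Qed.

Lemma colouring_clique (G : sgraph) k (S : {set G}) :
  colourable G k -> clique S -> #|S| <= k.
Proof.
move=> /colourableP [f fP] /cliqueP cS.
rewrite -(@card_in_imset _ _ f); first by apply: leq_trans (max_card _) _; rewrite card_ord.
move=> x y xS yS /eqP e; apply/eqP/negPn/negP => xy.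
by move/negP: (fP _ _ (cS _ _ xS yS xy)).
Qed.

Lemma colourable_mono (G : sgraph) k l : k <= l -> colourable G k -> colourable G l.
Proof.
move=> kl /colourableP [f fP]; apply/colourableP.
by exists (fun x => widen_ord kl (f x)) => x y /fP; apply: contra => /eqP [] /ord_inj->.
Qed.

Lemma colourable_embeds (H G : sgraph) k :
  embeds H G -> colourable G k -> colourable H k.
Proof.
move=> [f fI fE] /colourableP [c cP]; apply/colourableP.
by exists (c \o f) => x y /=; rewrite -fE; apply: cP.
Qed.

Lemma clique_imset (H G : sgraph) (f : H -> G) (S : {set H}) :
  (forall x y, (f x -- f y) = (x -- y)) -> clique S -> clique (f @: S).
Proof.
move=> fE /cliqueP cS; apply/cliqueP => _ _ /imsetP [x xS ->] /imsetP [y yS ->] xy.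
by rewrite fE cS //; apply: contraNneq xy => ->.
Qed.

Lemma clique_number_embeds (H G : sgraph) :
  embeds H G -> clique_number H <= clique_number G.
Proof.
move=> [f fI fE]; have [S cS <-] := max_clique H.
by rewrite -(card_imset _ fI); apply: clique_le; apply: clique_imset.
Qed.

Lemma omega_colourableP (G : sgraph) :
  omega_colourable G <-> colourable G (clique_number G).
Proof.
rewrite /omega_colourable /chromatic_number; case: ex_minnP => m mc mmin.
split=> [<-//|c]; apply/eqP; rewrite eqn_leq mmin //=.
by have [S cS <-] := max_clique G; apply: colouring_clique cS.
Qed.

Lemma omega_colourable_iso (G H : sgraph) :
  G ≃ H -> omega_colourable G -> omega_colourable H.
Proof.
move=> GH /omega_colourableP c; apply/omega_colourableP.
have HG := iso_sym GH.
apply: (colourable_embeds (iso_embeds HG)).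
by apply: colourable_mono c; apply: clique_number_embeds; apply: iso_embeds.
Qed.

Lemma perfect_embeds (H G : sgraph) :
  perfect G -> embeds H G -> omega_colourable H.
Proof.
move=> pG /induced_subgraphP [S HS].
by apply: omega_colourable_iso (iso_sym HS) (pG S).
Qed.

Lemma perfect_omega (G : sgraph) : perfect G -> omega_colourable G.
Proof. by move=> /perfect_embeds; apply; apply: embeds_refl. Qed.

Lemma independence_ge3P (G : sgraph) : independence_ge3 G <-> contains p_3K1 G.
Proof.
split=> [[S [/independentP iS S3]]|[xs xU xE]].
  have := S3; rewrite cardE; case E: (enum S) => [|x [|y [|z []]]] // _.
  have M w : w \in [:: x; y; z] -> w \in S by rewrite -E mem_enum.
  exists [:: x; y; z]; first by rewrite -E enum_uniq.
  have N u v : u \in [:: x; y; z] -> v \in [:: x; y; z] -> (u -- v) = false.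
    by move=> /M uS /M vS; apply/negbTE/iS.
  by rewrite /= !N ?inE ?eqxx ?orbT.
have : size xs = 3 by rewrite -size_rows xE.
case: xs xU xE => [|x [|y [|z []]]] // xU [xy xz yz] _.
exists [set w in [:: x; y; z]]; split; last by rewrite cardsE; apply/card_uniqP.
apply/independentP => u v; rewrite !inE.
do 2!case/or3P => /eqP->; by rewrite ?adj_irrefl ?xy ?xz ?yz // adj_sym ?xy ?xz ?yz.
Qed.

Definition neighbours (G : sgraph) (x : G) : {set G} := [set y | x -- y].

(** ** Clique number and colourability of coded graphs *)

Fixpoint colourings (k : nat) (c : code) : seq (seq nat) :=
  if c is r :: c' then
    flatten [seq [seq a :: cols | a <- iota 0 k &
        all (fun b => ~~ b.1 || (a != b.2)) (zip r cols)]
      | cols <- colourings k c']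
  else [:: [::]].

Lemma colourings_rows (G : sgraph) k (xs : seq G) :
  colourable G k -> ~~ nilp (colourings k (rows xs)).
Proof.
move=> /colourableP [f fP].
suff: [seq nat_of_ord (f x) | x <- xs] \in colourings k (rows xs).
  by case: (colourings _ _).
elim: xs => //= x xs IH; apply/flatten_mapP.
exists [seq nat_of_ord (f x) | x <- xs] => //; apply: map_f.
rewrite mem_filter mem_iota add0n ltn_ord !andbT.
elim: xs {IH} => //= y xs ->; rewrite andbT.
by case E: (x -- y) => //=; apply: fP.
Qed.

Fixpoint complete_code (n : nat) : code :=
  if n is m.+1 then nseq m true :: complete_code m else [::].

Lemma rows_clique (G : sgraph) (xs : seq G) :
  uniq xs -> {in xs &, forall x y, x != y -> x -- y} ->
  rows xs = complete_code (size xs).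
Proof.
elim: xs => //= x xs IH /andP [xxs uxs] H; rewrite IH //; last first.
  by move=> a b axs bxs; apply: H; rewrite inE ?axs ?bxs orbT.
congr (_ :: _); rewrite -(size_map (adj x)); apply/all_pred1P/allP.
move=> _ /mapP [y yxs ->] /=; rewrite eqb_id; apply: H.
- exact: mem_head.
- by rewrite inE yxs orbT.
- by apply: contraNneq xxs => ->.
Qed.

Lemma clique_contains (G : sgraph) (S : {set G}) k :
  clique S -> k <= #|S| -> contains (complete_code k) G.
Proof.
move=> /cliqueP cS kS; exists (take k (enum S)).
  by rewrite take_uniq ?enum_uniq.
rewrite rows_clique ?take_uniq ?enum_uniq ?size_takel -?cardE //.
by move=> x y /mem_take + /mem_take; rewrite !mem_enum; apply: cS.
Qed.

Definition code_omega (c : code) : nat :=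
  find (fun k => ~~ emb (complete_code k.+1) c) (iota 0 (size c)).

Definition code_bad (c : code) : bool :=
  (code_omega c < size c) && nilp (colourings (code_omega c) c).

Definition wf (c : code) : bool := crows c (iota 0 (size c)) == c.

Lemma coded_cgraph c : wf c -> coded (cgraph c) c.
Proof.
move=> /eqP cE; have [|xs xE] := @positionsP c (iota 0 (size c)).
  by rewrite /positions iota_uniq; apply/allP => i; rewrite mem_iota.
exists xs; split; last by rewrite rows_cgraph xE.
  by rewrite -(map_inj_uniq val_inj) /= xE iota_uniq.
by move=> x; rewrite -(mem_map val_inj) /= xE mem_iota /= add0n.
Qed.

Lemma code_badP (G : sgraph) c : coded G c -> code_bad c -> ~ omega_colourable G.
Proof.
move=> cG /andP [lt nC] /omega_colourableP col; set k := code_omega c in lt nC.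
have /(nth_find 0) nK :
    seq.has (fun k => ~~ emb (complete_code k.+1) c) (iota 0 (size c)).
  by rewrite has_find size_iota.
rewrite nth_iota // add0n -/(code_omega c) -/k in nK.
have [S cS Sw] := max_clique G.
have wk : clique_number G <= k.
  rewrite leqNgt -Sw; apply/negP => /(clique_contains cS) cK.
  by move/negP: nK; apply; apply/(coded_contains _ cG).
have [xs [_ _ xE]] := cG.
by have := colourings_rows xs (colourable_mono wk col); rewrite xE nC.
Qed.

(** * Minimal imperfect graphs *)

(** The linear algebra behind Lovasz's and Padberg's theorems concerns a family of
    pairs of sets such that [K j] meets [S i] once if [i != j], and is disjoint
    from it if [i = j]. *)

Section CrossFamilies.
Import GRing.Theory Num.Theory.
Local Open Scope ring_scope.

Definition co1_inv m : 'M[rat]_m := const_mx (m.-1%:R^-1) - 1%:M.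

Lemma co1_invK m : (1 < m)%N -> (const_mx 1 - 1%:M) *m co1_inv m = 1%:M.
Proof.
move=> m1; have m0 : (m.-1%:R : rat) != 0 by rewrite pnatr_eq0; lia.
rewrite /co1_inv mulmxBl mul1mx mulmxBr mulmx1 opprB.
have -> : (const_mx 1 : 'M[rat]_m) *m const_mx (m.-1%:R^-1)
    = const_mx (m%:R / m.-1%:R) :> 'M_m.
  apply/matrixP => i j; rewrite !mxE (eq_bigr (fun=> m.-1%:R^-1)) => [|k _].
    by rewrite sumr_const card_ord mulr_natl.
  by rewrite !mxE mul1r.
apply/matrixP => i j; rewrite !mxE.
have -> : m%:R / m.-1%:R = 1 + m.-1%:R^-1 :> rat.
  rewrite -{1}[m]prednK; last by lia.
  by rewrite -natr1 mulrDl divff // mul1r.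
ring.
Qed.

Variables (I V : finType) (S K : I -> {set V}).
Hypotheses (I1 : (1 < #|I|)%N) (cross : forall i j, #|K j :&: S i| = (i != j)).

Let inS m (e : 'I_m -> I) : 'M[rat]_(m, #|V|) :=
  \matrix_(i, x) (enum_val x \in S (e i))%:R.
Let inK m (e : 'I_m -> I) : 'M[rat]_(#|V|, m) :=
  \matrix_(x, i) (enum_val x \in K (e i))%:R.

Let sumV (F : V -> rat) :
  \sum_(x < #|V|) F (enum_val x) = \sum_(x : V) F x.
Proof.
by rewrite [RHS](reindex (@enum_val V V)) //; apply/onW_bij/enum_val_bij.
Qed.

Lemma cross_mx m (e : 'I_m -> I) : injective e ->
  inS e *m inK e = const_mx 1 - 1%:M.
Proof.
move=> eI; apply/matrixP => i j; rewrite !mxE.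
under eq_bigr do rewrite !mxE.
rewrite (sumV (fun x => (x \in S (e i))%:R * (x \in K (e j))%:R)).
have -> : \sum_(x : V) (x \in S (e i))%:R * (x \in K (e j))%:R
    = #|K (e j) :&: S (e i)|%:R :> rat.
  rewrite -sum1_card natr_sum [RHS]big_mkcond /=; apply: eq_bigr => x _.
  by rewrite inE; case: (x \in S _); case: (x \in K _); rewrite ?mulr1 ?mul0r.
rewrite cross.
by rewrite (inj_eq eI) eq_sym; case: (j == i); rewrite ?subrr ?subr0.
Qed.

(** The incidence matrices of the two families multiply to the invertible
    matrix with 0 on the diagonal and 1 elsewhere; hence there are at most as
    many pairs as vertices. *)
Lemma cross_card : (#|I| <= #|V|)%N.
Proof.
have := co1_invK I1; rewrite -(cross_mx (@enum_val_inj I I)) -mulmxA.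
exact: mulmx1_min.
Qed.

(** When there are as many pairs as vertices, the product of the incidence
    matrices in the other order is controlled too. *)
Lemma cross_dual a : #|I| = #|V| -> (forall x, #|[set i | x \in S i]| = a) ->
  forall x y, (#|[set i | x \in K i]| * a =
    #|I|.-1 * (#|[set i | (x \in K i) && (y \in S i)]| + (x == y)))%N.
Proof.
move=> IV Sa x y; pose e (k : 'I_#|V|) : I := enum_val (cast_ord (esym IV) k).
have eI : injective e by move=> k l /enum_val_inj /cast_ord_inj.
have eB : bijective e by apply: inj_card_bij; rewrite ?card_ord ?IV.
have sumI (F : I -> nat) : (\sum_(k < #|V|) F (e k) = \sum_i F i)%N.
  by rewrite [RHS](reindex e) //; apply: onW_bij.
have m1 : (1 < #|V|)%N by rewrite -IV.
have := co1_invK m1; rewrite -(cross_mx eI) -mulmxA => /mulmx1C.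
move=> /matrixP /(_ (enum_rank x) (enum_rank y)).
rewrite /co1_inv mulmxBr mulmx1 mulmxBl !mxE (inj_eq enum_rank_inj).
set c := (_.-1%:R)^-1.
have cardE (P : pred I) : #|[set i | P i]|%:R = \sum_(k < #|V|) (P (e k))%:R :> rat.
  rewrite -natr_sum (sumI (fun i => P i : nat)) -sum1_card big_mkcond /=.
  by congr _%:R; apply: eq_bigr => i _; rewrite inE; case: (P i).
have -> : \sum_j (inK e *m const_mx c) (enum_rank x) j * inS e j (enum_rank y)
   = #|[set i | x \in K i]|%:R * a%:R * c.
  rewrite -(Sa y) !cardE mulrAC mulr_sumr; apply: eq_bigr => j _.
  rewrite !mxE !enum_rankK; congr (_ * _); rewrite mulr_suml.
  by apply: eq_bigr => i _; rewrite !mxE enum_rankK.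
have -> : \sum_j inK e (enum_rank x) j * inS e j (enum_rank y)
   = #|[set i | (x \in K i) && (y \in S i)]|%:R.
  by rewrite cardE; apply: eq_bigr => j _; rewrite !mxE !enum_rankK -natrM mulnb.
have m0 : (#|V|.-1%:R : rat) != 0 by rewrite pnatr_eq0; lia.
move=> /(canRL (addrK _)); rewrite opprK => /(canRL (mulfVK _)) E.
apply/eqP; rewrite -(eqr_nat rat) !natrM natrD E // mulrC IV.
by rewrite addrC.
Qed.

End CrossFamilies.

Lemma card_setI_sum (V : finType) (Q S : {set V}) :
  #|Q :&: S| = \sum_(y in Q) (y \in S).
Proof.
rewrite -sum1_card [LHS]big_mkcond [RHS]big_mkcond; apply: eq_bigr => y _.
by rewrite inE; case: (y \in Q); case: (y \in S).
Qed.

(** Count in two ways the pairs of an index [j] with [x] in [K j] and of a vertex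
    of [Q :&: S j]: the result is [w - (x \in K i0)] as well as [w - (x \in Q)]. *)
Lemma cross_unique (I V : finType) (S K : I -> {set V}) w (Q : {set V}) i0 :
  (forall x y, #|[set i | (x \in K i) && (y \in S i)]| = (x != y)) ->
  (forall x, #|[set i | x \in K i]| = w) ->
  #|Q| = w -> (forall j, #|Q :&: S j| = (j != i0)) -> Q = K i0.
Proof.
move=> N Kw Qw QS; apply/setP => x.
have E : \sum_j (x \in K j) * #|Q :&: S j| = \sum_(y in Q) (x != y).
  transitivity (\sum_j \sum_(y in Q) (x \in K j) && (y \in S j)).
    apply: eq_bigr => j _; rewrite card_setI_sum big_distrr /=.
    by apply: eq_bigr => y _; rewrite mulnb.
  rewrite exchange_big; apply: eq_bigr => y _; rewrite -N -sum1_card.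
  by rewrite [RHS]big_mkcond; apply: eq_bigr => j _; rewrite inE; case: (_ && _).
have E1 : \sum_(y in Q) (x != y) + (x \in Q) = w.
  rewrite -Qw -sum1_card; have [xQ|xQ] := boolP (x \in Q).
    rewrite (bigD1 x) //= eqxx add0n [RHS](bigD1 x) //= addnC; congr (_ + _).
    by apply: eq_bigr => y /andP [_]; rewrite eq_sym => ->.
  rewrite addn0; apply: eq_bigr => y yQ.
  by rewrite (_ : x != y) //; apply: contraNneq xQ => ->.
have E2 : \sum_j (x \in K j) * #|Q :&: S j| + (x \in K i0) = w.
  rewrite -(Kw x) -[RHS]sum1_card [RHS]big_mkcond /= (bigD1 i0) //= QS eqxx muln0 add0n.
  rewrite [RHS](bigD1 i0) //= addnC inE; congr (_ + _).
  apply: eq_bigr => j ji; rewrite QS ji muln1 inE.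
  by case: (x \in K j).
by case: (x \in Q) E1; case: (x \in K i0) E2; lia.
Qed.

Lemma one_zero (I : finType) (a : I -> nat) : 0 < #|I| ->
  (forall j, a j <= 1) -> \sum_j a j = #|I|.-1 ->
  exists i, forall j, a j = (j != i).
Proof.
move=> I0 a1 Sa; have E : #|[set j | a j == 0]| = 1.
  have : \sum_j a j + #|[set j | a j == 0]| = #|I|; last by lia.
  rewrite -!sum1_card [X in _ + X]big_mkcond -big_split /=; apply: eq_bigr => j _.
  by rewrite inE; have := a1 j; case: (a j) => [|[|]].
have /cards1P [i iE] : #|[set j | a j == 0]| == 1 by rewrite E.
exists i => j; move/setP/(_ j): iE; rewrite !inE => <-.
by have := a1 j; case: (a j) => [|[|]].
Qed.

(** ** Stable sets and colourings of induced subgraphs *)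

Definition alpha (G : sgraph) : nat := \max_(S : {set G} | independent S) #|S|.

Lemma independent_le (G : sgraph) (S : {set G}) : independent S -> #|S| <= alpha G.
Proof. by move=> H; rewrite /alpha (bigmax_sup S). Qed.

Lemma max_independent (G : sgraph) :
  exists2 S : {set G}, independent S & #|S| = alpha G.
Proof.
have c0 : independent (set0 : {set G}) by apply/independentP => x; rewrite inE.
case: (@arg_maxnP _ set0 (@independent G) (fun S : {set G} => #|S|) c0) => S cS Smax.
exists S => //; apply/eqP; rewrite eqn_leq independent_le //=.
by apply/bigmax_leqP => T cT; apply: Smax.
Qed.

Definition minimal_imperfect (G : sgraph) : Prop :=
  ~ omega_colourable G /\
  forall S : {set G}, S != setT -> omega_colourable (induced S).

Lemma embeds_card (H G : sgraph) : embeds H G -> #|H| <= #|G|.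
Proof. by move=> [f fI _]; apply: leq_card fI. Qed.

Lemma perfect_dec (G : sgraph) : perfect G \/ ~ perfect G.
Proof.
case: (boolP [forall S : {set G}, colourable (induced S) (clique_number (induced S))]).
  by move=> /forallP all; left=> S; apply/omega_colourableP.
by move=> N; right=> p; case/forallP: N => S; apply/omega_colourableP.
Qed.

(** Take an induced subgraph with the fewest vertices among the imperfect ones. *)
Lemma exists_minimal_imperfect (G : sgraph) :
  ~ perfect G -> exists2 H, embeds H G & minimal_imperfect H.
Proof.
have [n] := ubnP #|G|; elim: n G => // n IH G ltn nP.
have [/existsP [S /andP [ST nc]]|/existsPn all] := boolP [exists S : {set G},
    (S != setT) && ~~ colourable (induced S) (clique_number (induced S))].
  have [||H HS mH] := IH (induced S); last first.
  - exists H => //; exact: embeds_trans (embeds_induced S).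
  - move=> /perfect_omega /omega_colourableP c; by rewrite c in nc.
  - rewrite card_sig; apply: leq_trans (ltn : _ <= n); rewrite -cardsT.
    rewrite (_ : #|_| = #|S|); last by apply: eq_card => x; rewrite !inE.
    by apply: proper_card; rewrite properT.
exists G; first exact: embeds_refl.
have min S : S != setT -> omega_colourable (@induced G S).
  move=> ST; apply/omega_colourableP; move: (all S).
  by rewrite negb_and ST negbK.
split => // cG; apply: nP => S; case: (altP (S =P setT)) => [->|/min//].
apply: omega_colourable_iso cG.
exists (fun x => exist _ x (in_setT x) : induced [set: G]) => //.
by exists val => // -[x xT]; apply: val_inj.
Qed.

Section Restrict.
Variables (G : sgraph) (S : {set G}).

Lemma induced_clique (Q : {set induced S}) :
  clique Q -> [/\ clique (val @: Q), val @: Q \subset S & #|val @: Q| = #|Q|].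
Proof.
move=> cQ; split; last by rewrite card_imset //; exact: val_inj.
  exact: (@clique_imset (induced S) G val Q (fun _ _ => erefl) cQ).
by apply/subsetP => _ /imsetP [x _ ->]; exact: valP.
Qed.

Lemma induced_colouring k : 0 < k -> colourable (induced S) k ->
  exists f : G -> 'I_k, {in S &, forall x y, x -- y -> f x != f y}.
Proof.
move=> k0 /colourableP [f fP].
exists (fun x => if insub x is Some u then f u else Ordinal k0) => x y xS yS xy.
by rewrite !insubT; apply: fP.
Qed.

Lemma induced_clique_number : clique_number (induced S) <= clique_number G.
Proof. exact/clique_number_embeds/embeds_induced. Qed.

End Restrict.

Lemma clique_number_gt0 (G : sgraph) (x : G) : 0 < clique_number G.
Proof.
rewrite -(cards1 x); apply: clique_le; apply/cliqueP => y z.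
by rewrite !inE => /eqP-> /eqP->; rewrite eqxx.
Qed.

Section MinimalImperfect.
Variable G : sgraph.
Hypothesis MI : minimal_imperfect G.
Let w := clique_number G.
Let a := alpha G.

Lemma MI_not_colourable : ~~ colourable G w.
Proof. by apply/negP => /omega_colourableP; apply: (proj1 MI). Qed.

Lemma MI_colour_minus (v : G) :
  exists f : G -> 'I_w, forall x y, x != v -> y != v -> x -- y -> f x != f y.
Proof.
have /omega_colourableP c : omega_colourable (induced [set~ v]).
  by apply: (proj2 MI); apply/eqP => /setP /(_ v); rewrite !inE eqxx.
have c' := colourable_mono (induced_clique_number _) c.
have [f fP] := induced_colouring (clique_number_gt0 v) c'.
by exists f => x y xv yv; apply: fP; rewrite !inE.
Qed.

(** Otherwise colouring [G - S] and giving [S] one more colour would do. *)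
Lemma MI_clique_avoiding (S : {set G}) : independent S ->
  exists Q : {set G}, [/\ clique Q, #|Q| = w & Q :&: S = set0].
Proof.
move=> iS; have [->|S0] := eqVneq S set0.
  by have [Q cQ Qw] := max_clique G; exists Q; rewrite setI0.
have ST : ~: S != setT by rewrite -setC0 (inj_eq (@setC_inj _)).
have /omega_colourableP c := proj2 MI _ ST.
have [Q cQ Qw] := max_clique (induced (~: S)).
have [cQ' QS Qc] := induced_clique cQ; exists (val @: Q); split => //.
  apply/eqP; rewrite eqn_leq clique_le //= leqNgt; apply/negP => lt.
  move/negP: MI_not_colourable; apply.
  have lt' : clique_number (induced (~: S)) < w by rewrite -Qw -Qc.
  have w0 : 0 < w by apply: leq_ltn_trans lt'.
  apply/colourableP.
  have [k0|k0] := posnP (clique_number (induced (~: S))).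
    exists (fun=> Ordinal w0) => x y xy.
    have xS z : z \in S.
      apply: contraT => zS; have zS' : z \in ~: S by rewrite inE.
      by have := clique_number_gt0 (exist _ z zS' : induced (~: S)); rewrite k0.
    by have /independentP /(_ x y (xS x) (xS y)) := iS; rewrite xy.
  have [f fP] := induced_colouring k0 c.
  exists (fun x => if x \in S then Ordinal lt' else widen_ord (ltnW lt') (f x)).
  move=> x y xy; rewrite -val_eqE; case: ifP => xS; case: ifP => yS /=.
  - by have /independentP /(_ x y xS yS) := iS; rewrite xy.
  - by have := ltn_ord (f y); case: ltngtP.
  - by have := ltn_ord (f x); case: ltngtP.
  - by apply: fP; rewrite ?inE ?xS ?yS.
by apply/setP => x; rewrite !inE; apply/andP => -[/(subsetP QS)]; rewrite inE => /negP.
Qed.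

Lemma MI_edge : exists x y : G, x -- y.
Proof.
have [/existsP [x /existsP [y]]|N] := boolP [exists x : G, exists y : G, x -- y].
  by exists x, y.
have E (x y : G) : (x -- y) = false.
  by apply: contraNF N => xy; apply/existsP; exists x; apply/existsP; exists y.
case/negP: MI_not_colourable; apply/colourableP.
have [/card_gt0P [x _]|] := ltnP 0 #|G|.
  by exists (fun=> Ordinal (clique_number_gt0 x)) => y z; rewrite E.
rewrite leqn0 => /eqP G0.
have F (x : G) : False by have := card0_eq G0 x; rewrite inE.
by exists (fun x => False_rect _ (F x)) => x.
Qed.

Lemma MI_omega_ge2 : 2 <= w.
Proof.
have [x [y xy]] := MI_edge; rewrite (_ : 2 = #|[set x; y]|); last first.
  by rewrite cards2 (adj_neq xy).
apply: clique_le; apply/cliqueP => u v; rewrite !inE.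
by do 2!case/orP => /eqP->; rewrite ?eqxx ?xy // adj_sym xy.
Qed.

Lemma MI_nonedge : exists x y : G, x != y /\ ~~ (x -- y).
Proof.
have [/existsP [x /existsP [y /andP [xy nxy]]]|N] :=
    boolP [exists x : G, exists y : G, (x != y) && ~~ (x -- y)].
  by exists x, y.
case/negP: MI_not_colourable; apply: colourable_mono (_ : #|[set: G]| <= _) _.
  apply: clique_le; apply/cliqueP => x y _ _ xy; apply: contraNT N => nxy.
  by apply/existsP; exists x; apply/existsP; exists y; rewrite xy.
rewrite cardsT; apply/colourableP; exists enum_rank => x y /adj_neq.
by rewrite (inj_eq enum_rank_inj).
Qed.

Lemma MI_alpha_ge2 : 2 <= a.
Proof.
have [x [y [xy nxy]]] := MI_nonedge; rewrite (_ : 2 = #|[set x; y]|); last first.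
  by rewrite cards2 xy.
apply: independent_le; apply/independentP => u v; rewrite !inE.
by do 2!case/orP => /eqP->; rewrite ?adj_irrefl // adj_sym.
Qed.

Lemma MI_card_le : #|G| <= (a * w).+1.
Proof.
have [x [y _]] := MI_edge; have [f fP] := MI_colour_minus x.
have E : #|[set~ x]| = #|G|.-1 by rewrite cardsC1.
rewrite -ltnS -(prednK (n := #|G|)); last by apply/card_gt0P; exists x.
rewrite !ltnS -E -sum1_card (partition_big f predT) //=.
apply: leq_trans (_ : \sum_(c < w) a <= _); last first.
  by rewrite sum_nat_const card_ord mulnC.
apply: leq_sum => c _.
rewrite sum1dep_card; apply: independent_le; apply/independentP => u v.
rewrite !inE => /andP [ux /eqP uc] /andP [vx /eqP vc]; apply/negP => uv.
by have := fP _ _ ux vx uv; rewrite uc vc eqxx.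
Qed.

(** Gasparyan's family: a maximum stable set [S0] together with the colour
    classes of the graphs [G - s] for [s] in [S0] covers every vertex [alpha]
    times; a maximum clique thus misses exactly one member of the family, and
    each member is missed by some maximum clique. *)
Lemma MI_families : exists (I : finType) (S K : I -> {set G}),
  [/\ forall i, independent (S i), forall i, clique (K i) /\ #|K i| = w,
      forall i j, #|K j :&: S i| = (i != j), #|I| = (a * w).+1 &
      forall x, #|[set i | x \in S i]| = a].
Proof.
have [S0 iS0] := max_independent G; rewrite -/a => S0a.
have [F FP] := fin_all_exists MI_colour_minus.
pose I : finType := ('I_1 + 'I_#|S0| * 'I_w)%type.
pose S (i : I) : {set G} := match i with
  | inl _ => S0
  | inr (s, c) => [set x | (x != enum_val s) && (F (enum_val s) x == c)] end.
have iS i : independent (S i).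
  case: i => [_|[s c]] //=; apply/independentP => u v; rewrite !inE.
  move=> /andP [us /eqP uc] /andP [vs /eqP vc]; apply/negP => uv.
  by have := FP _ _ _ us vs uv; rewrite uc vc eqxx.
have [K KP] := fin_all_exists (fun i => MI_clique_avoiding (iS i)).
have cI : #|I| = (a * w).+1 by rewrite card_sum card_prod !card_ord S0a add1n.
have Sa x : \sum_i (x \in S i) = a.
  rewrite big_sumType big_ord1 /=.
  have -> : \sum_(p : 'I_#|S0| * 'I_w) (x \in S (inr p))
      = \sum_s \sum_c (x \in S (inr (s, c))).
    by rewrite pair_bigA; apply: eq_bigr => -[].
  rewrite (eq_bigr (fun s => (x != enum_val s : nat))); last first.
    move=> s _; rewrite (bigD1 (F (enum_val s) x)) //= inE eqxx andbT.
    rewrite big1 ?addn0 // => c; rewrite inE eq_sym => /negbTE->.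
    by rewrite andbF.
  rewrite -(big_enum_val (fun s => x != s : nat)) /=.
  rewrite -S0a -sum1_card; have [xS|xS] := boolP (x \in S0).
    rewrite (bigD1 x) //= eqxx add0n [RHS](bigD1 x) //=; congr (_ + _).
    by apply: eq_bigr => s /andP [_]; rewrite eq_sym => ->.
  rewrite add0n; apply: eq_bigr => s sS.
  by rewrite (_ : x != s) //; apply: contraNneq xS => ->.
have Qone (Q : {set G}) : clique Q -> #|Q| = w ->
    exists i, forall j, #|Q :&: S j| = (j != i).
  move=> cQ Qw; apply: one_zero; first by rewrite cI.
    by move=> j; apply: clique_indep_le1.
  rewrite cI /=; under eq_bigr do rewrite card_setI_sum.
  rewrite exchange_big /= (eq_bigr (fun=> a)) // sum_nat_const Qw; exact: mulnC.
exists I, S, K; split => //.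
- by move=> i; have [] := KP i.
- move=> i j; have [cK Kw Kj] := KP j; have [l lP] := Qone _ cK Kw.
  have := lP j; rewrite Kj cards0 lP; case: eqP => // <- _.
  by rewrite eq_sym.
- move=> x; rewrite -[RHS](Sa x) -sum1_card big_mkcond; apply: eq_bigr => i _.
  by rewrite inE; case: (x \in S i).
Qed.

Lemma MI_card : #|G| = (a * w).+1.
Proof.
have [I [S [K [_ _ cross cI _]]]] := MI_families.
have I1 : 1 < #|I|.
  by rewrite cI ltnS muln_gt0 (ltnW MI_alpha_ge2) (ltnW MI_omega_ge2).
by apply/eqP; rewrite eqn_leq MI_card_le -cI (cross_card I1 cross).
Qed.

(** Padberg's theorem: Gasparyan's family consists of all maximum stable sets and
    of all maximum cliques.  Indeed any further one would, like the members of the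
    family, be disjoint from exactly one set of the dual family, which determines
    it by [cross_unique]. *)
Lemma MI_structure : exists (I : finType) (S K : I -> {set G}),
  [/\ forall i, independent (S i) /\ #|S i| = a,
      forall i, clique (K i) /\ #|K i| = w,
      forall i j, #|K j :&: S i| = (i != j),
      (forall x, #|[set i | x \in S i]| = a) /\
      (forall x, #|[set i | x \in K i]| = w) &
      (forall T : {set G}, independent T -> #|T| = a -> exists i, T = S i) /\
      (forall Q : {set G}, clique Q -> #|Q| = w -> exists i, Q = K i)].
Proof.
have [I [S [K [iS cK cross cI Sa]]]] := MI_families.
have a0 : 0 < a := ltnW MI_alpha_ge2; have w0 : 0 < w := ltnW MI_omega_ge2.
have I1 : 1 < #|I| by rewrite cI ltnS muln_gt0 a0 w0.
have IG : #|I| = #|G| by rewrite cI MI_card.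
have D := cross_dual I1 cross IG Sa.
have disj x : #|[set i | (x \in K i) && (x \in S i)]| = 0.
  apply/eqP; rewrite cards_eq0; apply/eqP/setP => i; rewrite !inE.
  apply/negP => /andP [xK xS]; have := cross i i; rewrite eqxx => /eqP.
  by rewrite cards_eq0 => /eqP /setP /(_ x); rewrite !inE xK xS.
have Kw x : #|[set i | x \in K i]| = w.
  have := D x x; rewrite disj eqxx addn1 muln1 cI /= mulnC => /eqP.
  by rewrite eqn_pmul2l // => /eqP.
have N x y : #|[set i | (x \in K i) && (y \in S i)]| = (x != y).
  have := D x y; rewrite Kw cI /= mulnC -[LHS]muln1 => /eqP.
  rewrite eqn_pmul2l ?muln_gt0 ?a0 // => /eqP E.
  by move: E; case: (x == y) => /=; rewrite ?addn1 ?addn0 => -[].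
have N' x y : #|[set i | (x \in S i) && (y \in K i)]| = (x != y).
  rewrite eq_sym -N; apply: eq_card => i; rewrite !inE; exact: andbC.
have sumS : \sum_i #|S i| = \sum_(i : I) a.
  rewrite (eq_bigr (fun i => \sum_(x : G) (x \in S i))) => [|i _].
    rewrite exchange_big /= (eq_bigr (fun=> a)) ?sum_nat_const ?IG // => x _.
    rewrite -[RHS](Sa x) -sum1_card [RHS]big_mkcond; apply: eq_bigr => i _.
    by rewrite inE; case: (x \in S i).
  by rewrite -[in LHS](setTI (S i)) card_setI_sum; apply: eq_bigl => x; rewrite inE.
have cS i : #|S i| = a.
  have le j : #|S j| <= a by apply: independent_le.
  have := eq_leq (esym sumS); rewrite (bigD1 i) //= [X in _ <= X](bigD1 i) //=.
  have : \sum_(j | j != i) #|S j| <= \sum_(j : I | j != i) a by apply: leq_sum.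
  by have := le i; set u := (\sum_(j | _) #|S j|); set v := (\sum_(j | _) a); lia.
have one (T : {set G}) : independent T -> #|T| = a ->
    exists i, forall j, #|T :&: K j| = (j != i).
  move=> iT Ta; apply: one_zero; first exact: ltnW.
    by move=> j; rewrite setIC; apply: clique_indep_le1 => //; case: (cK j).
  under eq_bigr do rewrite card_setI_sum.
  rewrite exchange_big /= (eq_bigr (fun=> w)); first by rewrite sum_nat_const Ta cI.
  move=> x _; rewrite -[RHS](Kw x) -sum1_card [RHS]big_mkcond; apply: eq_bigr => i _.
  by rewrite inE; case: (x \in K i).
have one' (Q : {set G}) : clique Q -> #|Q| = w ->
    exists i, forall j, #|Q :&: S j| = (j != i).
  move=> cQ Qw; apply: one_zero; first exact: ltnW.
    by move=> j; apply: clique_indep_le1.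
  under eq_bigr do rewrite card_setI_sum.
  rewrite exchange_big /= (eq_bigr (fun=> a)).
    by rewrite sum_nat_const Qw cI mulnC.
  move=> x _; rewrite -[RHS](Sa x) -sum1_card [RHS]big_mkcond; apply: eq_bigr => i _.
  by rewrite inE; case: (x \in S i).
exists I, S, K; split => //; split => [T iT Ta|Q cQ Qw].
  by have [i iP] := one T iT Ta; exists i; apply: (cross_unique N' Sa Ta iP).
by have [i iP] := one' Q cQ Qw; exists i; apply: (cross_unique N Kw Qw iP).
Qed.

End MinimalImperfect.

Definition nonneighbours (G : sgraph) (x : G) : {set G} :=
  [set y | (x != y) && ~~ (x -- y)].

Section MinimalImperfectConsequences.
Variable G : sgraph.
Hypothesis MI : minimal_imperfect G.
Let w := clique_number G.
Let a := alpha G.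

Lemma clique2 (x y : G) : x -- y -> clique [set x; y].
Proof.
move=> xy; apply/cliqueP => u v; rewrite !inE.
by do 2!case/orP => /eqP->; rewrite ?eqxx ?xy // adj_sym xy.
Qed.

Lemma independent2 (x y : G) : ~~ (x -- y) -> independent [set x; y].
Proof.
move=> xy; apply/independentP => u v; rewrite !inE.
by do 2!case/orP => /eqP->; rewrite ?adj_irrefl // adj_sym.
Qed.

Lemma pair_count (I : finType) (F : I -> {set G}) (N : {set G}) (x : G) :
  injective F -> x \notin N ->
  (forall i, x \in F i -> exists2 y, y \in N & F i = [set x; y]) ->
  (forall y, y \in N -> exists i, F i = [set x; y]) ->
  #|N| = #|[set i | x \in F i]|.
Proof.
move=> FI xN F1 F2; rewrite -(card_imset _ FI) -(@card_in_imset _ _ (fun y => [set x; y])).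
  apply: eq_card => Q; apply/imsetP/imsetP => [[y yN ->]|[i]].
    have [i iE] := F2 y yN; exists i => //.
    by rewrite inE iE set21.
  by rewrite inE => /F1 [y yN E]; exists y; rewrite // -E.
move=> y z yN zN /setP /(_ y); rewrite !inE eqxx orbT => /esym/orP [/eqP e|/eqP//].
by rewrite -e yN in xN.
Qed.

(** If [omega = 2], the maximum cliques at a vertex are its edges, and there are
    [omega] of them. *)
Lemma MI_regular (x : G) : w = 2 -> #|neighbours x| = 2.
Proof.
move=> w2; have [I [S [K [_ cK cross [_ Kw] [_ all]]]]] := MI_structure MI.
transitivity #|[set i | x \in K i]|; last by rewrite Kw.
apply: pair_count.
- move=> i j Kij; have := cross i j; rewrite -Kij cross eqxx.
  by case: eqP.
- by rewrite inE adj_irrefl.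
- move=> i xK; have [ci Ki] := cK i.
  have /cards2P [u [v [uv E]]] : #|K i| == 2 by rewrite Ki -/w w2.
  have Q p q : K i = [set p; q] -> p != q -> x = p ->
      exists2 y, y \in neighbours x & K i = [set x; y].
    move=> {}E pq xp; exists q; last by rewrite xp.
    by rewrite inE xp; move/cliqueP: ci; apply; rewrite ?E ?inE ?eqxx ?orbT.
  have : x \in [set u; v] by rewrite -E.
  rewrite !inE => /orP [] /eqP e; first exact: (Q u v).
  by apply: (Q v u) => //; [rewrite setUC | rewrite eq_sym].
- move=> y; rewrite inE => xy; have [|i E] := all _ (clique2 xy); last by exists i.
  by rewrite cards2 (adj_neq xy) -/w w2.
Qed.

Lemma MI_coregular (x : G) : a = 2 -> #|nonneighbours x| = 2.
Proof.
move=> a2; have [I [S [K [cS _ cross [Sa _] [all _]]]]] := MI_structure MI.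
transitivity #|[set i | x \in S i]|; last by rewrite Sa.
apply: pair_count.
- move=> i j Sij; have := cross i j; rewrite Sij cross eqxx.
  by case: eqP.
- by rewrite inE eqxx.
- move=> i xS; have [ci Si] := cS i.
  have /cards2P [u [v [uv E]]] : #|S i| == 2 by rewrite Si -/a a2.
  have Q p q : S i = [set p; q] -> p != q -> x = p ->
      exists2 y, y \in nonneighbours x & S i = [set x; y].
    move=> {}E pq xp; exists q; last by rewrite xp.
    rewrite inE xp pq /=; move/independentP: ci; apply; by rewrite ?E ?inE ?eqxx ?orbT.
  have : x \in [set u; v] by rewrite -E.
  rewrite !inE => /orP [] /eqP e; first exact: (Q u v).
  by apply: (Q v u) => //; [rewrite setUC | rewrite eq_sym].
- move=> y; rewrite inE => /andP [xy nxy].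
  have [|i E] := all _ (independent2 nxy); last by exists i.
  by rewrite cards2 xy -/a a2.
Qed.

(** The largest class of an omega-colouring of [S] has at least the average size. *)
Lemma MI_subset_bound (S : {set G}) : S != setT ->
  exists T Q : {set G}, [/\ independent T, clique Q, T \subset S, Q \subset S &
    #|S| <= #|T| * #|Q|].
Proof.
move=> ST; have /omega_colourableP c := proj2 MI _ ST.
have [Q cQ Qw] := max_clique (induced S); have [cQ' QS Qc] := induced_clique cQ.
have [k0|k0] := posnP (clique_number (induced S)).
  exists set0, set0; split; rewrite ?sub0set //.
  - by apply/independentP => x; rewrite inE.
  - by apply/cliqueP => x; rewrite inE.
  rewrite cards0 leqn0 cards_eq0; apply/eqP/setP => x; rewrite inE.
  apply/negP => xS; have := clique_number_gt0 (exist _ x xS : induced S).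
  by rewrite k0.
have [f fP] := induced_colouring k0 c.
pose T c := [set x in S | f x == c].
pose c0 : 'I_(clique_number (induced S)) := [arg max_(c > Ordinal k0) #|T c|].
exists (T c0), (val @: Q); split => //.
- apply/independentP => u v; rewrite !inE => /andP [uS /eqP uc] /andP [vS /eqP vc].
  by apply/negP => uv; have := fP _ _ uS vS uv; rewrite uc vc eqxx.
- by apply/subsetP => x; rewrite inE => /andP [].
rewrite Qc Qw -sum1_card (partition_big f predT) //= mulnC.
apply: leq_trans (_ : \sum_(c < clique_number (induced S)) #|T c0| <= _); last first.
  by rewrite sum_nat_const card_ord.
apply: leq_sum => d _; rewrite sum1dep_card /c0; case: arg_maxnP => //= e _.
by move=> /(_ d isT); apply: leq_trans; rewrite leq_eqVlt; apply/orP; left.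
Qed.

(** If [S] were a proper part without edges to its complement, both parts would
    have at most [alpha * omega] vertices for their own parameters; since stable
    sets of the parts can be united, so would the whole graph, contrary to
    [MI_card]. *)
Lemma MI_connected (S : {set G}) (x0 : G) : x0 \in S ->
  (forall x y, x \in S -> x -- y -> y \in S) -> S = setT.
Proof.
move=> x0S cl; apply/eqP/negPn/negP => ST.
have CT : ~: S != setT by apply/eqP => /setP /(_ x0); rewrite !inE x0S.
have [T [Q [iT cQ TS QS le]]] := MI_subset_bound ST.
have [T' [Q' [iT' cQ' TS' QS' le']]] := MI_subset_bound CT.
have d : [disjoint T & T'].
  rewrite -setI_eq0; apply/eqP/setP => x; rewrite !inE; apply/negP.
  by case/andP => /(subsetP TS) xS /(subsetP TS'); rewrite inE xS.
have iU : independent (T :|: T').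
  apply/independentP => x y; rewrite !inE => /orP [xT|xT] /orP [yT|yT].
  - by move/independentP: iT; apply.
  - apply/negP => /(cl _ _ (subsetP TS _ xT)) yS.
    by have := subsetP TS' _ yT; rewrite inE yS.
  - rewrite adj_sym; apply/negP => /(cl _ _ (subsetP TS _ yT)) yS.
    by have := subsetP TS' _ xT; rewrite inE yS.
  - by move/independentP: iT'; apply.
have := independent_le iU; rewrite cardsU disjoint_setI0 // cards0 subn0 => TT.
have le1 := leq_trans le (leq_mul (leqnn _) (clique_le cQ)).
have le2 := leq_trans le' (leq_mul (leqnn _) (clique_le cQ')).
have := leq_add le1 le2; rewrite cardsC (MI_card MI) -mulnDl.
by rewrite ltnNge leq_mul2r TT orbT.
Qed.

(** Here cliques can be united. *)
Lemma MI_coconnected (S : {set G}) (x0 : G) : x0 \in S ->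
  (forall x y, x \in S -> x != y -> ~~ (x -- y) -> y \in S) -> S = setT.
Proof.
move=> x0S cl; apply/eqP/negPn/negP => ST.
have CT : ~: S != setT by apply/eqP => /setP /(_ x0); rewrite !inE x0S.
have [T [Q [iT cQ TS QS le]]] := MI_subset_bound ST.
have [T' [Q' [iT' cQ' TS' QS' le']]] := MI_subset_bound CT.
have d : [disjoint Q & Q'].
  rewrite -setI_eq0; apply/eqP/setP => x; rewrite !inE; apply/negP.
  by case/andP => /(subsetP QS) xS /(subsetP QS'); rewrite inE xS.
have cU : clique (Q :|: Q').
  apply/cliqueP => x y; rewrite !inE => /orP [xT|xT] /orP [yT|yT] xy.
  - by move/cliqueP: cQ; apply.
  - apply: contraT => /(cl _ _ (subsetP QS _ xT) xy) yS.
    by have := subsetP QS' _ yT; rewrite inE yS.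
  - rewrite adj_sym; rewrite eq_sym in xy.
    apply: contraT => /(cl _ _ (subsetP QS _ yT) xy) yS.
    by have := subsetP QS' _ xT; rewrite inE yS.
  - by move/cliqueP: cQ'; apply.
have := clique_le cU; rewrite cardsU disjoint_setI0 // cards0 subn0 => QQ.
have le1 := leq_trans le (leq_mul (independent_le iT) (leqnn _)).
have le2 := leq_trans le' (leq_mul (independent_le iT') (leqnn _)).
have := leq_add le1 le2; rewrite cardsC (MI_card MI) -mulnDr.
by rewrite ltnNge leq_mul2l QQ orbT.
Qed.

Definition colour_class (v : G) (f : G -> 'I_w) (c : 'I_w) : {set G} := [set x | (x != v) && (f x == c)].

Definition proper_minus (v : G) (f : G -> 'I_w) : Prop :=
  forall x y, x != v -> y != v -> x -- y -> f x != f y.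

Lemma class_independent v f c : proper_minus v f -> independent (colour_class v f c).
Proof.
move=> fP; apply/independentP => x y; rewrite !inE => /andP [xv /eqP xc].
by move=> /andP [yv /eqP yc]; apply/negP => /(fP _ _ xv yv); rewrite xc yc eqxx.
Qed.

Lemma MI_class_card v f c : proper_minus v f -> #|colour_class v f c| = a.
Proof.
move=> fP; have le d : #|colour_class v f d| <= a.
  exact/independent_le/class_independent.
have S : \sum_d #|colour_class v f d| = \sum_(d < w) a.
  rewrite sum_nat_const card_ord; have := cardsC1 v; rewrite (MI_card MI) -/a -/w /=.
  rewrite mulnC => <-; rewrite -sum1_card (partition_big f predT) //=.
  apply: eq_bigr => d _; rewrite sum1dep_card; apply: eq_card => x; by rewrite !inE.
have := eq_leq (esym S); rewrite (bigD1 c) //= [X in _ <= X](bigD1 c) //=.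
have : \sum_(j | j != c) #|colour_class v f j| <= \sum_(j : 'I_w | j != c) a.
  by apply: leq_sum.
by have := le c; set u := (\sum_(j | _) #|_|); set t := (\sum_(j | _) a); lia.
Qed.

(** The colour classes of [G - v] do not depend on the colouring: they are the
    maximum stable sets whose dual clique contains [v]. *)
Lemma MI_class_unique v f g c : proper_minus v f -> proper_minus v g ->
  exists d, colour_class v g c = colour_class v f d.
Proof.
have [I [S [K [_ cK cross [_ Kw] [all _]]]]] := MI_structure MI.
have key f' c' : proper_minus v f' ->
    exists2 i, colour_class v f' c' = S i & v \in K i.
  move=> fP; have iT := class_independent c' fP.
  have [i iE] := all _ iT (MI_class_card c' fP); exists i => //.
  apply: contraT => vK; have [ci Ki] := cK i.
  have inj : {in K i &, injective f'}.
    move=> x y xK yK /eqP e; apply/eqP/negPn/negP => xy.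
    have xv : x != v by apply: contraNneq vK => <-.
    have yv : y != v by apply: contraNneq vK => <-.
    by have := fP _ _ xv yv; rewrite e; move/cliqueP: ci => /(_ _ _ xK yK xy) -> /(_ isT).
  have : #|f' @: K i| <= #|[set~ c']|.
    apply: subset_leq_card; apply/subsetP => _ /imsetP [x xK ->]; rewrite !inE.
    apply/negP => /eqP xc; have : #|K i :&: S i| != 0.
      rewrite cards_eq0; apply/set0Pn; exists x; rewrite inE xK -iE inE xc eqxx andbT.
      by apply: contraNneq vK => <-.
    by rewrite cross eqxx.
  rewrite (card_in_imset inj) Ki cardsC1 card_ord -/w.
  by have := ltn_ord c'; lia.
move=> fP gP; have [i iE iv] := key g c gP.
have [h hP] := fin_all_exists2 (fun d => key f d fP).
move=> hv.
have hI : injective h.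
  move=> d e hde; have : colour_class v f d != set0.
    by rewrite -cards_eq0 (MI_class_card d fP) -lt0n ltnW // MI_alpha_ge2.
  case/set0Pn => x xd; have xe : x \in colour_class v f e by rewrite hP -hde -hP.
  by move: xd xe; rewrite !inE => /andP [_ /eqP <-] /andP [_ /eqP].
have E : h @: setT = [set i | v \in K i].
  apply/eqP; rewrite eqEcard card_imset // cardsT card_ord Kw leqnn andbT.
  by apply/subsetP => _ /imsetP [d _ ->]; rewrite inE.
have : i \in h @: setT by rewrite E inE.
by case/imsetP => d _ id; exists d; rewrite iE id -hP.
Qed.

(** Exchanging the colours [c] and [d] on a proper component [X] of the subgraph
    that they span would give a colouring with other classes. *)
Lemma MI_kempe v f c d (X : {set G}) x0 : proper_minus v f -> c != d ->
  x0 \in X -> X \subset colour_class v f c :|: colour_class v f d ->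
  (forall x y, x \in X -> y \in colour_class v f c :|: colour_class v f d ->
     x -- y -> y \in X) ->
  X = colour_class v f c :|: colour_class v f d.
Proof.
move=> fP cd x0X /subsetP Xs cl.
pose g x := if x \in X then (if f x == c then d else c) else f x.
have Xf x : x \in X -> x != v /\ (f x == c) || (f x == d).
  by move=> /Xs; rewrite !inE -andb_orr => /andP.
have Y x : x != v -> (f x == c) || (f x == d) ->
    x \in colour_class v f c :|: colour_class v f d.
  by move=> xv; rewrite !inE xv.
have gP : proper_minus v g.
  have one x y : x \in X -> y \notin X -> y != v -> x -- y -> g x != g y.
    move=> xX yX yv xy; rewrite /g xX (negbTE yX); apply: contra yX => /eqP e.
    apply: (cl x) => //; apply: Y => //; rewrite -e.
    by case: ifP; rewrite eqxx ?orbT.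
  move=> x y xv yv xy; case: (boolP (x \in X)) => xX; last first.
    case: (boolP (y \in X)) => yX; last by rewrite /g (negbTE xX) (negbTE yX) fP.
    by rewrite eq_sym one // adj_sym.
  case: (boolP (y \in X)) => yX; last exact: one.
  have := fP _ _ xv yv xy; rewrite /g xX yX.
  have [_ /orP [] /eqP->] := Xf _ xX; have [_ /orP [] /eqP->] := Xf _ yX;
    by rewrite ?eqxx //= ?[d == c]eq_sym ?(negbTE cd) ?[d == c]eq_sym ?(negbTE cd).
have [e eE] := MI_class_unique c fP gP.
have memE x : x != v -> (g x == c) = (f x == e).
  by move=> xv; have /setP /(_ x) := eE; rewrite !inE xv.
have [x0v x0f] := Xf _ x0X.
have x0g : g x0 = (if f x0 == c then d else c) by rewrite /g x0X.
apply/eqP; rewrite eqEsubset; apply/andP; split; first exact/subsetP.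
apply/subsetP => y; rewrite !inE -andb_orr => /andP [yv yf].
apply: contraT => yX; have yg : g y = f y by rewrite /g (negbTE yX).
have : colour_class v g c != set0.
  by rewrite -cards_eq0 (MI_class_card c gP) -lt0n ltnW // MI_alpha_ge2.
case/set0Pn => z; rewrite inE => /andP [zv zc].
have zf : (f z == c) || (f z == d).
  move: zc; rewrite /g; case: ifP => [/Xf [_ //]|_ ->//].
have := memE _ x0v; have := memE _ yv; have := memE _ zv; rewrite zc x0g yg.
move=> /esym /eqP ze; rewrite -{}ze.
by case/orP: yf => /eqP->; case/orP: x0f => /eqP->; case/orP: zf => /eqP->;
   rewrite ?eqxx ?[d == c]eq_sym ?(negbTE cd) ?eqxx ?[d == c]eq_sym ?(negbTE cd).
Qed.

End MinimalImperfectConsequences.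

Lemma val_ordS n (i : 'I_n) : ordS i = (if i.+1 == n then 0 else i.+1) :> nat.
Proof.
rewrite /=; case: eqP => [->|/eqP ni]; first by rewrite modnn.
by rewrite modn_small // ltn_neqAle ni ltn_ord.
Qed.

Lemma val_ord_pred n (i : 'I_n) :
  ord_pred i = (if i == 0 :> nat then n.-1 else i.-1) :> nat.
Proof.
rewrite /=; have lt := ltn_ord i; case: eqP => [->|/eqP i0].
  by rewrite add0n modn_small //; lia.
have -> : (i + n).-1 = i.-1 + n by lia.
by rewrite modnDr modn_small //; lia.
Qed.

(** * Connected graphs of maximum degree two *)

Section MaxDegreeTwo.
Variables (T : finType) (e : rel T) (A : {set T}) (x0 : T).
Hypotheses (eS : symmetric e) (x0A : x0 \in A).
Hypothesis conn : forall (X : {set T}) x, x \in X -> X \subset A ->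
  (forall y z, y \in X -> z \in A -> e y z -> z \in X) -> X = A.
Hypothesis deg : forall x, x \in A -> #|[set y in A | e x y]| <= 2.

Lemma third_neighbour x y z t : x \in A -> y \in A -> z \in A -> t \in A ->
  e x y -> e x z -> e x t -> y != z -> (t == y) || (t == z).
Proof.
move=> xA yA zA tA xy xz xt yz; apply: contraT; rewrite negb_or => /andP [ty tz].
have : #|[set y; z] :|: [set t]| <= #|[set y in A | e x y]|.
  apply: subset_leq_card; apply/subsetP => u; rewrite !inE.
  by do 2?[case/orP]; move=> /eqP->; rewrite ?yA ?zA ?tA.
rewrite setUC cardsU1 cards2 yz !inE negb_or ty tz /=.
by move=> le; have := leq_trans le (deg xA).
Qed.

(** A longest path already contains everything: its inner vertices have no
    further neighbour, and its ends have none by maximality. *)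
Lemma path_or_cycle : exists s : seq T,
  [/\ uniq s, s =i A, forall i, i.+1 < size s -> e (nth x0 s i) (nth x0 s i.+1) &
    forall i j, i < j -> j < size s -> e (nth x0 s i) (nth x0 s j) ->
      (j == i.+1) || (i == 0) && (j == (size s).-1)].
Proof.
pose P n := [exists t : n.-tuple T, [&& uniq t, sorted e t & all [in A] t]].
have P1 : exists n, P n.
  by exists 1; apply/existsP; exists [tuple x0]; rewrite /= x0A.
have Pb n : P n -> n <= #|T|.
  case/existsP => t /and3P [u _ _]; rewrite -(size_tuple t) -(card_uniqP u).
  exact: max_card.
case: (ex_maxnP P1 Pb) => n /existsP [t /and3P [tU tS tA]] tmax.
have long (s : seq T) : uniq s -> sorted e s -> all [in A] s -> size s <= size t.
  move=> u so al; rewrite size_tuple; apply: tmax; apply/existsP.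
  by exists (in_tuple s); rewrite /= u so al.
have tn0 : 0 < size t by apply: (@long [:: x0]) => //=; rewrite x0A.
move: (tval t) tU tS tA long tn0 => {P P1 Pb tmax n t} s sU sS /allP sA long s0.
pose c i := nth x0 s i.
have cA i : i < size s -> c i \in A by move=> li; apply: sA; apply: mem_nth.
have ce i : i.+1 < size s -> e (c i) (c i.+1).
  by move: i; apply/sortedP.
have cI i j : i < size s -> j < size s -> (c i == c j) = (i == j).
  by move=> li lj; rewrite nth_uniq.
have inner i y : i.+2 < size s -> y \in A -> e (c i.+1) y ->
    (y == c i) || (y == c i.+2).
  move=> li yA iy; apply: (third_neighbour (x := c i.+1)) => //.
  - by apply: cA; lia.
  - by apply: cA; lia.
  - exact: cA.
  - by rewrite eS ce //; lia.
  - exact: ce.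
  - by rewrite cI; lia.
have cl x y : x \in s -> y \in A -> e x y -> y \in s.
  move=> /(nthP x0) [i li <-] yA iy; apply: contraT => yn.
  have [i0|i0] := posnP i.
    move: iy; rewrite i0 => iy; suff : size (y :: s) <= size s by rewrite /= ltnn.
    apply: long => /=; [by rewrite yn | | by rewrite yA; apply/allP].
    by case: (s) iy sS => //= a s' ay ->; rewrite eS ay.
  have [il|il] := ltnP i.+1 (size s).
    have := @inner i.-1 y; rewrite prednK // => /(_ il yA iy) /orP [] /eqP yE;
      by rewrite yE /c mem_nth // ?(leq_ltn_trans (leq_pred i)) in yn.
  suff : size (rcons s y) <= size s by rewrite size_rcons ltnn.
  apply: long; first by rewrite rcons_uniq yn.
    move: li iy il sS s0; case: (s) => //= a s' li iy il sS _.
    rewrite rcons_path sS /= (last_nth x0); have -> : size s' = i by lia.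
    exact: iy.
  by rewrite all_rcons yA; apply/allP.
exists s; split => //.
- have E : [set x in s] = A.
    apply: (conn (x := nth x0 s 0)); [| |by move=> x y; rewrite !inE => xs; apply: cl].
      by rewrite inE mem_nth.
    by apply/subsetP => x; rewrite inE => /sA.
  by move=> x; rewrite -E inE.
- move=> i j ij lj ije; apply: contraT; rewrite negb_or negb_and => /andP [ji].
  have li : i < size s by apply: ltn_trans lj.
  case/orP => [i0|jl].
    have := @inner i.-1 (c j); rewrite prednK ?lt0n // => /(_ _ (cA _ lj) ije).
    by rewrite !cI //; lia.
  have := @inner j.-1 (c i); rewrite prednK; last by lia.
  have {}jl : j.+1 < size s by lia.
  move=> /(_ jl (cA _ li)); rewrite eS => /(_ ije).
  by rewrite !cI //; lia.
Qed.

End MaxDegreeTwo.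

Ltac arith :=
  repeat match goal with
  | H : ?T |- _ => lazymatch type of T with
      | Prop => lazymatch T with
        | is_true (leq _ _) => fail
        | @eq nat _ _ => fail
        | is_true (odd _) => fail
        | _ => clear H
        end
      end
  end; lia.

(** * Local analysis *)

Fixpoint bitseqs (n : nat) : seq bitseq :=
  if n is m.+1 then let r := bitseqs m in map (cons true) r ++ map (cons false) r
  else [:: [::]].

Lemma mem_bitseqs (b : bitseq) : b \in bitseqs (size b).
Proof. by elim: b => //= -[] b H; rewrite mem_cat map_f ?orbT. Qed.

(** The adjacencies of a new vertex to a list of vertices with code [q] satisfy
    [P], as all the others create one of the patterns of [ps]. *)
Definition forced (ps : seq code) (q : code) (P : pred bitseq) : bool :=
  all (fun b => if P b then true else some (fun p => emb p (b :: q)) ps)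
    (bitseqs (size q)).

Definition free_all (ps : seq code) (G : sgraph) : Prop :=
  forall p, p \in ps -> free p G.

Lemma forcedP (G : sgraph) ps q P (x : G) xs :
  free_all ps G -> rows xs = q -> uniq (x :: xs) -> forced ps q P ->
  P [seq x -- y | y <- xs].
Proof.
move=> F <- u /allP /(_ [seq x -- y | y <- xs]).
rewrite size_rows -(size_map (adj x)) => /(_ (mem_bitseqs _)).
rewrite some_has; case: ifP => // _ /hasP [p pps e].
by case: (F p pps); apply: (contains_rows u).
Qed.

Lemma forcedF (G : sgraph) ps q (x : G) xs :
  free_all ps G -> rows xs = q -> uniq (x :: xs) -> forced ps q pred0 -> False.
Proof. by move=> F e u /(forcedP F e u). Qed.

Lemma not_contains_rows (G : sgraph) ps (xs : seq G) q :
  free_all ps G -> uniq xs -> rows xs = q -> seq.has (fun p => emb p q) ps -> False.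
Proof.
by move=> F u <- /hasP [p pps e]; case: (F p pps); apply: (contains_rows u).
Qed.

Lemma free_all1 p (G : sgraph) : free p G -> free_all [:: p] G.
Proof. by move=> F q; rewrite inE => /eqP->. Qed.

Lemma free_all2 p q (G : sgraph) : free p G -> free q G -> free_all [:: p; q] G.
Proof. by move=> F F' r; rewrite !inE => /orP [] /eqP->. Qed.

(** * Cyclic enumerations *)

(** Indexing a cycle by all integers modulo [n] makes rotations available as
    [cyclic_shift]. *)

Definition cyclic (T : eqType) (r : rel T) (n : nat) (c : nat -> T) : Prop :=
  (forall i j, (c i == c j) = (i == j %[mod n])) /\
  (forall i j, r (c i) (c j) = (j == i.+1 %[mod n]) || (i == j.+1 %[mod n])).

Lemma cyclic_shift (T : eqType) (r : rel T) n c k :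
  cyclic r n c -> cyclic r n (fun i => c (k + i)).
Proof.
move=> [cI cR]; split=> i j; first by rewrite cI eqn_modDl.
by rewrite cR -!addnS !eqn_modDl.
Qed.

Section CyclicTheory.
Variables (T : eqType) (r : rel T) (n : nat) (c : nat -> T).
Hypothesis cyc : cyclic r n c.

Lemma cyclic_period i : c (i + n) = c i.
Proof. by apply/eqP; rewrite (proj1 cyc) modnDr. Qed.

Lemma cyclic_mod i : c (i %% n) = c i.
Proof. by apply/eqP; rewrite (proj1 cyc) modn_mod. Qed.

Lemma cyclic_neq i j : i < j -> j < i + n -> (c i == c j) = false.
Proof.
move=> ij jn; rewrite (proj1 cyc) -(subnKC (ltnW ij)) -{1}[i]addn0 eqn_modDl.
by rewrite mod0n modn_small; lia.
Qed.

Lemma cyclic_succ i : r (c i) (c i.+1).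
Proof. by rewrite (proj2 cyc) eqxx. Qed.

Lemma cyclic_far i j : i.+1 < j -> j.+1 < i + n -> r (c i) (c j) = false.
Proof.
move=> ij jn; have [d dE] : exists d, j = i + d by exists (j - i); lia.
rewrite (proj2 cyc) dE -addn1 -addnS eqn_modDl -{1}[i]addn0 eqn_modDl.
by rewrite mod0n !modn_small; lia.
Qed.

Lemma cyclic_last i : 0 < n -> r (c (i + n.-1)) (c i).
Proof. by move=> n0; rewrite -(cyclic_period i) -{2}(prednK n0) addnS cyclic_succ. Qed.

End CyclicTheory.

Lemma sequence_cyclic (T : finType) (r : rel T) (x0 : T) (s : seq T) :
  symmetric r -> irreflexive r -> uniq s -> 3 <= size s ->
  (forall i, i.+1 < size s -> r (nth x0 s i) (nth x0 s i.+1)) ->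
  (forall i j, i < j -> j < size s -> r (nth x0 s i) (nth x0 s j) ->
     (j == i.+1) || (i == 0) && (j == (size s).-1)) ->
  r (nth x0 s 0) (nth x0 s (size s).-1) ->
  cyclic r (size s) (fun i => nth x0 s (i %% size s)).
Proof.
move=> rS rI sU n3 sR sC close; set n := size s in n3 sR sC close *.
have sI i j : i < n -> j < n -> (nth x0 s i == nth x0 s j) = (i == j).
  by move=> li lj; rewrite nth_uniq.
have R i j : i < j -> j < n ->
    r (nth x0 s i) (nth x0 s j) = (j == i.+1) || (i == 0) && (j == n.-1).
  move=> ij jn; apply/idP/idP => [|/orP [/eqP jE|/andP [/eqP-> /eqP->]]] //.
    exact: sC.
  by rewrite jE sR // -jE.
have lt i : i %% n < n by rewrite ltn_mod; lia.
split=> i j; first by rewrite sI.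
have S k : k.+1 %% n = if k %% n == n.-1 then 0 else (k %% n).+1.
  rewrite -addn1 -modnDml; case: eqP => [->|ne].
    by rewrite addn1 prednK ?modnn //; lia.
  by rewrite modn_small ?addn1 //; have := lt k; lia.
rewrite !S; have := lt i; have := lt j; move: (i %% n) (j %% n) => a b lb la.
case: (ltngtP a b) => [ab|ba|<-].
- by rewrite R //; case: ifP; case: ifP; lia.
- by rewrite rS R //; case: ifP; case: ifP; lia.
- by rewrite rI; case: ifP; lia.
Qed.

Lemma regular2_cyclic (T : finType) (r : rel T) (x0 : T) :
  symmetric r -> irreflexive r ->
  (forall (X : {set T}) x, x \in X ->
    (forall y z, y \in X -> r y z -> z \in X) -> X = setT) ->
  (forall x, #|[set y | r x y]| = 2) ->
  exists c, cyclic r #|T| c /\ forall x, exists i, x = c i.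
Proof.
move=> rS rI conn deg.
have [X x xX _ cl|x _|s [sU sA sR sC]] := @path_or_cycle T r setT x0 rS (in_setT x0).
- by apply: (conn X x xX) => y z yX; apply: cl; rewrite ?inE.
- by rewrite -(deg x); apply: subset_leq_card; apply/subsetP => y; rewrite !inE.
have n1 : size s = #|T|.
  by rewrite -(card_uniqP sU); apply: eq_card => x; rewrite sA !inE.
set n := size s in n1; rewrite -n1.
have n3 : 3 <= n.
  have := deg x0; set N := [set y | _] => N2.
  have : #|x0 |: N| <= #|T| by apply: max_card.
  by rewrite cardsU1 N2 inE rI n1.
have sI i j : i < n -> j < n -> (nth x0 s i == nth x0 s j) = (i == j).
  by move=> li lj; rewrite nth_uniq.
have close : r (nth x0 s 0) (nth x0 s n.-1).
  have : #|[set y | r (nth x0 s 0) y] :\ nth x0 s 1| = 1.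
    have := cardsD1 (nth x0 s 1) [set y | r (nth x0 s 0) y].
    by rewrite deg inE sR -/n; lia.
  move=> /eqP /cards1P [y yE]; have : y \in [set y] by rewrite inE.
  rewrite -{}yE !inE => /andP [y1 ry].
  have ys : y \in s by rewrite sA inE.
  move: y1 ry; rewrite -(nth_index x0 ys); have := ys; rewrite -index_mem -/n.
  move: (index y s) => j lj; rewrite sI //; last by lia.
  move=> j1 rj; have j0 : 0 < j by case: j rj {lj j1} => //; rewrite rI.
  by have := sC _ _ j0 lj rj; rewrite (negbTE j1) /= => /eqP <-.
exists (fun i => nth x0 s (i %% n)); split; last first.
  move=> x; have xs : x \in s by rewrite sA inE.
  by exists (index x s); rewrite modn_small ?index_mem // nth_index.
exact: sequence_cyclic.
Qed.

(** * Odd holes and odd antiholes *)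

Definition nonadj (G : sgraph) : rel G := fun x y => (x != y) && ~~ (x -- y).

Lemma nonadj_sym (G : sgraph) : symmetric (@nonadj G).
Proof. by move=> x y; rewrite /nonadj eq_sym adj_sym. Qed.

Lemma nonadj_irrefl (G : sgraph) : irreflexive (@nonadj G).
Proof. by move=> x; rewrite /nonadj eqxx. Qed.

Lemma MI_hole (G : sgraph) : minimal_imperfect G -> clique_number G = 2 ->
  exists c, cyclic (@adj G) #|G| c /\ forall x : G, exists i, x = c i.
Proof.
move=> MI w2; have [x0 _] := MI_edge MI.
apply: (regular2_cyclic x0) => [||X x xX cl|x].
- exact: adj_sym.
- exact: adj_irrefl.
- exact: MI_connected xX cl.
- exact: MI_regular.
Qed.

Lemma MI_antihole (G : sgraph) : minimal_imperfect G -> alpha G = 2 ->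
  exists c, cyclic (@nonadj G) #|G| c /\ forall x : G, exists i, x = c i.
Proof.
move=> MI a2; have [x0 _] := MI_edge MI.
apply: (regular2_cyclic x0) => [||X x xX cl|x].
- exact: nonadj_sym.
- exact: nonadj_irrefl.
- apply: (MI_coconnected MI xX) => y z yX yz nyz.
  by apply: (cl y z yX); rewrite /nonadj yz.
- exact: MI_coregular.
Qed.

Lemma MI_hole_card (G : sgraph) : minimal_imperfect G -> clique_number G = 2 ->
  #|G| = (alpha G).*2.+1.
Proof. by move=> MI w2; rewrite (MI_card MI) w2 muln2. Qed.

Lemma MI_antihole_card (G : sgraph) : minimal_imperfect G -> alpha G = 2 ->
  #|G| = (clique_number G).*2.+1.
Proof. by move=> MI a2; rewrite (MI_card MI) a2 mul2n. Qed.

Lemma MI_hole_in (H G : sgraph) : embeds H G -> minimal_imperfect H ->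
  clique_number H = 2 -> exists (n : nat) (c : nat -> G),
    [/\ odd n, 5 <= n, n = (alpha H).*2.+1 & cyclic (@adj G) n c].
Proof.
move=> [f fI fE] MI w2; have [c [[cI cR] _]] := MI_hole MI w2.
exists #|H|, (f \o c); rewrite MI_hole_card //; split => //.
- by rewrite /= odd_double.
- by have := MI_alpha_ge2 MI; lia.
by rewrite -MI_hole_card //; split=> i j /=; rewrite ?(inj_eq fI) ?fE.
Qed.

Lemma MI_antihole_in (H G : sgraph) : embeds H G -> minimal_imperfect H ->
  alpha H = 2 -> exists (n : nat) (c : nat -> G),
    [/\ odd n, 5 <= n & cyclic (@nonadj G) n c].
Proof.
move=> [f fI fE] MI w2; have [c [[cI cR] _]] := MI_antihole MI w2.
exists #|H|, (f \o c); split.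
- by rewrite MI_antihole_card //= odd_double.
- by rewrite MI_antihole_card //; have := MI_omega_ge2 MI; lia.
by split=> i j /=; rewrite ?(inj_eq fI) // -cR /nonadj (inj_eq fI) fE.
Qed.

Lemma cyclic_iso (G : sgraph) n c : 3 <= n -> cyclic (@adj G) n c ->
  (forall x : G, exists i, x = c i) -> G ≃ Cn n.
Proof.
move=> n3 cyc surj; apply: iso_sym; exists (fun i : Cn n => c i).
  have [cI cR] := cyc; have inj : injective (fun i : Cn n => c i).
    by move=> i j /eqP; rewrite cI !modn_small // => /eqP /val_inj.
  apply: inj_card_bij => //; rewrite -[X in X <= _]cardsT -[X in _ <= X]cardsT.
  apply: leq_trans (leq_imset_card (fun i : Cn n => c i) [set: Cn n]).
  apply: subset_leq_card; apply/subsetP => x _; have [i ->] := surj x.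
  have lt : i %% n < n by rewrite ltn_mod; lia.
  by apply/imsetP; exists (Ordinal lt); rewrite //= (cyclic_mod cyc).
move=> i j; rewrite (proj2 cyc) /adj /= /sym_rel -!val_eqE /=.
rewrite (modn_small (ltn_ord j)) (modn_small (ltn_ord i)).
have := val_ordS i; have := val_ordS j; rewrite /= => -> ->.
have lj := ltn_ord j; case: (i =P j :> nat) => //= ->.
by apply/negbTE; rewrite negb_or; case: ifP; lia.
Qed.

(** * P4-free graphs *)

(** Otherwise [v] could be given the colour [c]. *)
Lemma MI_class_neighbour (G : sgraph) v (f : G -> 'I_(clique_number G)) c :
  minimal_imperfect G -> proper_minus v f ->
  exists2 x, x \in colour_class v f c & v -- x.
Proof.
move=> MI fP; have [/existsP [x /andP [xc vx]]|N] :=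
    boolP [exists x : G, (x \in colour_class v f c) && (v -- x)]; first by exists x.
case/negP: (MI_not_colourable MI); apply/colourableP.
have Nx x : x \in colour_class v f c -> (v -- x) = false.
  by move=> xc; apply: contraNF N => vx; apply/existsP; exists x; rewrite xc.
exists (fun x => if x == v then c else f x) => x y xy.
case: (eqVneq x v) => [xv|xv]; case: (eqVneq y v) => [yv|yv].
- by rewrite xv yv adj_irrefl in xy.
- rewrite xv in xy; apply/negP => /eqP e; have := Nx y.
  by rewrite inE yv -e eqxx xy => /(_ isT).
- rewrite yv adj_sym in xy; apply/negP => /eqP e; have := Nx x.
  by rewrite inE xv e eqxx xy => /(_ isT).
- exact: fP.
Qed.

(** If the vertices [x], [y] of two colour classes were not adjacent, the part
    of these classes within distance 2 of [x] would be a proper component. *)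
Lemma P4_free_classes (G : sgraph) v (f : G -> 'I_(clique_number G)) c d x y :
  minimal_imperfect G -> free p_P4 G -> proper_minus v f -> c != d ->
  x \in colour_class v f c -> y \in colour_class v f d -> x -- y.
Proof.
move=> MI /free_all1 F fP cd xc yd.
have ic := class_independent c fP; have id := class_independent d fP.
have sep u t : u \in colour_class v f c -> t \in colour_class v f d -> u != t.
  rewrite !inE => /andP [_ /eqP uc] /andP [_ /eqP td].
  by apply: contraNneq cd => ut; rewrite -uc -td ut.
have kempe X := MI_kempe MI (X := X) (x0 := x) fP cd.
move: (colour_class v f c) (colour_class v f d) xc yd ic id sep kempe => C D.
move=> xC yD iC iD sep kempe.
pose N := [set t in D | x -- t].
pose X := N :|: [set u in C | (u == x) || [exists t in N, u -- t]].
have memN t : (t \in N) = (t \in D) && (x -- t) by rewrite inE.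
have memX u : (u \in X) =
    (u \in N) || (u \in C) && ((u == x) || [exists t in N, u -- t]).
  by rewrite in_setU [X in _ || X]inE.
have E : X = C :|: D.
  apply: kempe.
  - by rewrite memX xC eqxx orbT.
  - apply/subsetP => u; rewrite memX memN in_setU.
    by case/orP => /andP [-> _]; rewrite ?orbT.
  move=> u t; rewrite !memX => /orP [uN|/andP [uC uX]] tCD ut.
    have tC : t \in C.
      case/setUP: tCD => // tD; move: uN; rewrite memN => /andP [uD _].
      by move/independentP: iD => /(_ _ _ uD tD); rewrite ut.
    rewrite tC; apply/orP; right; apply/orP; right.
    by apply/existsP; exists u; rewrite uN adj_sym.
  have tD : t \in D.
    case/setUP: tCD => // tC; move/independentP: iC => /(_ _ _ uC tC).
    by rewrite ut.
  case/orP: uX => [/eqP ux|/existsP [s /andP [sN us]]].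
    by rewrite memN tD -ux ut.
  have [sD xs] : s \in D /\ x -- s by apply/andP; rewrite -memN.
  apply/orP; left; rewrite memN tD /=; apply: contraT => xt.
  have nxu : (x -- u) = false by apply/negbTE; move/independentP: iC; apply.
  have nst : (s -- t) = false by apply/negbTE; move/independentP: iD; apply.
  case: (@not_contains_rows _ _ [:: x; s; u; t] p_P4 F) => //.
    rewrite /= !inE !negb_or (sep x s) // (sep x t) // (eq_sym s u) (sep u s) //.
    rewrite (sep u t) //= !andbT.
    by apply/andP; split; [apply: contraTneq ut => <- | apply: contraTneq xs => ->].
  by rewrite /= xs nxu (negbTE xt) nst ut adj_sym us.
have : y \in X by rewrite E in_setU yD orbT.
rewrite memX memN => /orP [/andP [] //|/andP [yC _]].
by have := sep _ _ yC yD; rewrite eqxx.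
Qed.

(** The neighbours of [v] of the various colours then form a clique with [v],
    which is too large. *)
Lemma P4_free_perfect (G : sgraph) : free p_P4 G -> perfect G.
Proof.
move=> F; case: (perfect_dec G) => // /exists_minimal_imperfect [H HG MI].
have {}F := free_embeds HG F; have [v _] := MI_edge MI.
have [f fP] := MI_colour_minus MI v.
have [h hP] := fin_all_exists2 (fun c => MI_class_neighbour c MI fP).
move=> vh.
have hI : injective h.
  move=> c d e; have := hP c; rewrite e; have := hP d; rewrite !inE.
  by move=> /andP [_ /eqP ->] /andP [_ /eqP].
have : #|v |: [set h c | c : 'I_(clique_number H)]| <= clique_number H.
  apply: clique_le; apply/cliqueP => x y; rewrite !inE.
  move=> /predU1P [->|/imsetP [c _ ->]] /predU1P [->|/imsetP [d _ ->]].
  - by rewrite eqxx.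
  - by rewrite vh.
  - by rewrite adj_sym vh.
  - by rewrite (inj_eq hI) => cd; apply: (P4_free_classes MI F fP cd).
rewrite cardsU1 card_imset // card_ord (_ : v \notin _) ?ltnn //.
by apply/imsetP => -[c _ vc]; have := vh c; rewrite -vc adj_irrefl.
Qed.

Lemma free_3K1_alpha (G : sgraph) : free p_3K1 G -> alpha G <= 2.
Proof.
move=> F; rewrite leqNgt; apply/negP => a3; apply: F; apply/independence_ge3P.
have [S iS Sa] := max_independent G; rewrite -Sa cardE in a3.
exists [set x in take 3 (enum S)]; split.
  apply: independent_sub iS; apply/subsetP => x; rewrite inE => /mem_take.
  by rewrite mem_enum.
rewrite cardsE; have /card_uniqP -> := take_uniq 3 (enum_uniq S).
exact: size_takel.
Qed.

Lemma free_K3_omega (G : sgraph) : free p_K3 G -> clique_number G <= 2.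
Proof.
move=> F; rewrite leqNgt; apply/negP => w3; apply: F.
have [S cS Sw] := max_clique G; rewrite -Sw in w3.
exact: (clique_contains cS w3).
Qed.

Lemma MI_card_ge5 (G : sgraph) : minimal_imperfect G -> 5 <= #|G|.
Proof.
by move=> MI; rewrite (MI_card MI); have := MI_alpha_ge2 MI; have := MI_omega_ge2 MI; nia.
Qed.

(** * Pairs with a paw or its complement *)

Lemma connect_closed (T : finType) (e : rel T) (P : pred T) x y :
  (forall u v, P u -> e u v -> P v) -> P x -> connect e x y -> P y.
Proof.
move=> cl Px /connectP [s]; elim: s x Px => [|z s IH] x Px /= => [_ ->//|].
by move=> /andP [xz]; apply: IH; apply: cl Px xz.
Qed.

(** Stated for a relation, to be applied to adjacency and to nonadjacency. *)
Section Paw.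
Variables (T : finType) (e : rel T).
Hypothesis eS : symmetric e.
Hypothesis paw : forall x y z u, e x y -> e x z -> e y z -> e u x -> e u y || e u z.

Let in_triangle x := [exists y, exists z, [&& e x y, e x z & e y z]].

Lemma in_triangleP x y z : e x y -> e x z -> e y z -> in_triangle x.
Proof.
by move=> xy xz yz; apply/existsP; exists y; apply/existsP; exists z; rewrite xy xz.
Qed.

Lemma edge_in_triangle x u : in_triangle x -> e u x -> exists2 t, e t x & e t u.
Proof.
case/existsP => y /existsP [z /and3P [xy xz yz]] ux.
have /orP [uy|uz] := paw xy xz yz ux; first by exists y; rewrite eS.
by exists z; rewrite eS.
Qed.

(** Olariu's theorem on a connected component with a triangle, in the form that it
    contains no edge and vertex without edge between them.  Every edge at a vertex
    of a triangle is in a triangle, hence so is every edge of the component.  Then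
    the set of vertices with a neighbour on [uv] absorbs its neighbours. *)
Lemma olariu a b c u v x : e a b -> e a c -> e b c ->
  connect e a u -> connect e a x -> e u v -> e x u || e x v.
Proof.
move=> ab ac bc au ax uv.
have eC : connect_sym e by apply: sym_connect_sym.
have tri x' : connect e a x' -> in_triangle x'.
  apply: connect_closed (in_triangleP ab ac bc) => y z ty yz.
  have zy : e z y by rewrite eS.
  have [t ty' tz] := edge_in_triangle ty zy.
  by apply: (@in_triangleP z y t) => //; rewrite eS.
have ux : connect e u x by apply: connect_trans ax; rewrite eC.
have vu : e v u by rewrite eS.
have [t tu tv] := edge_in_triangle (tri _ au) vu.
apply: (@connect_closed _ e (fun y => e y u || e y v) u x) ux; last by rewrite uv orbT.
have main p q s y z : e p q -> e s p -> e s q -> e y p -> e z y -> e z p || e z q.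
  move=> pq sp sq yp zy; case yq: (e y q); first exact: (paw yp yq pq zy).
  have ps : e p s by rewrite eS.
  have ys : e y s.
    by have := @paw p q s y pq ps; rewrite eS sq yq => /(_ isT yp).
  have /orP [->//|zs] := paw yp ys ps zy.
  exact: (paw sp sq pq zs).
move=> y z /orP [yu|yv] yz; have zy : e z y by rewrite eS.
  exact: (main u v t y z).
by rewrite orbC; apply: (main v u t y z).
Qed.

Lemma olariu_P4 a b c p q r s : e a b -> e a c -> e b c -> connect e a p ->
  e p q -> e q r -> e r s -> e s p = false -> e s q = false -> False.
Proof.
move=> ab ac bc ap pq qr rs sp sq.
have aS : connect e a s.
  apply: connect_trans ap _; apply: connect_trans (connect1 pq) _.
  by apply: connect_trans (connect1 qr) (connect1 rs).
by have := olariu ab ac bc ap aS pq; rewrite sp sq.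
Qed.

End Paw.

Lemma paw_adj (G : sgraph) : free p_paw G -> forall x y z u : G,
  x -- y -> x -- z -> y -- z -> u -- x -> (u -- y) || (u -- z).
Proof.
move=> /free_all1 F x y z u xy xz yz ux; apply: contraT.
rewrite negb_or => /andP [uy uz].
case: (@not_contains_rows _ _ [:: x; y; z; u] p_paw F) => //.
  rewrite /= !inE !negb_or (adj_neq xy) (adj_neq xz) (adj_neq yz).
  rewrite [x == u]eq_sym (adj_neq ux) /= andbT; apply/andP; split.
    by apply: contraNneq uz => <-.
  by apply: contraNneq uy => <-; rewrite adj_sym.
by rewrite /= xy xz yz (adj_sym x u) ux (adj_sym y u) (negbTE uy) (adj_sym z u) (negbTE uz).
Qed.

Lemma paw_nonadj (G : sgraph) : free p_copaw G -> forall x y z u : G,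
  nonadj x y -> nonadj x z -> nonadj y z -> nonadj u x -> nonadj u y || nonadj u z.
Proof.
move=> /free_all1 F x y z u /andP [xy nxy] /andP [xz nxz] /andP [yz nyz] /andP [ux nux].
rewrite /nonadj; have [->|uy] := eqVneq u y; first by rewrite yz nyz.
have [->|uz] := eqVneq u z; first by rewrite adj_sym nyz.
apply: contraT; rewrite /= negb_or !negbK => /andP [yu zu].
case: (@not_contains_rows _ _ [:: x; y; u; z] p_copaw F) => //.
  by rewrite /= !inE !negb_or xy xz [x == u]eq_sym ux [y == u]eq_sym uy yz uz.
rewrite /= (negbTE nxy) (adj_sym x u) (negbTE nux) (negbTE nxz) (adj_sym y u) yu.
by rewrite (negbTE nyz) zu.
Qed.

Definition p_C5 := edge_code 5 [:: (0, 1); (1, 2); (2, 3); (3, 4); (4, 0)].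

Lemma P4_of_imperfect (G : sgraph) : ~ perfect G -> contains p_P4 G.
Proof. by move=> n; case: (contains_dec G p_P4) => // /P4_free_perfect. Qed.

Lemma outside (G : sgraph) (xs : seq G) :
  size xs < #|G| -> exists x, x \notin xs.
Proof.
move=> lt; have [/existsP [x xn]|N] := boolP [exists x, x \notin xs]; first by exists x.
move: lt; rewrite ltnNge => /negP []; apply: leq_trans (card_size xs).
apply: subset_leq_card; apply/subsetP => x _; apply: contraNT N => xn.
by apply/existsP; exists x.
Qed.

(** A vertex outside an induced [P_4] can only close it to a [C_5], and this can
    happen only once. *)
Lemma copaw_paw (G : sgraph) : free p_copaw G -> free p_paw G ->
  ~ (G ≃ Cn 5) -> perfect G.
Proof.
move=> F1 F2 nC; have F := free_all2 F1 F2.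
case: (perfect_dec G) => // nP.
have [[|a [|b [|c [|d []]]]] // u4 P4] := P4_of_imperfect nP.
have [H /embeds_card HG /MI_card_ge5 H5] := exists_minimal_imperfect nP.
have [x xn] := @outside G [:: a; b; c; d] (leq_trans H5 HG).
have ux : uniq [:: x; a; b; c; d] by rewrite cons_uniq xn.
have /eqP [xa xb xc xd] : [seq x -- y | y <- [:: a; b; c; d]] == [:: true; false; false; true].
  by apply: (forcedP F P4 ux (P := pred1 [:: true; false; false; true])); vm_compute.
have C5 : rows [:: x; a; b; c; d] = p_C5.
  by move: P4; rewrite /= xa xb xc xd => ->.
case: nC; apply: (coded_iso (p := p_C5)); last exact: coded_Cn5.
exists [:: x; a; b; c; d]; split => // y; apply: contraT => yn.
have uy : uniq [:: y; x; a; b; c; d] by rewrite cons_uniq yn.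
by case: (forcedF F C5 uy); vm_compute.
Qed.

Lemma nonadj3K1 (G : sgraph) : contains p_3K1 G ->
  exists x y z : G, [/\ nonadj x y, nonadj x z & nonadj y z].
Proof.
move=> [[|a [|b [|c []]]] //]; rewrite /= !inE !negb_or.
move=> /and3P [/andP [ab ac] bc _] [ab' ac' bc']; exists a, b, c.
by rewrite /nonadj ab ac bc ab' ac' bc'.
Qed.

(** The path [p q r s] is, for nonadjacency, the path [r p s q]. *)
Lemma P4_nonadj (G : sgraph) (p q r s : G) :
  uniq [:: p; q; r; s] -> rows [:: p; q; r; s] = p_P4 ->
  [/\ nonadj r p, nonadj p s, nonadj s q, nonadj q r = false & nonadj q p = false].
Proof.
rewrite /= !inE !negb_or => /and4P [/and3P [pq pr ps] /andP [qr qs] rs _].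
move=> [pq' pr' ps' qr' qs' rs']; split; rewrite /nonadj ?ps ?ps' //.
- by rewrite eq_sym pr adj_sym pr'.
- by rewrite eq_sym qs adj_sym qs'.
- by rewrite qr' andbF.
- by rewrite adj_sym pq' andbF.
Qed.

(** Nonadjacency connects every vertex to an induced [P_4], as a vertex adjacent
    to all of it would create a diamond; so a stable set of size 3 would
    contradict Olariu's theorem for the complement. *)
Lemma copaw_diamond_alpha (G : sgraph) : free p_copaw G -> free p_diamond G ->
  contains p_P4 G -> free p_3K1 G.
Proof.
move=> F1 /free_all1 F2 [[|p [|q [|r [|s []]]]] // u4 P4].
case/nonadj3K1 => a [b [c [ab ac bc]]].
have [rp ps sq qr qp] := P4_nonadj u4 P4.
have pr : connect (@nonadj G) p r by apply: connect1; rewrite nonadj_sym.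
have cS : connect_sym (@nonadj G) by apply: sym_connect_sym; exact: nonadj_sym.
have conn x : connect (@nonadj G) p x.
  have [|xn] := boolP (x \in [:: p; q; r; s]).
    rewrite !inE => /or4P [] /eqP-> //.
      exact: connect_trans (connect1 ps) (connect1 sq).
    exact: connect1.
  have ux : uniq [:: x; p; q; r; s] by rewrite cons_uniq xn.
  have := forcedP F2 P4 ux (P := fun b => ~~ all id b).
  move=> /(_ isT); rewrite -has_predC => /hasP [_ /mapP [y ys ->] /= xy].
  have nyx : nonadj y x.
    by rewrite /nonadj adj_sym xy andbT; apply: contraNneq xn => <-.
  apply: connect_trans (connect1 nyx); move: ys.
  rewrite !inE => /or4P [] /eqP-> //.
    exact: connect_trans (connect1 ps) (connect1 sq).
  exact: connect1.
apply: (olariu_P4 (@nonadj_sym G) (paw_nonadj F1) ab ac bc _ rp ps sq) => //.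
by apply: connect_trans pr; rewrite cS.
Qed.

Definition p_coC5 := edge_code 5 [:: (0, 2); (0, 3); (1, 3); (1, 4); (2, 4)].

Lemma coded_Cn5_co : coded (Cn 5) p_coC5.
Proof.
exists [:: ordc 5 0; ordc 5 2; ordc 5 4; ordc 5 1; ordc 5 3]; split; [by []| |by vm_compute].
by case; do 5?case=> //.
Qed.

Section CyclicGraphs.
Variables (G : sgraph) (n : nat) (c : nat -> G).

Lemma antihole_far i j : cyclic (@nonadj G) n c -> i.+1 < j -> j.+1 < i + n ->
  c i -- c j.
Proof.
move=> cyc ij jn; have := cyclic_far cyc ij jn.
by rewrite /nonadj (cyclic_neq cyc) /= => [/negbFE||]; arith.
Qed.

Lemma antihole_succ i : cyclic (@nonadj G) n c -> (c i -- c i.+1) = false.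
Proof. by move=> cyc; have /andP [_ /negbTE] := cyclic_succ cyc i. Qed.

Lemma antihole_last i : cyclic (@nonadj G) n c -> 0 < n ->
  (c (i + n.-1) -- c i) = false.
Proof. by move=> cyc n0; have /andP [_ /negbTE] := cyclic_last cyc i n0. Qed.

Lemma cyclic_cover (r : rel G) (s : seq G) : cyclic r n c -> 0 < n ->
  s = map c (iota 0 n) -> (forall x, (forall i, x != c i) -> False) ->
  forall x, x \in s.
Proof.
move=> cyc n0 -> out x; apply: contraT => xs; case: (out x) => i.
apply: contraNneq xs => ->; rewrite -(cyclic_mod cyc); apply: map_f.
by rewrite mem_iota ltn_mod.
Qed.

End CyclicGraphs.

(** So the complement of a minimal imperfect subgraph is an odd cycle.  It has
    length 5, as the complements of longer ones contain a diamond, and every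
    further vertex would create a forbidden subgraph. *)
Lemma copaw_diamond (G : sgraph) : free p_copaw G -> free p_diamond G ->
  ~ (G ≃ Cn 5) -> perfect G.
Proof.
move=> F1 F2 nC; case: (perfect_dec G) => // nP.
have F3 := copaw_diamond_alpha F1 F2 (P4_of_imperfect nP).
have [H HG MI] := exists_minimal_imperfect nP.
have a2 : alpha H = 2.
  apply/eqP; rewrite eqn_leq MI_alpha_ge2 // andbT.
  exact/free_3K1_alpha/(free_embeds HG).
have [n [c [on n5 cyc]]] := MI_antihole_in HG MI a2.
have far i j := antihole_far (i := i) (j := j) cyc.
have succ i := antihole_succ i cyc.
have [n7|n7] := ltnP 6 n.
  case: (@not_contains_rows _ _ [:: c 0; c 1; c 3; c 5]
    [:: [:: false; true; true]; [:: true; true]; [:: true]; [::]] (free_all1 F2)) => //.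
    by rewrite /= !inE !(cyclic_neq cyc) //; arith.
  by rewrite /= !succ !far //; arith.
have {n5 n7} n5 : n = 5 by arith.
subst n; case: nC; apply: (coded_iso (p := p_coC5)); last exact: coded_Cn5_co.
have u5 : uniq (map c (iota 0 5)) by rewrite /= !inE !(cyclic_neq cyc) //; arith.
have C5 : rows (map c (iota 0 5)) = p_coC5.
  have last : (c 0 -- c 4) = false by rewrite adj_sym (antihole_last 0 cyc).
  by rewrite /= last !succ !far.
exists (map c (iota 0 5)); split => //; apply: (cyclic_cover cyc) => // x xc.
have ux : uniq (x :: map c (iota 0 5)).
  by rewrite cons_uniq u5 andbT; apply/mapP => -[i _ xi]; have := xc i; rewrite xi eqxx.
by apply: (forcedF (free_all2 F3 F2) C5 ux); vm_compute.
Qed.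

(** The same argument as for [copaw_diamond_alpha], with adjacency in place of
    nonadjacency. *)
Lemma codiamond_paw_triangle_free (G : sgraph) : free p_codiamond G ->
  free p_paw G -> contains p_P4 G -> free p_K3 G.
Proof.
move=> /free_all1 F1 F2 [[|p [|q [|r [|s []]]]] // u4 P4].
move=> [[|a [|b [|c []]]] // _ [ab ac bc]].
have [pq pr ps qr [qs rs]] : [/\ p -- q, (p -- r) = false, (p -- s) = false, q -- r &
    (q -- s) = false /\ r -- s] by case: P4.
have cS : connect_sym (@adj G) by apply: sym_connect_sym; exact: adj_sym.
have conn4 y : y \in [:: p; q; r; s] -> connect (@adj G) p y.
  have pr' := connect_trans (connect1 pq) (connect1 qr).
  rewrite !inE => /or4P [] /eqP-> //; first exact: connect1.
  exact: connect_trans pr' (connect1 rs).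
have conn x : connect (@adj G) x p.
  have [/conn4|xn] := boolP (x \in [:: p; q; r; s]); first by rewrite cS.
  have ux : uniq [:: x; p; q; r; s] by rewrite cons_uniq xn.
  have := forcedP F1 P4 ux (P := seq.has id).
  move=> /(_ isT) /hasP [_ /mapP [y ys ->] /= xy].
  by apply: connect_trans (connect1 xy) _; rewrite cS conn4.
by apply: (olariu_P4 (@adj_sym G) (paw_adj F2) ab ac bc _ pq qr rs) => //; rewrite adj_sym.
Qed.

Lemma codiamond_paw (G : sgraph) : free p_codiamond G -> free p_paw G ->
  ~ (G ≃ Cn 5) -> perfect G.
Proof.
move=> F1 F2 nC; case: (perfect_dec G) => // nP.
have F3 := codiamond_paw_triangle_free F1 F2 (P4_of_imperfect nP).
have [H HG MI] := exists_minimal_imperfect nP.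
have w2 : clique_number H = 2.
  apply/eqP; rewrite eqn_leq MI_omega_ge2 // andbT.
  exact/free_K3_omega/(free_embeds HG).
have [n [c [on n5 _ cyc]]] := MI_hole_in HG MI w2.
have far i j := cyclic_far cyc (i := i) (j := j).
have succ i := cyclic_succ cyc i.
have [n7|n7] := ltnP 6 n.
  case: (@not_contains_rows _ _ [:: c 0; c 1; c 3; c 5]
    [:: [:: true; false; false]; [:: false; false]; [:: false]; [::]] (free_all1 F1)) => //.
    by rewrite /= !inE !(cyclic_neq cyc) //; arith.
  by rewrite /= !succ !far //; arith.
have {n5 n7} n5 : n = 5 by arith.
subst n; case: nC; apply: (coded_iso (p := p_C5)); last exact: coded_Cn5.
have u5 : uniq (map c (iota 0 5)) by rewrite /= !inE !(cyclic_neq cyc) //; arith.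
have C5 : rows (map c (iota 0 5)) = p_C5.
  have last : c 0 -- c 4 by rewrite adj_sym; exact: (cyclic_last cyc 0).
  by rewrite /= last !succ !far.
exists (map c (iota 0 5)); split => //; apply: (cyclic_cover cyc) => // x xc.
have ux : uniq (x :: map c (iota 0 5)).
  by rewrite cons_uniq u5 andbT; apply/mapP => -[i _ xi]; have := xc i; rewrite xi eqxx.
by apply: (forcedF (free_all2 F3 F1) C5 ux); vm_compute.
Qed.

(** A stable set of size 3 and an induced [P_4] lie in different components of
    the complement, where they span the complement of [K_3] and [P_4]. *)
Lemma copaw_alpha3 (G : sgraph) : free p_copaw G -> free p_coK3P4 G ->
  contains p_3K1 G -> perfect G.
Proof.
move=> F1 F2 /nonadj3K1 [a [b [c [ab ac bc]]]].
apply: P4_free_perfect => -[[|p [|q [|r [|s []]]]] // u4 P4].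
have [rp ps sq qr qp] := P4_nonadj u4 P4.
have cS : connect_sym (@nonadj G) by apply: sym_connect_sym; exact: nonadj_sym.
have rx x : x \in [:: p; q; r; s] -> connect (@nonadj G) r x.
  have rs := connect_trans (connect1 rp) (connect1 ps).
  rewrite !inE => /or4P [] /eqP-> //; first exact: connect1.
  exact: connect_trans rs (connect1 sq).
have nar : ~~ connect (@nonadj G) a r.
  apply/negP => ar.
  exact: (olariu_P4 (@nonadj_sym G) (paw_nonadj F1) ab ac bc ar rp ps sq).
have ay y : y \in [:: a; b; c] -> connect (@nonadj G) a y.
  by rewrite !inE => /or3P [] /eqP-> //; exact: connect1.
have J y x : y \in [:: a; b; c] -> x \in [:: p; q; r; s] -> y -- x.
  move=> /ay yabc /rx xr; have nyx : ~~ nonadj y x.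
    apply: contraNN nar => yx; apply: connect_trans yabc _.
    by apply: connect_trans (connect1 yx) _; rewrite cS.
  move: nyx; rewrite /nonadj negb_and !negbK => /orP [/eqP yx|//].
  by case/negP: nar; apply: connect_trans yabc _; rewrite yx cS.
have N (y x : G) : nonadj y x -> (y != x) * ((y -- x) = false).
  by case/andP => ? /negbTE.
apply: (@not_contains_rows _ _ [:: a; b; c; p; q; r; s] ([:: [:: false; false; true;
  true; true; true]; [:: false; true; true; true; true]; nseq 4 true] ++ p_P4)
  (free_all1 F2)) => //.
  rewrite (cat_uniq [:: a; b; c] [:: p; q; r; s]) u4 andbT; apply/andP; split.
    by rewrite /= !inE negb_or (N _ _ ab) (N _ _ ac) (N _ _ bc).
  by apply/hasPn => x xs; apply/negP => /J /(_ xs); rewrite adj_irrefl.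
rewrite -P4 /= (N _ _ ab) (N _ _ ac) (N _ _ bc) !(J a) ?(J b) ?(J c) //;
  by rewrite !inE eqxx ?orbT.
Qed.

Lemma connected_closed (G : sgraph) (P : pred G) x y :
  connected G -> (forall u v, P u -> u -- v -> P v) -> P x -> P y.
Proof. by move=> conn cl Px; apply: connect_closed cl Px (conn x y). Qed.

Definition on_cycle (G : sgraph) n (c : nat -> G) : pred G :=
  fun x => x \in map c (iota 0 n).

Lemma on_cycleP (G : sgraph) (r : rel G) n c x : cyclic r n c -> 0 < n ->
  reflect (exists i, x = c i) (on_cycle n c x).
Proof.
move=> cyc n0; apply: (iffP mapP) => [[i _ ->]|[i ->]]; first by exists i.
exists (i %% n); last by rewrite (cyclic_mod cyc).
by rewrite mem_iota ltn_mod.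
Qed.

Lemma connected_hole (G : sgraph) n c : connected G -> 3 <= n -> odd n ->
  cyclic (@adj G) n c ->
  (forall u i, (forall j, u != c j) -> u -- c i -> False) -> odd_cycle G.
Proof.
move=> conn n3 on cyc out; exists n; split => //; apply: (cyclic_iso n3 cyc) => x.
have n0 : 0 < n by arith.
apply/(on_cycleP _ cyc n0); apply: (@connected_closed _ (on_cycle n c) (c 0) x conn); last first.
  by apply/(on_cycleP _ cyc n0); exists 0.
move=> u v /(on_cycleP _ cyc n0) [i ->] iv; apply: contraT => vn.
case: (out v i); last by rewrite adj_sym.
by move=> j; apply: contraNneq vn => ->; apply/(on_cycleP _ cyc n0); exists j.
Qed.

(** A neighbour [u] of [c i] outside an odd hole must also be adjacent to
    [c (i + 2)], hence, going round the odd cycle, to [c (i + 1)]. *)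
Lemma fork_hole (G : sgraph) n c u i : free p_fork G -> free p_K3 G ->
  odd n -> 5 <= n -> cyclic (@adj G) n c -> (forall j, u != c j) -> u -- c i -> False.
Proof.
move=> F1 F2 on n5 cyc uc ui; have F := free_all2 F1 F2.
have far j k := cyclic_far cyc (i := j) (j := k).
have succ j := cyclic_succ cyc j.
have step j : u -- c j.+1 -> u -- c j.+3.
  pose xs := [:: c j; c j.+1; c j.+2; c j.+3].
  have P4 : rows xs = p_P4 by rewrite /= !succ !far //; arith.
  have uxs : uniq (u :: xs).
    rewrite cons_uniq; apply/andP; split.
      by rewrite !inE !negb_or !uc.
    by rewrite /= !inE !(cyclic_neq cyc) //; arith.
  have := forcedP F P4 uxs (P := fun b => nth false b 1 ==> nth false b 3).
  by move=> /(_ isT) /implyP.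
have all m : u -- c (i + n + m.*2).
  elim: m => [|m IH]; first by rewrite addn0 (cyclic_period cyc).
  have := step (i + n + m.*2).-1; rewrite prednK; last by arith.
  by move=> /(_ IH); congr (_ -- c _); arith.
have ui' := all n.+1./2.
have e : i + n + (n.+1./2).*2 = i.+1 + n + n.
  by have := odd_double_half n.+1; rewrite /= on /=; arith.
rewrite e !(cyclic_period cyc) in ui'.
apply: F2; exists [:: u; c i; c i.+1]; last by rewrite /= ui ui' succ.
by rewrite /= !inE !negb_or !uc /= (cyclic_neq cyc) //; arith.
Qed.

Lemma fork_paw (G : sgraph) : free p_fork G -> free p_paw G ->
  connected G -> ~ odd_cycle G -> perfect G.
Proof.
move=> F1 F2 conn nO; case: (perfect_dec G) => // nP.
have [[|p [|q [|r [|s []]]]] // u4 P4] := P4_of_imperfect nP.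
have [pq _ ps qr [qs rs]] : [/\ p -- q, (p -- r) = false, (p -- s) = false, q -- r &
    (q -- s) = false /\ r -- s] by case: P4.
have F3 : free p_K3 G.
  move=> [[|a [|b [|c []]]] // _ [ab ac bc]].
  by apply: (olariu_P4 (@adj_sym G) (paw_adj F2) ab ac bc (conn a p) pq qr rs);
     rewrite adj_sym.
have [H HG MI] := exists_minimal_imperfect nP.
have w2 : clique_number H = 2.
  apply/eqP; rewrite eqn_leq MI_omega_ge2 // andbT.
  exact/free_K3_omega/(free_embeds HG).
have [n [c [on n5 _ cyc]]] := MI_hole_in HG MI w2.
case: nO; apply: (connected_hole conn _ on cyc); first by arith.
by move=> u i uc; apply: (fork_hole F1 F3 on n5 cyc uc).
Qed.

(** * Odd antiholes in connected claw-free graphs *)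

(** A variant of a lemma of Ben Rebea: a connected claw-free graph that has a
    stable set of size 3 and an odd antihole contains both a [P_5] and a hammer. *)

Section Antihole.
Variables (G : sgraph) (p : code) (n : nat).
Hypotheses (pP : p \in [:: p_P5; p_hammer]) (F : free_all [:: p_claw; p] G).
Hypotheses (on : odd n) (n5 : 5 <= n).

(** Suppose that [u] misses [c 0] and [c 1].  Any neighbour [c m] of [u] that is
    adjacent to both gives a claw; so only [c 2] and [c (n - 1)] may be neighbours,
    and each of them is the centre of a claw on two consecutive vertices farther
    away, unless [n = 5]. *)
Lemma antihole_dominating (c : nat -> G) u j k : cyclic (@nonadj G) n c ->
  (forall i, u != c i) -> u -- c j -> (u -- c k) || (u -- c k.+1).
Proof.
move=> cyc0 uc0 uj0; apply: contraT; rewrite negb_or => /andP [uk0 uk1].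
pose d i := c (k + i); have cyc : cyclic (@nonadj G) n d by apply: cyclic_shift.
have {uc0} uc i : u != d i by apply: uc0.
have {uk0} u0 : (u -- d 0) = false by rewrite /d addn0; apply/negbTE.
have {uk1} u1 : (u -- d 1) = false by rewrite /d addn1; apply/negbTE.
have n0 : 0 < n by arith.
have {j uj0} [j jn uj] : exists2 j, j < n & u -- d j.
  exists ((j + k * n.-1) %% n); first by rewrite ltn_mod.
  suff -> : d ((j + k * n.-1) %% n) = c j by [].
  apply/eqP; rewrite /d (proj1 cyc0) modnDmr.
  have -> : k + (j + k * n.-1) = k * n + j by rewrite -{2}(prednK n0); arith.
  by rewrite modnMDl.
move: cyc uc u0 u1 uj; move: d => {cyc0} c cyc uc u0 u1 uj.
have far i l := antihole_far (i := i) (j := l) cyc.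
have succ i := antihole_succ i cyc.
have neq i l := cyclic_neq cyc (i := i) (j := l).
have [n7|n7] := ltnP 6 n; last first.
  have {n7} ? : n = 5 by arith.
  subst n; pose xs := map c (iota 0 5).
  have C5 : rows xs = p_coC5.
    have last : (c 0 -- c 4) = false by rewrite adj_sym (antihole_last 0 cyc).
    by rewrite /= last !succ !far.
  have ux : uniq (u :: xs).
    by rewrite /= !inE !negb_or !uc !neq //; arith.
  have := forcedP F C5 ux (P := fun b => [|| nth false b 0, nth false b 1 | ~~ seq.has id b]).
  rewrite /= u0 u1 /= orbF.
  have -> : forced [:: p_claw; p] p_coC5
      (fun b => [|| nth false b 0, nth false b 1 | ~~ seq.has id b]).
    by move: pP; rewrite !inE => /orP [] /eqP->; vm_compute.
  move=> /(_ isT); rewrite !negb_or => /and3P [u2 u3 u4].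
  case: j jn uj => [|[|[|[|[|[]]]]]] // _; rewrite ?u0 ?u1 ?(negbTE u2) //.
    by rewrite (negbTE u3).
  by rewrite (negbTE u4).
have claw : free_all [:: p_claw] G by apply/free_all1/F; rewrite inE eqxx.
have no m : 2 < m -> m < n.-1 -> (u -- c m) = false.
  move=> m2 mn; apply: contraTF isT => um.
  case: (@not_contains_rows _ _ [:: u; c 0; c 1; c m] [:: [:: false; false; true];
      [:: false; true]; [:: true]; [::]] claw) => //.
    by rewrite /= !inE !negb_or !uc !neq //; arith.
  by rewrite /= u0 u1 um succ !far //; arith.
have [j2|j2] : j = 2 \/ j = n.-1.
- case: (ltnP 2 j) => [j3|j3].
    case: (ltnP j n.-1) => [/(no _ j3)|]; first by rewrite uj.
    by right; arith.
  by left; case: j uj j3 {jn} => [|[|[]]] //; rewrite ?u0 ?u1.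
- subst j; case: (@not_contains_rows _ _ [:: u; c 2; c 4; c 5]
      [:: [:: true; false; false]; [:: true; true]; [:: false]; [::]] claw) => //.
    by rewrite /= !inE !negb_or !uc !neq //; arith.
  by rewrite /= uj !no ?succ ?far //; arith.
have n43 : n - 3 = (n - 4).+1 by arith.
case: (@not_contains_rows _ _ [:: u; c (n - 4); c (n - 3); c j]
    [:: [:: false; false; true]; [:: false; true]; [:: true]; [::]] claw) => //.
  by rewrite /= !inE !negb_or !uc !neq //; arith.
by rewrite /= uj !no ?n43 ?succ ?far //; arith.
Qed.

Section Fixed.
Variable c : nat -> G.
Hypothesis cyc : cyclic (@nonadj G) n c.

Let n0 : 0 < n. Proof. arith. Qed.
Let claw : free_all [:: p_claw] G.
Proof. by apply/free_all1/F; rewrite inE eqxx. Qed.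
Let far i l := antihole_far (i := i) (j := l) cyc.
Let succ i := antihole_succ i cyc.
Let neq i l := cyclic_neq cyc (i := i) (j := l).

(** As the cycle is odd, neighbours and nonneighbours cannot alternate. *)
Lemma antihole_two_neighbours u j : (forall i, u != c i) -> u -- c j ->
  exists k, (u -- c k) && (u -- c k.+1).
Proof.
move=> uc uj.
have [/hasP [k _ kP]|/hasPn N] :=
  boolP (seq.has (fun k => (u -- c k) && (u -- c k.+1)) (iota 0 n)); first by exists k.
have alt m : m <= n -> (u -- c m) = odd m (+) (u -- c 0).
  elim: m => [|m IH] mn; first by [].
  have := antihole_dominating m cyc uc uj; have := N m.
  rewrite mem_iota add0n mn => /(_ isT); rewrite /= IH; last exact: ltnW.
  by case: (u -- c m.+1); case: (odd m); case: (u -- c 0).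
have := alt n (leqnn n); rewrite -{1}[n]add0n (cyclic_period cyc) on.
by case: (u -- c 0).
Qed.

(** So a vertex at distance two from the antihole would produce a claw. *)
Lemma antihole_near u : connected G -> (forall i, u != c i) -> exists j, u -- c j.
Proof.
move=> conn uc.
pose P := [pred x | on_cycle n c x || seq.has (fun j => x -- c j) (iota 0 n)].
have : P u.
  apply: (@connected_closed _ P (c 0) u conn); last first.
    by apply/orP; left; apply/(on_cycleP _ cyc n0); exists 0.
  move=> x y Px xy; rewrite /P /=; apply: contraT; rewrite negb_or => /andP [yn].
  move=> /hasPn yc.
  have {}yc i : (y -- c i) = false.
    by rewrite -(cyclic_mod cyc) (negbTE (yc _ _)) // mem_iota ltn_mod.
  have yneq i : y != c i.
    by apply: contraNneq yn => ->; apply/(on_cycleP _ cyc n0); exists i.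
  case/orP: Px => [/(on_cycleP _ cyc n0) [i xi]|/hasP [j _ xj]].
    by rewrite xi adj_sym yc in xy.
  have xneq i : x != c i by apply: contraTneq xy => ->; rewrite adj_sym yc.
  have [k /andP [xk xk1]] := antihole_two_neighbours xneq xj.
  case: (@not_contains_rows _ _ [:: x; y; c k; c k.+1]
    [:: [:: true; true; true]; [:: false; false]; [:: false]; [::]] claw) => //.
    by rewrite /= !inE !negb_or (adj_neq xy) !xneq !yneq neq //; arith.
  by rewrite /= xy xk xk1 !yc succ.
case/orP => [/(on_cycleP _ cyc n0) [i ui]|/hasP [j _ uj]]; last by exists j.
by have := uc i; rewrite ui eqxx.
Qed.

End Fixed.

Hypothesis conn : connected G.

Lemma antihole_dom (c : nat -> G) u k : cyclic (@nonadj G) n c ->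
  (forall i, u != c i) -> (u -- c k) || (u -- c k.+1).
Proof.
move=> cyc uc; have [j uj] := antihole_near cyc conn uc.
exact: antihole_dominating cyc uc uj.
Qed.

(** Let [u] and [v] miss [c 0].  Each of [c 2], [c 3] is adjacent to [c 0] and thus
    missed by [u] or [v]; as none of them misses both, say [u] misses [c 2] and [v]
    misses [c 3].  Then [u], [c 3], [c 0], [c 2], [v] is a [P_5], and [c 1] yields a
    hammer with triangle [u], [c 1], [c 3]. *)
Lemma antihole_triple1 (c : nat -> G) u v i : cyclic (@nonadj G) n c ->
  (forall i, u != c i) -> (forall i, v != c i) ->
  nonadj u v -> (u -- c i) = false -> (v -- c i) = false -> False.
Proof.
move=> cyc0 uc0 vc0 uv u0 v0.
pose d k := c (i + k); have cyc : cyclic (@nonadj G) n d by apply: cyclic_shift.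
have {}u0 : (u -- d 0) = false by rewrite /d addn0.
have {}v0 : (v -- d 0) = false by rewrite /d addn0.
have {uc0} uc k : u != d k by apply: uc0.
have {vc0} vc k : v != d k by apply: vc0.
move: d cyc u0 v0 uc vc => {c cyc0 i} c cyc u0 v0 uc vc.
have claw : free_all [:: p_claw] G by apply/free_all1/F; rewrite inE eqxx.
have far i l := antihole_far (i := i) (j := l) cyc.
have succ i := antihole_succ i cyc.
have neq i l := cyclic_neq cyc (i := i) (j := l).
have main x y : (forall i, x != c i) -> (forall i, y != c i) -> nonadj x y ->
    (x -- c 0) = false -> (y -- c 0) = false -> (x -- c 2) = false -> False.
  move=> xc yc /andP [xy /negbTE nxy] x0 y0 x2.
  have x1 : x -- c 1 by have := antihole_dom 0 cyc xc; rewrite x0.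
  have y1 : y -- c 1 by have := antihole_dom 0 cyc yc; rewrite y0.
  have x3 : x -- c 3 by have := antihole_dom 2 cyc xc; rewrite x2.
  have y3 : (y -- c 3) = false.
    apply: contraTF isT => y3.
    case: (@not_contains_rows _ _ [:: x; y; c 0; c 3]
      [:: [:: false; false; true]; [:: false; true]; [:: true]; [::]] claw) => //.
      by rewrite /= !inE !negb_or xy !xc !yc neq //; arith.
    by rewrite /= nxy x0 x3 y0 y3 far //; arith.
  have y2 : y -- c 2 by have := antihole_dom 2 cyc yc; rewrite y3 orbF.
  case: (@not_contains_rows _ _ [:: x; y; c 0; c 1; c 2; c 3]
    [:: [:: false; false; true; false; true]; [:: false; true; true; false];
      [:: false; true; true]; [:: false; true]; [:: false]; [::]] F) => //.
  - by rewrite /= !inE !negb_or xy !xc !yc !neq //; arith.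
  - by rewrite /= nxy x0 x1 x2 x3 y0 y1 y2 y3 !succ !far //; arith.
  by move: pP; rewrite !inE => /orP [] /eqP->; vm_compute.
case u2 : (u -- c 2); last exact: (main u v).
case v2 : (v -- c 2); last by apply: (main v u); rewrite // nonadj_sym.
have /andP [uv' /negbTE nuv] := uv.
case: (@not_contains_rows _ _ [:: u; v; c 0; c 2]
  [:: [:: false; false; true]; [:: false; true]; [:: true]; [::]] claw) => //.
  by rewrite /= !inE !negb_or uv' !uc !vc neq //; arith.
by rewrite /= nuv u0 v0 u2 v2 far //; arith.
Qed.

Variable c : nat -> G.
Hypothesis cyc : cyclic (@nonadj G) n c.

Let far i l := antihole_far (i := i) (j := l) cyc.
Let succ i := antihole_succ i cyc.
Let neq i l := cyclic_neq cyc (i := i) (j := l).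
Let claw : free_all [:: p_claw] G.
Proof. by apply/free_all1/F; rewrite inE eqxx. Qed.

Lemma antihole_consecutive i j : nonadj (c i) (c j) -> c j = c i.+1 \/ c i = c j.+1.
Proof. by rewrite (proj2 cyc) => /orP [] e; [left|right]; apply/eqP; rewrite (proj1 cyc). Qed.

Lemma antihole_triple2 u i j : (forall k, u != c k) ->
  nonadj u (c i) -> nonadj u (c j) -> nonadj (c i) (c j) -> False.
Proof.
move=> uc /andP [_ ui] /andP [_ uj] /antihole_consecutive [e|e].
  by have := antihole_dom i cyc uc; rewrite -e (negbTE ui) (negbTE uj).
by have := antihole_dom j cyc uc; rewrite -e (negbTE ui) (negbTE uj).
Qed.

Lemma antihole_triple3 i j k :
  nonadj (c i) (c j) -> nonadj (c i) (c k) -> nonadj (c j) (c k) -> False.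
Proof.
have main a b x : c b = c a.+1 -> nonadj (c a) (c x) -> nonadj (c b) (c x) -> False.
  move=> e ax; rewrite e => /antihole_consecutive [e'|/eqP].
    by move: ax; rewrite e' /nonadj far ?andbF //; arith.
  rewrite (proj1 cyc) -[a.+1]addn1 -[x.+1]addn1 eqn_modDr -(proj1 cyc) => /eqP e'.
  by move: ax; rewrite e' nonadj_irrefl.
move=> ij ik jk; have [e|e] := antihole_consecutive ij; first exact: main e ik jk.
exact: main e jk ik.
Qed.

(** Every vertex of the antihole is missed by one of [u], [v], [w], as there is no
    claw, and by only one, by [antihole_triple1].  Consecutive vertices are missed
    by different ones and the cycle is odd, so that some three consecutive vertices
    are missed by three different ones. *)
Lemma antihole_triple0 u v w : (forall i, u != c i) -> (forall i, v != c i) ->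
  (forall i, w != c i) -> nonadj u v -> nonadj u w -> nonadj v w -> False.
Proof.
move=> uc vc wc uv uw vw; pose U := [:: u; v; w].
have Uc x i : x \in U -> x != c i.
  by rewrite !inE => /or3P [] /eqP->.
have Un x y : x \in U -> y \in U -> x != y -> nonadj x y.
  rewrite !inE => /or3P [] /eqP-> /or3P [] /eqP->; rewrite ?eqxx // => _;
  by rewrite // nonadj_sym.
pose m k := if ~~ (u -- c k) then u else if ~~ (v -- c k) then v else w.
have mU k : m k \in U by rewrite /m; do 2?case: ifP => _; rewrite !inE eqxx ?orbT.
have mk k : (m k -- c k) = false.
  rewrite /m; case: ifPn => [/negbTE//|]; rewrite negbK => uk.
  case: ifPn => [/negbTE//|]; rewrite negbK => vk; apply: contraTF isT => wk.
  have [/andP [uv' /negbTE nuv] /andP [uw' /negbTE nuw]] := (uv, uw).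
  have /andP [vw' /negbTE nvw] := vw.
  case: (@not_contains_rows _ _ [:: u; v; w; c k]
    [:: [:: false; false; true]; [:: false; true]; [:: true]; [::]] claw) => //.
    by rewrite /= !inE !negb_or uv' uw' vw' uc vc wc.
  by rewrite /= nuv nuw nvw uk vk wk.
have mE x k : x \in U -> (x -- c k) = (x != m k).
  move=> xU; have [->|xm] := eqVneq x (m k); first exact: mk.
  apply: contraT => xk; case: (@antihole_triple1 c x (m k) k) => //.
  - by move=> i; apply: Uc.
  - by move=> i; apply: Uc.
  - exact: Un.
  - exact/negbTE.
have m1 k : m k != m k.+1.
  have := antihole_dom k cyc (fun i => Uc (m k) i (mU k)).
  by rewrite !mE // eqxx.
have [k k2] : exists k, m k != m k.+2.
  have [/hasP [k _ kP]|/hasPn N] :=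
    boolP (seq.has (fun k => m k != m k.+2) (iota 0 n)); first by exists k.
  have ev j b : j.*2 + b <= n -> m (j.*2 + b) = m b.
    elim: j => [|j IH] jn; first by [].
    rewrite -IH; last by arith.
    have := N (j.*2 + b); rewrite mem_iota => /(_ _) /negPn/eqP -> //; arith.
  have n2 : n = n./2.*2 + 1 by have := odd_double_half n; rewrite on; arith.
  have m0 : m n = m 0.
    by rewrite /m -{1 2}[n]add0n (cyclic_period cyc).
  have := m1 0; rewrite -m0 n2 ev ?eqxx //; arith.
have mc i j : m i != c j by apply: Uc.
have [xy yz] := (m1 k, m1 k.+1).
have [/andP [_ /negbTE nxy] /andP [_ /negbTE nxz]] :=
  (Un _ _ (mU k) (mU k.+1) xy, Un _ _ (mU k) (mU k.+2) k2).
have /andP [_ /negbTE nyz] := Un _ _ (mU k.+1) (mU k.+2) yz.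
case: (@not_contains_rows _ _ [:: m k; m k.+1; m k.+2; c k; c k.+1; c k.+2]
  [:: [:: false; false; false; true; true]; [:: false; true; false; true];
      [:: true; true; false]; [:: false; true]; [:: false]; [::]] F) => //.
- by rewrite /= !inE !negb_or xy yz k2 !mc !neq //; arith.
- have mE' i j : (m i -- c j) = (m i != m j) by apply: mE.
  rewrite /= nxy nxz nyz !mE' !eqxx [m k.+1 == m k]eq_sym xy yz k2.
  by rewrite [m k.+2 == m k]eq_sym k2 [m k.+2 == m k.+1]eq_sym yz !succ far //; arith.
by move: pP; rewrite !inE => /orP [] /eqP->; vm_compute.
Qed.

Lemma antihole_no_stable3 : free p_3K1 G.
Proof.
have n0 : 0 < n by arith.
have out x : ~~ on_cycle n c x -> forall i, x != c i.
  by move=> xn i; apply: contraNneq xn => ->; apply/(on_cycleP _ cyc n0); exists i.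
case/nonadj3K1 => x [y [z [xy xz yz]]].
have [yx zx] : nonadj y x /\ nonadj z x by rewrite ![nonadj _ x]nonadj_sym.
have zy : nonadj z y by rewrite nonadj_sym.
have oc u := on_cycleP u cyc n0.
case: (boolP (on_cycle n c x)) => [/oc [i xi]|/out xo];
case: (boolP (on_cycle n c y)) => [/oc [j yj]|/out yo];
case: (boolP (on_cycle n c z)) => [/oc [k zk]|/out zo]; subst.
- exact: (antihole_triple3 xy xz yz).
- exact: (antihole_triple2 zo zx zy xy).
- exact: (antihole_triple2 yo yx yz xz).
- by apply: (antihole_triple1 cyc yo zo yz (i := i)); apply/negbTE; case/andP: yx; case/andP: zx.
- exact: (antihole_triple2 xo xy xz yz).
- by apply: (antihole_triple1 cyc xo zo xz (i := j)); apply/negbTE; case/andP: xy; case/andP: zy.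
- by apply: (antihole_triple1 cyc xo yo xy (i := k)); apply/negbTE; case/andP: xz; case/andP: yz.
- exact: (antihole_triple0 xo yo zo xy xz yz).
Qed.

End Antihole.

(** * Two colour classes of a claw-free graph *)

Lemma claw_free_stable (G : sgraph) (S : {set G}) x : free p_claw G ->
  independent S -> #|[set y in S | x -- y]| <= 2.
Proof.
move=> /free_all1 F /independentP iS; rewrite leqNgt; apply/card_gt2P.
move=> [a [b [c [[]]]]]; rewrite !inE => /andP [aS xa] /andP [bS xb] /andP [cS xc].
move=> [ab bc ca]; case: (@not_contains_rows _ _ [:: x; a; b; c] p_claw F) => //.
  by rewrite /= !inE !negb_or (adj_neq xa) (adj_neq xb) (adj_neq xc) ab bc eq_sym ca.
by rewrite /= xa xb xc !(negbTE (iS _ _ _ _)).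
Qed.

(** By [MI_kempe] they induce a connected graph, and its degrees are at most 2. *)
Lemma colour_pair_sequence (G : sgraph) v (f : G -> 'I_(clique_number G)) c d x0 :
  minimal_imperfect G -> free p_claw G -> proper_minus v f -> c != d ->
  exists s : seq G, [/\ uniq s, s =i colour_class v f c :|: colour_class v f d,
    size s = (alpha G).*2,
    forall i, i.+1 < size s -> nth x0 s i -- nth x0 s i.+1 &
    forall i j, i < j -> j < size s -> nth x0 s i -- nth x0 s j ->
      (j == i.+1) || (i == 0) && (j == (size s).-1)].
Proof.
move=> MI F fP cd; set C := colour_class v f c; set D := colour_class v f d.
have iC : independent C by apply: class_independent.
have iD : independent D by apply: class_independent.
have CD : [disjoint C & D].
  rewrite -setI_eq0; apply/eqP/setP => x; rewrite !inE; apply: contraNF cd.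
  by case/andP => /andP [_ /eqP<-] /andP [_ /eqP<-].
have cC : #|C| = alpha G by apply: MI_class_card.
have cD : #|D| = alpha G by apply: MI_class_card.
have cCD : #|C :|: D| = (alpha G).*2.
  by rewrite cardsU disjoint_setI0 // cards0 subn0 cC cD addnn.
have [x1 x1A] : exists x, x \in C :|: D.
  by apply/set0Pn; rewrite -cards_eq0 cCD; have := MI_alpha_ge2 MI; case: (alpha G).
have deg x : x \in C :|: D -> #|[set y in C :|: D | x -- y]| <= 2.
  case/setUP => xS.
    apply: leq_trans (claw_free_stable x F iD); apply: subset_leq_card.
    apply/subsetP => y; rewrite inE => /andP [/setUP [yC|yD] xy]; last by rewrite inE yD.
    by have /independentP /(_ x y xS yC) := iC; rewrite xy.
  apply: leq_trans (claw_free_stable x F iC); apply: subset_leq_card.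
  apply/subsetP => y; rewrite inE => /andP [/setUP [yC|yD] xy]; first by rewrite inE yC.
  by have /independentP /(_ x y xS yD) := iD; rewrite xy.
have [|s [sU sA sR sC]] := path_or_cycle (@adj_sym G) x1A _ deg.
  by move=> X x xX Xs cl; apply: (MI_kempe MI fP cd xX Xs) => y z yX zA; apply: cl.
exists s; have sz : size s = (alpha G).*2.
  by rewrite -(card_uniqP sU) -cCD; apply: eq_card => x; rewrite sA.
split => // [i li|i j ij lj].
  by rewrite !(set_nth_default x1) //; [apply: sR | apply: ltnW].
by rewrite !(set_nth_default x1) //; [apply: sC | apply: ltn_trans lj].
Qed.

(** With a stable set of size 3, two colour classes contain a [P_5]; hence
    [alpha = 2] and the complement of the subgraph is an odd cycle. *)
Lemma claw_P5 (G : sgraph) : free p_claw G -> free p_P5 G ->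
  connected G -> contains p_3K1 G -> perfect G.
Proof.
move=> F1 F2 conn a3; case: (perfect_dec G) => // nP.
have [H HG MI] := exists_minimal_imperfect nP.
have [a2|a2] := ltnP 2 (alpha H); last first.
  have {}a2 : alpha H = 2 by apply/eqP; rewrite eqn_leq a2 MI_alpha_ge2.
  have [n [c [on n5 cyc]]] := MI_antihole_in HG MI a2.
  by case: (antihole_no_stable3 (p := p_P5) _ (free_all2 F1 F2) on n5 conn cyc).
have [x0 _] := MI_edge MI; have [f fP] := MI_colour_minus MI x0.
have w2 := MI_omega_ge2 MI.
have cd : Ordinal (ltnW w2) != Ordinal w2 by [].
have {F1}F1 := free_embeds HG F1; have {F2}F2 := free_embeds HG F2.
have [s [sU _ sz sR sC]] := colour_pair_sequence x0 MI F1 fP cd.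
case: F2; exists (take 5 s); first exact: take_uniq.
have no i j : i.+1 < j -> j <= 4 -> (nth x0 s i -- nth x0 s j) = false.
  move=> ij j4; apply/negbTE/negP => /sC; rewrite sz => /(_ _ _)/orP [||/eqP|/andP [_ /eqP]];
  arith.
case: s sz no sR {sC sU} => [|a [|b [|c [|d [|e s]]]]] /= sz no sR; try by arith.
have := sR 0 isT; have := sR 1 isT; have := sR 2 isT; have := sR 3 isT => /=.
have := no 0 2 isT isT; have := no 0 3 isT isT; have := no 0 4 isT isT.
have := no 1 3 isT isT; have := no 1 4 isT isT; have := no 2 4 isT isT => /=.
by rewrite take0 /= => -> -> -> -> -> -> -> -> -> ->.
Qed.

(** * Claw-free graphs without a hammer *)

Definition p_P6 := edge_code 6 [:: (0, 1); (1, 2); (2, 3); (3, 4); (4, 5)].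

(** The adjacencies to an induced [P_6] that create neither a claw nor a hammer. *)
Definition P6_patterns : seq bitseq :=
  [:: [:: false; false; false; false; false; false];
      [:: true; false; false; false; false; false];
      [:: false; false; false; false; false; true];
      [:: true; false; false; false; false; true];
      [:: false; true; true; true; true; false]].

Lemma P6_window (G : sgraph) w (xs : seq G) : free_all [:: p_claw; p_hammer] G ->
  rows xs = p_P6 -> uniq (w :: xs) -> [seq w -- x | x <- xs] \in P6_patterns.
Proof.
move=> F P6 u; apply: (forcedP F P6 u (P := fun b => b \in P6_patterns)).
by vm_compute.
Qed.

(** A vertex adjacent to an inner vertex of a window is adjacent to its four
    inner vertices, which the window shifted by one does not allow. *)
Lemma hammer_hole (G : sgraph) n c w i : free_all [:: p_claw; p_hammer] G ->
  7 <= n -> cyclic (@adj G) n c -> (forall j, w != c j) -> (w -- c i) = false.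
Proof.
move=> F n7 cyc wc; apply/negbTE/negP => wi; set k := i + n - 2.
have far j l := cyclic_far cyc (i := j) (j := l).
have succ j := cyclic_succ cyc j.
have W l : [seq w -- x | x <- map c [:: l; l.+1; l.+2; l.+3; l.+4; l.+4.+1]]
    \in P6_patterns.
  apply: P6_window => //.
    by rewrite /= !succ !far //; arith.
  rewrite cons_uniq; apply/andP; split; first by rewrite !inE !negb_or !wc.
  by rewrite /= !inE !(cyclic_neq cyc) //; arith.
have := W k; have := W k.+1; rewrite /= (_ : c k.+2 = c i).
  rewrite wi; case: (w -- c k.+1); case: (w -- c k.+3) => //;
  case: (w -- c k.+4) => //; case: (w -- c k.+4.+1) => //;
  by case: (w -- c k); case: (w -- c k.+4.+2).
by rewrite -(cyclic_period cyc i); congr c; rewrite /k; arith.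
Qed.

(** Likewise along a path of which an end is a neighbour. *)
Lemma window_path (b : nat -> bool) m : 6 <= m -> b 0 ->
  (forall k, k + 5 < m ->
    [:: b k; b k.+1; b k.+2; b k.+3; b k.+4; b k.+4.+1] \in P6_patterns) ->
  forall i, 0 < i -> i < m.-1 -> b i = false.
Proof.
move=> m6 b0 W i i0 im; have [i5|i5] := ltnP 4 i.
  have [k kE] : exists k, i = k.+4.+1 by exists (i - 5); arith.
  subst i; have W1 : k.+1 + 5 < m by arith.
  have W0 : k + 5 < m by arith.
  have := W _ W1; have := W _ W0.
  case: (b k.+4.+1) => //; case: (b k.+4) => //; case: (b k.+3) => //;
  case: (b k.+2) => //; case: (b k.+1) => //; case: (b k) => //;
  by case: (b k.+4.+2).
have W0 : 0 + 5 < m by arith.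
have := W 0 W0; rewrite b0.
by case: i i0 i5 {im} => [|[|[|[|[|]]]]] // _ _;
  case: (b 1); case: (b 2); case: (b 3); case: (b 4); case: (b 5).
Qed.

(** Otherwise [x] would be a component of the graph of these two colours. *)
Lemma MI_other_class (G : sgraph) v (f : G -> 'I_(clique_number G)) c d x :
  minimal_imperfect G -> proper_minus v f -> c != d ->
  x \in colour_class v f c -> exists2 y, y \in colour_class v f d & x -- y.
Proof.
move=> MI fP cd xc; have [/existsP [y /andP [yd xy]]|N] :=
  boolP [exists y, (y \in colour_class v f d) && (x -- y)]; first by exists y.
have : [set x] = colour_class v f c :|: colour_class v f d.
  apply: (MI_kempe MI fP cd (x0 := x)); first by rewrite inE.
    by apply/subsetP => y; rewrite in_set1 => /eqP->; rewrite in_setU xc.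
  move=> y z; rewrite !in_set1 => /eqP-> /setUP [zc|zd] xz.
    by have /independentP /(_ x z xc zc) := class_independent c fP; rewrite xz.
  by case/existsP: N; exists z; rewrite zd xz.
move/setP => E; have : #|[set x]| >= #|colour_class v f c|.
  by apply: subset_leq_card; apply/subsetP => y yc; rewrite E in_setU yc.
by rewrite cards1 (MI_class_card MI c fP); have := MI_alpha_ge2 MI; case: (alpha G) => [|[]].
Qed.

Definition p_C6 := edge_code 6 [:: (0, 1); (1, 2); (2, 3); (3, 4); (4, 5); (5, 0)].

(** The nonzero adjacencies to an induced [C_6] that create neither of them. *)
Definition C6_patterns : seq bitseq :=
  [:: [:: true; true; false; true; true; false];
      [:: false; true; true; false; true; true];
      [:: true; false; true; true; false; true]].

Section HammerFree.
Variables (G : sgraph).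
Hypotheses (MI : minimal_imperfect G) (F1 : free p_claw G) (F2 : free p_hammer G).
Hypotheses (a3 : 2 < alpha G).
Let F : free_all [:: p_claw; p_hammer] G := free_all2 F1 F2.

Variables (v : G) (f : G -> 'I_(clique_number G)).
Hypothesis fP : proper_minus v f.
Variables (c d e : 'I_(clique_number G)) (s : seq G).
Hypotheses (cd : c != d) (ce : c != e) (de : d != e).
Let C := colour_class v f c.
Let D := colour_class v f d.
Let E := colour_class v f e.
Hypotheses (sU : uniq s) (sA : s =i C :|: D) (sz : size s = (alpha G).*2).
Local Notation n := (size s).
Local Notation at_ := (nth v s).
Hypothesis sR : forall i, i.+1 < n -> at_ i -- at_ i.+1.
Hypothesis sC : forall i j, i < j -> j < n -> at_ i -- at_ j ->
  (j == i.+1) || (i == 0) && (j == n.-1).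

Lemma third_notin w : w \in E -> w \notin s.
Proof.
rewrite sA in_setU !inE => /andP [-> /eqP->] /=.
by rewrite eq_sym (negbTE ce) eq_sym (negbTE de).
Qed.

Lemma v_notin : v \notin s.
Proof. by rewrite sA in_setU !inE eqxx. Qed.

Let n6 : 6 <= n. Proof. by rewrite sz; arith. Qed.
Let sI i j : i < n -> j < n -> (at_ i == at_ j) = (i == j).
Proof. by move=> li lj; rewrite nth_uniq. Qed.
Let mem_at i : i < n -> at_ i \in C :|: D.
Proof. by move=> li; rewrite -sA mem_nth. Qed.
Let at_index x : x \in C :|: D -> exists2 i, i < n & x = at_ i.
Proof.
by rewrite -sA => xs; exists (index x s); rewrite ?index_mem // nth_index.
Qed.
Let CD0 x : x \in C -> x \in D -> False.
Proof. by rewrite !inE => /andP [_ /eqP->] /andP [_]; rewrite (negbTE cd). Qed.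

(** If the two colour classes span a path, a neighbour [w] of its first vertex of a
    third colour is adjacent to its two ends only.  The path and [w] then have
    [2 * alpha + 1] vertices and no triangle, contrary to [MI_subset_bound]. *)
Lemma hammer_path : ~~ (at_ 0 -- at_ n.-1) -> False.
Proof.
move=> open; have far i j : i.+1 < j -> j < n -> (at_ i -- at_ j) = false.
  move=> ij jn; apply/negbTE/negP => aij; have ij' : i < j by arith.
  have /orP [/eqP|/andP [/eqP i0 /eqP jE]] := sC ij' jn aij; first by arith.
  by move/negP: open; apply; rewrite -i0 -jE.
have n0 : 0 < n by arith.
have [w wE w0] : exists2 w, w \in E & at_ 0 -- w.
  have /setUP [x0C|x0D] := mem_at n0.
    exact: MI_other_class MI fP ce x0C.
  exact: MI_other_class MI fP de x0D.
have wn := third_notin wE.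
have W k : k + 5 < n -> [:: w -- at_ k; w -- at_ k.+1; w -- at_ k.+2;
    w -- at_ k.+3; w -- at_ k.+4; w -- at_ k.+4.+1] \in P6_patterns.
  move=> kn; have ne x : x < n -> w != at_ x.
    by move=> xn; apply: contraNneq wn => ->; apply: mem_nth.
  apply: (@P6_window G w (map at_ [:: k; k.+1; k.+2; k.+3; k.+4; k.+4.+1])) => //.
    by rewrite /= !sR ?far //; arith.
  rewrite cons_uniq; apply/andP; split; first by rewrite !inE !negb_or !ne //; arith.
  by rewrite /= !inE !sI; arith.
have inner i : 0 < i -> i < n.-1 -> (w -- at_ i) = false.
  by apply: (window_path (b := fun i => w -- at_ i)) => //; rewrite adj_sym.
pose A := w |: (C :|: D).
have cA : #|A| = (alpha G).*2.+1.
  rewrite /A cardsU1 -sA wn -sz -(card_uniqP sU); congr _.+1.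
  by apply: eq_card => x; rewrite sA.
have AT : A != setT.
  apply/eqP => /setP /(_ v); rewrite in_setT in_setU1 -sA (negbTE v_notin) orbF.
  by move=> /eqP vw; move: wE; rewrite -vw !inE eqxx.
have [T [Q [iT cQ TA QA le]]] := MI_subset_bound MI AT.
have Q2 : #|Q| <= 2.
  have one (S : {set G}) : independent S -> #|Q :&: S| <= 1.
    exact: clique_indep_le1.
  have QS : #|Q| <= #|Q :&: [set w]| + (#|Q :&: C| + #|Q :&: D|).
    apply: leq_trans (_ : #|Q :&: [set w] :|: (Q :&: C :|: Q :&: D)| <= _).
      apply: subset_leq_card; apply/subsetP => x xQ; have := subsetP QA _ xQ.
      by rewrite /A in_setU1 in_setU !(in_setU, in_setI, in_set1) xQ.
    by apply: leq_trans (leq_card_setU _ _) _; rewrite leq_add2l leq_card_setU.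
  have QC := one C (class_independent c fP); have QD := one D (class_independent d fP).
  have [wQ|wQ] := boolP (w \in Q); last first.
    have : #|Q :&: [set w]| = 0; last by arith.
    apply/eqP; rewrite cards_eq0; apply/eqP/setP => x; rewrite !inE.
    by apply/negP => /andP [xQ /eqP xw]; rewrite xw (negbTE wQ) in xQ.
  have Qw : #|Q :&: [set w]| <= 1.
    by rewrite -(cards1 w) subset_leq_card // subsetIr.
  apply: leq_trans QS _; have [->|/set0Pn [x]] := eqVneq (Q :&: C) set0.
    by rewrite cards0; arith.
  have [->|/set0Pn [y]] := eqVneq (Q :&: D) set0; first by rewrite cards0; arith.
  rewrite !in_setI => /andP [yQ yD] /andP [xQ xC].
  have /cliqueP cl := cQ.
  have xy : x -- y.
    by apply: cl => //; apply/eqP => xy; apply: (CD0 xC); rewrite xy.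
  have ends z : z \in Q -> z \in C :|: D -> z = at_ 0 \/ z = at_ n.-1.
    move=> zQ zCD; have [i li zE] := at_index zCD.
    have wz : w -- z.
      have wz : w != z by apply: contraNneq wn => wz; rewrite sA wz.
      exact: cl.
    have [i0|i0] := posnP i; first by left; rewrite zE i0.
    have [il|il] := ltnP i n.-1; first by rewrite zE inner in wz.
    by right; rewrite zE; congr (at_ _); arith.
  have [xA yA] : x \in C :|: D /\ y \in C :|: D by rewrite !in_setU xC yD orbT.
  case: (ends x xQ xA) (ends y yQ yA) => xE [] yE; move: xy; rewrite xE yE ?adj_irrefl //.
    by move=> h; case/negP: open.
  by rewrite adj_sym => h; case/negP: open.
have := leq_trans le (leq_mul (independent_le iT) Q2).
by rewrite cA muln2 ltnn.
Qed.

(** The classes span an even cycle; it has length 6, since longer cycles admit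
    no further neighbour.  The three vertices of a third colour are then attached
    to it in the three possible ways, which gives the line graph of [K_{3,3}], and
    [v] cannot be attached to this graph. *)
Lemma hammer_cycle : at_ 0 -- at_ n.-1 -> False.
Proof.
move=> close.
have [w0 w0E] : exists w, w \in E.
  by apply/set0Pn; rewrite -cards_eq0 (MI_class_card MI e fP); case: (alpha G) a3.
have nbrC w : w \in E -> exists2 x, x \in s & w -- x.
  move=> wE; have ec : e != c by rewrite eq_sym.
  have [x xC wx] := MI_other_class MI fP ec wE; exists x => //.
  by rewrite sA in_setU xC.
have [n7|n7] := ltnP 6 n.
  have n3 : 3 <= n by arith.
  have cyc := sequence_cyclic (@adj_sym G) (@adj_irrefl G) sU n3 sR sC close.
  have [x xs w0x] := nbrC _ w0E; have w0n := third_notin w0E.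
  have nn : 0 < n by arith.
  have := hammer_hole (index x s) F n7 cyc (w := w0).
  rewrite modn_small ?index_mem // nth_index // w0x => H.
  suff : true = false by []. apply: H => j.
  by apply: contraNneq w0n => ->; rewrite mem_nth // ltn_mod.
have n6E : n = 6 by arith.
have far i j : i.+1 < j -> j < 6 -> (i == 0) && (j == 5) = false ->
    (at_ i -- at_ j) = false.
  move=> ij j6 ij5; apply/negbTE/negP => aij; have ij' : i < j by arith.
  have jn : j < n by rewrite n6E.
  by have := sC ij' jn aij; rewrite n6E ij5 orbF => /eqP; arith.
have sE : s = map at_ (iota 0 6).
  by rewrite -{1}(mkseq_nth v s) n6E.
have C6 : rows s = p_C6.
  have last : at_ 0 -- at_ 5 by move: close; rewrite n6E.
  have succ i : i < 5 -> at_ i -- at_ i.+1 by move=> i5; apply: sR; rewrite n6E.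
  by rewrite sE /= last !succ // !far.
have pat x : x \notin s -> [seq x -- y | y <- s] \in nseq 6 false :: C6_patterns.
  move=> xn; have u : uniq (x :: s) by rewrite cons_uniq xn.
  apply: (forcedP F C6 u (P := fun b => b \in nseq 6 false :: C6_patterns)).
  by vm_compute.
have patE w : w \in E -> [seq w -- y | y <- s] \in C6_patterns.
  move=> wE; have := pat w (third_notin wE); rewrite inE => /predU1P [e0|//].
  have [x xs wx] := nbrC w wE; have : (w -- x) \in nseq 6 false.
    by rewrite -e0; apply: map_f.
  by rewrite mem_nseq wx.
have iE : independent E by apply: class_independent.
have diff w w' : w \in E -> w' \in E -> w != w' ->
    [seq w -- y | y <- s] != [seq w' -- y | y <- s].
  move=> wE w'E ww'; have wn := third_notin wE; have w'n := third_notin w'E.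
  have u : uniq (w :: w' :: s) by rewrite !cons_uniq inE negb_or ww' wn w'n.
  have nww' : (w -- w') = false by apply/negbTE; move/independentP: iE; apply.
  have E6 : rows (w' :: s) = [seq w' -- y | y <- s] :: p_C6 by rewrite /= C6.
  have := patE w' w'E; move: E6; move: [seq w' -- y | y <- s] => b' E6 b'P.
  have H := forcedP F E6 u (P := fun b => nth false b 0 || (behead b != b')).
  have : forced [:: p_claw; p_hammer] (b' :: p_C6)
      (fun b => nth false b 0 || (behead b != b')).
    by move: b'P; rewrite !inE => /or3P [] /eqP->; vm_compute.
  by move=> /H; rewrite /= nww'.
have cE : 2 < #|E| by rewrite (MI_class_card MI e fP).
have /card_gt2P [x [y [z [[xE yE zE] [xy yz zx]]]]] := cE.
have xz : x != z by rewrite eq_sym.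
have [x' y'] : (x -- y) = false /\ (x -- z) = false.
  by split; apply/negbTE; move/independentP: iE; apply.
have z' : (y -- z) = false by apply/negbTE; move/independentP: iE; apply.
have := diff _ _ xE yE xy; have := diff _ _ xE zE xz; have := diff _ _ yE zE yz.
have R : rows [:: x, y, z & s] = [:: [:: false, false & [seq x -- t | t <- s]],
    (false :: [seq y -- t | t <- s]), [seq z -- t | t <- s] & p_C6].
  by rewrite /= x' y' z' C6.
have vn : v \notin [:: x, y, z & s].
  have vE t : t \in E -> v != t.
    by move=> tE; apply: contraTneq tE => <-; rewrite !inE eqxx.
  by rewrite !inE !negb_or !vE // v_notin.
have u : uniq [:: v, x, y, z & s].
  rewrite cons_uniq vn /= sU !inE !negb_or xy xz yz.
  by rewrite !third_notin.
have := patE x xE; have := patE y yE; have := patE z zE.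
move: [seq x -- t | t <- s] [seq y -- t | t <- s] [seq z -- t | t <- s] R => p q r R.
move=> rP qP pP qr pr pq.
(* By [pat] only the nonzero adjacencies of [v] to the cycle are to be refuted. *)
have vs : [seq v -- t | t <- s] \in C6_patterns.
  have := pat v v_notin; rewrite inE => /predU1P [e0|//].
  have [t tC vt] := MI_class_neighbour c MI fP.
  have : (v -- t) \in nseq 6 false by rewrite -e0; apply: map_f; rewrite sA in_setU tC.
  by rewrite mem_nseq vt.
have H := forcedP F R u (P := fun b => drop 3 b \notin C6_patterns).
suff /H : forced [:: p_claw; p_hammer]
    [:: [:: false, false & p], false :: q, r & p_C6] (fun b => drop 3 b \notin C6_patterns).
  by rewrite /= drop0 vs.
have cases b : b \in C6_patterns -> exists2 i, i < 3 & b = nth [::] C6_patterns i.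
  by move=> bP; exists (index b C6_patterns); rewrite ?index_mem // nth_index.
move: qr pr pq; have [i i3 ->] := cases p pP; have [j j3 ->] := cases q qP.
have [k k3 ->] := cases r rP.
case: i i3 => [|[|[|]]] // _; case: j j3 => [|[|[|]]] // _;
  case: k k3 => [|[|[|]]] // _; rewrite ?eqxx // => _ _ _; by vm_compute.
Qed.

End HammerFree.

Lemma hammer_not_MI (G : sgraph) : minimal_imperfect G -> free p_claw G ->
  free p_hammer G -> 2 < alpha G -> 2 < clique_number G -> False.
Proof.
move=> MI F1 F2 a3 w3; have [v _] := MI_edge MI.
have [f fP] := MI_colour_minus MI v.
have w1 : 0 < clique_number G by arith.
have w2 : 1 < clique_number G by arith.
have cd : Ordinal w1 != Ordinal w2 by [].
have ce : Ordinal w1 != Ordinal w3 by [].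
have de : Ordinal w2 != Ordinal w3 by [].
have [s [sU sA sz sR sC]] := colour_pair_sequence v MI F1 fP cd.
have [close|open] := boolP (nth v s 0 -- nth v s (size s).-1).
  exact: (hammer_cycle MI F1 F2 a3 fP ce de sU sA sz sR sC close).
exact: (hammer_path MI F1 F2 a3 fP cd ce de sU sA sz sR sC open).
Qed.

(** An odd hole with at least 7 vertices is the whole graph by [hammer_hole], and an
    odd antihole is excluded by [antihole_no_stable3]. *)
Lemma claw_hammer (G : sgraph) : free p_claw G -> free p_hammer G ->
  connected G -> contains p_3K1 G -> ~ odd_cycle G -> perfect G.
Proof.
move=> F1 F2 conn a3 nO; case: (perfect_dec G) => // nP.
have [H HG MI] := exists_minimal_imperfect nP.
have [a2|a2] := ltnP 2 (alpha H); last first.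
  have {}a2 : alpha H = 2 by apply/eqP; rewrite eqn_leq a2 MI_alpha_ge2.
  have [n [c [on n5 cyc]]] := MI_antihole_in HG MI a2.
  by case: (antihole_no_stable3 (p := p_hammer) _ (free_all2 F1 F2) on n5 conn cyc).
have [w3|w2] := ltnP 2 (clique_number H).
  by case: (hammer_not_MI MI (free_embeds HG F1) (free_embeds HG F2)).
have {}w2 : clique_number H = 2 by apply/eqP; rewrite eqn_leq w2 MI_omega_ge2.
have [n [c [on _ nE cyc]]] := MI_hole_in HG MI w2.
have n7 : 7 <= n by arith.
case: nO; apply: (connected_hole conn _ on cyc) => [|u i uc]; first by arith.
by rewrite (hammer_hole i (free_all2 F1 F2) n7 cyc uc).
Qed.

(** * Graphs without co-diamond and gem *)

Section Gem.
Variables (G : sgraph) (S : {set G}).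
Hypotheses (F1 : free p_codiamond G) (F2 : free p_gem G).
Hypotheses (iS : independent S) (Sa : #|S| = alpha G) (S3 : 2 < #|S|).

(** By maximality of [S], [x] has a neighbour in [S], and together they would span a
    co-diamond with [s] and [t]. *)
Lemma misses_one x s t : x \notin S -> s \in S -> t \in S -> s != t ->
  (x -- s) || (x -- t).
Proof.
move=> xS sS tS st; apply: contraT; rewrite negb_or => /andP [/negbTE xs /negbTE xt].
have [/existsP [r /andP [rS xr]]|N] := boolP [exists r, (r \in S) && (x -- r)].
  have iS' := elimT (independentP S) iS.
  case: (@not_contains_rows _ _ [:: s; t; r; x] p_codiamond (free_all1 F1)) => //.
    rewrite /= !inE !negb_or st [r == x]eq_sym (adj_neq xr).
    rewrite (_ : s != r); last by apply: contraFneq xs => ->.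
    rewrite (_ : t != r); last by apply: contraFneq xt => ->.
    rewrite (_ : s != x); last by apply: contraNneq xS => <-.
    by rewrite (_ : t != x) //; apply: contraNneq xS => <-.
  rewrite /= ![_ -- x]adj_sym xs xt xr.
  by rewrite (negbTE (iS' s t _ _)) ?(negbTE (iS' s r _ _)) ?(negbTE (iS' t r _ _)).
have : independent (x |: S).
  have N' r : r \in S -> (x -- r) = false.
    by move=> rS; apply: contraNF N => xr; apply/existsP; exists r; rewrite rS.
  apply/independentP => u w /setU1P [->|uS] /setU1P [->|wS].
  - by rewrite adj_irrefl.
  - by rewrite N'.
  - by rewrite adj_sym N'.
  - by move/independentP: iS; apply.
by move=> /independent_le; rewrite cardsU1 xS -Sa ltnn.
Qed.

(** Three vertices of the clique missing three different vertices of [S] would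
    give a gem. *)
Lemma clique_extends (Q : {set G}) : clique Q -> Q \subset ~: S ->
  exists2 s, s \in S & {in Q, forall q, q -- s}.
Proof.
move=> cQ QS; have [/existsP [s /andP [sS /forall_inP sQ]]|N] :=
  boolP [exists s, (s \in S) && [forall q in Q, q -- s]]; first by exists s.
have miss s : s \in S -> exists2 q, q \in Q & (q -- s) = false.
  move=> sS; have : ~~ [forall q in Q, q -- s].
    by apply: contraNN N => a; apply/existsP; exists s; rewrite sS.
  by rewrite negb_forall_in => /exists_inP [q qQ /negbTE qs]; exists q.
have /card_gt2P [s1 [s2 [s3 [[s1S s2S s3S] [s12 s23 s31]]]]] := S3.
have [q1 q1Q m1] := miss _ s1S; have [q2 q2Q m2] := miss _ s2S.
have [q3 q3Q m3] := miss _ s3S.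
have out q : q \in Q -> q \notin S by move=> /(subsetP QS); rewrite inE.
have hit q s t : q \in Q -> s \in S -> t \in S -> (q -- s) = false -> t != s -> q -- t.
  by move=> /out qS sS tS qs ts; have := misses_one qS tS sS ts; rewrite qs orbF.
have s13 : s1 != s3 by rewrite eq_sym.
have neq (q q' s : G) : (q -- s) = false -> q' -- s -> q' != q.
  by move=> qs; apply: contraTneq => ->; rewrite qs.
have s21 : s2 != s1 by rewrite eq_sym.
have h12 := hit _ _ _ q1Q s1S s2S m1 s21.
have h21 := hit _ _ _ q2Q s2S s1S m2 s12.
have h31 := hit _ _ _ q3Q s3S s1S m3 s13; have h32 := hit _ _ _ q3Q s3S s2S m3 s23.
have n31 := neq _ _ _ m1 h31; have n32 := neq _ _ _ m2 h32.
have n12 := neq _ _ _ m2 h12.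
have cl := elimT (cliqueP Q) cQ.
have qs q s : q \in Q -> s \in S -> q != s.
  by move=> /out qS sS; apply: contraNneq qS => ->.
case: (@not_contains_rows _ _ [:: q3; q1; s1; s2; q2] p_gem (free_all1 F2)) => //.
  by rewrite /= !inE !negb_or n31 n32 n12 s12 ![_ == q2]eq_sym !qs.
have s12' : (s1 -- s2) = false by apply/negbTE; move/independentP: iS; apply.
have [q31 q32 q12] : [/\ q3 -- q1, q3 -- q2 & q1 -- q2] by split; apply: cl.
rewrite /= q31 q32 q12 h31 h32 m1 h12 s12' [s1 -- q2]adj_sym h21.
by rewrite [s2 -- q2]adj_sym m2.
Qed.

(** Each of three vertices of [S] misses at least two vertices of a [C_5] lying
    outside [S], while each vertex of the [C_5] misses at most one of them. *)
Lemma no_C5_outside (c : nat -> G) : cyclic (@nonadj G) 5 c ->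
  (forall i, c i \notin S) -> False.
Proof.
move=> cyc cS; pose xs := map c (iota 0 5).
have far i j := antihole_far (i := i) (j := j) cyc.
have succ i := antihole_succ i cyc.
have C5 : rows xs = p_coC5.
  have last : (c 0 -- c 4) = false by rewrite adj_sym (antihole_last 0 cyc).
  by rewrite /= last !succ !far.
have two s : s \in S -> 2 <= count negb [seq s -- x | x <- xs].
  move=> sS; have u : uniq (s :: xs).
    have sc i : s != c i by apply: contraTneq sS => ->; apply: cS.
    by rewrite /= !inE !negb_or !sc !(cyclic_neq cyc).
  apply: (forcedP (free_all1 F2) C5 u (P := fun b => 2 <= count negb b)).
  by vm_compute.
have /card_gt2P [s1 [s2 [s3 [[s1S s2S s3S] [s12 s23 s31]]]]] := S3.
have one i : (~~ (s1 -- c i)) + ((~~ (s2 -- c i)) + (~~ (s3 -- c i))) <= 1.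
  have := misses_one (cS i) s1S s2S s12; have := misses_one (cS i) s2S s3S s23.
  have := misses_one (cS i) s3S s1S s31; rewrite ![c i -- _]adj_sym.
  by case: (s1 -- c i); case: (s2 -- c i); case: (s3 -- c i).
have := two _ s1S; have := two _ s2S; have := two _ s3S; rewrite /=.
have := one 0; have := one 1; have := one 2; have := one 3; have := one 4.
do 15!(match goal with |- context [nat_of_bool ?b] => move: (nat_of_bool b) => ? end).
clear; lia.
Qed.

End Gem.

(** By [clique_extends], removing a maximum stable set [S] lowers the clique number,
    so that it suffices to colour [G - S].  This is done by induction as long as
    [G - S] has a stable set of size 3.  When it has none, a minimal imperfect
    subgraph would be the complement of an odd cycle, of length 5 as longer ones
    give a gem, and [no_C5_outside] excludes this. *)
Lemma codiamond_gem (G : sgraph) : free p_codiamond G -> free p_gem G ->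
  contains p_3K1 G -> omega_colourable G.
Proof.
have [m] := ubnP #|G|; elim: m G => // m IH G lt F1 F2 c3.
have [S iS Sa] := max_independent G.
have S3 : 2 < #|S|.
  have [T [iT T3]] := proj2 (independence_ge3P G) c3.
  by rewrite Sa -T3; apply: independent_le.
pose H := induced (~: S); have HG : embeds H G by apply: embeds_induced.
have colH : omega_colourable H.
  case: (contains_dec H p_3K1) => [c3'|n3].
    apply: IH => //; [|exact: free_embeds HG F1|exact: free_embeds HG F2].
    rewrite card_sig; apply: leq_trans (lt : _ <= m).
    rewrite (_ : #|_| = #|~: S|); last by apply: eq_card => x; rewrite !inE.
    by have := cardsC S; arith.
  apply: perfect_omega; case: (perfect_dec H) => // nP.
  have [H' HH MI] := exists_minimal_imperfect nP.
  have a2 : alpha H' = 2.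
    apply/eqP; rewrite eqn_leq MI_alpha_ge2 // andbT.
    exact/free_3K1_alpha/(free_embeds HH).
  have [n [c0 [on n5 cyc0]]] := MI_antihole_in HH MI a2.
  have [c cyc cS] : exists2 c : nat -> G, cyclic (@nonadj G) n c &
      forall i, c i \notin S.
    exists (fun i => val (c0 i)); last by move=> i; have := valP (c0 i); rewrite inE.
    case: cyc0 => cI cR; split=> i j; first by rewrite -cI.
    by rewrite -cR /nonadj -val_eqE.
  have far i j := antihole_far (i := i) (j := j) cyc.
  have succ i := antihole_succ i cyc.
  have [n7|n7] := ltnP 6 n.
    case: (@not_contains_rows _ _ [:: c 0; c 2; c 3; c 4; c 5]
      [:: [:: true; true; true; true]; [:: false; true; true]; [:: false; true];
          [:: false]; [::]] (free_all1 F2)) => //.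
      by rewrite /= !inE !(cyclic_neq cyc) //; arith.
    by rewrite /= !succ !far //; arith.
  have n5' : n = 5 by arith.
  by subst n; case: (no_C5_outside F1 F2 iS Sa S3 cyc cS).
have [Q cQ Qw] := max_clique H; have [cQ' QS Qc] := induced_clique cQ.
have [s sS sQ] := clique_extends F1 F2 iS Sa S3 cQ' QS.
have lew : (clique_number H).+1 <= clique_number G.
  rewrite -Qw -Qc; have sn : s \notin val @: Q.
    by apply/negP => /(subsetP QS); rewrite inE sS.
  have cU : clique (s |: val @: Q).
    apply/cliqueP => x y /setU1P [->|xQ] /setU1P [->|yQ] xy.
    - by rewrite eqxx in xy.
    - by rewrite adj_sym sQ.
    - exact: sQ.
    - by move/cliqueP: cQ'; apply.
  by have := clique_le cU; rewrite cardsU1 sn add1n.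
apply/omega_colourableP/(colourable_mono lew).
have /omega_colourableP cH := colH; apply/colourableP.
have [w0|w0] := posnP (clique_number H).
  have allS x : x \in S.
    apply: contraT => xS; have xS' : x \in ~: S by rewrite inE.
    by have := clique_number_gt0 (exist _ x xS' : H); rewrite w0.
  exists (fun=> ord_max) => x y xy.
  by have /independentP /(_ x y (allS x) (allS y)) := iS; rewrite xy.
have [f fP] := induced_colouring w0 cH.
exists (fun x => if x \in S then ord_max else widen_ord (leqnSn _) (f x)).
move=> x y xy; rewrite -val_eqE; case: ifP => xS; case: ifP => yS /=.
- by have /independentP /(_ x y xS yS) := iS; rewrite xy.
- by have := ltn_ord (f y); case: ltngtP.
- by have := ltn_ord (f x); case: ltngtP.
- by apply: fP; rewrite ?inE ?xS ?yS.
Qed.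

(** * Graphs that are not omega-colourable *)

(** Most of them come from an odd hole or its complement by adding a vertex: an
    isolated one, a pendant one, or a copy (twin) of a vertex of the cycle. *)

Definition cycle_edges n := (0, n.-1) :: [seq (i, i.+1) | i <- iota 0 n.-1].
(** The complement of [C_7] is the square of [C_7]. *)
Definition square_edges n := [seq (i, (i + 2) %% n) | i <- iota 0 n] ++ cycle_edges n.

Definition b_C5_K1 := edge_code 6 (cycle_edges 5).
Definition b_C5_pendant := edge_code 6 ((3, 5) :: cycle_edges 5).
Definition b_C5_twin := edge_code 6 ([:: (2, 5); (4, 5)] ++ cycle_edges 5).
Definition b_wheel :=
  edge_code 6 ([seq (i, 5) | i <- iota 0 5] ++ cycle_edges 5).
Definition b_wheel_pendant :=
  edge_code 7 ((5, 6) :: [seq (i, 5) | i <- iota 0 5] ++ cycle_edges 5).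
Definition b_wheel_triangle := edge_code 7
  ([:: (2, 6); (3, 6)] ++ [seq (i, 5) | i <- iota 0 5] ++ cycle_edges 5).
(** The Moser spindle. *)
Definition b_spindle := edge_code 7
  ([:: (0, 5); (3, 5); (4, 5); (1, 6); (2, 6); (3, 6)] ++ cycle_edges 5).
Definition b_C5_join_3K1 := edge_code 8
  ([seq (i, j) | i <- iota 0 5, j <- iota 5 3] ++ cycle_edges 5).
Definition b_C7 := edge_code 7 (cycle_edges 7).
Definition b_coC7 := edge_code 7 (square_edges 7).
Definition b_C7_K1 := edge_code 8 (cycle_edges 7).
Definition b_C7_pendant := edge_code 8 ((4, 7) :: cycle_edges 7).
Definition b_C7_twin := edge_code 8 ([:: (3, 7); (5, 7)] ++ cycle_edges 7).
Definition b_coC7_join_3K1 := edge_code 10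
  ([seq (i, j) | i <- iota 0 7, j <- iota 7 3] ++ square_edges 7).
(** The line graph of [K_{3,3}] with one edge subdivided: it has no triangle
    other than the three edges at a vertex, hence omega = 3, while 10 edges on
    7 vertices cannot be split into three matchings. *)
Definition b_line := edge_code 10
  [:: (0, 1); (0, 2); (0, 4); (0, 6); (1, 3); (1, 5); (1, 6); (2, 3); (2, 4);
      (2, 8); (3, 5); (3, 8); (4, 5); (4, 9); (5, 9); (6, 7); (7, 8); (7, 9);
      (8, 9)].
(** The cycle [C_7] with three vertices replaced by adjacent pairs: its cliques
    have at most 3 vertices, and its stable sets too, so 10 vertices need four
    colours. *)
Definition b_C7_blowup := edge_code 10
  [:: (0, 1); (0, 2); (0, 9); (1, 2); (1, 3); (2, 3); (3, 4); (3, 5); (4, 5);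
      (4, 6); (5, 6); (6, 7); (6, 8); (7, 8); (7, 9); (8, 9)].

(** ** The classes, for coded graphs *)

Definition code_connected (c : code) : bool :=
  all (fun i => seq.has (fun j => cadj c i j) (iota 0 i)) (iota 1 (size c).-1).

Lemma code_connectedP c : code_connected c -> connected (cgraph c).
Proof.
move=> /allP H; have S := @adj_sym (cgraph c).
have cS : connect_sym (@adj (cgraph c)) by apply: sym_connect_sym.
suff T (x z : cgraph c) : z = 0 :> nat -> connect (@adj (cgraph c)) x z.
  move=> x y; have n0 : 0 < size c by apply: leq_ltn_trans (ltn_ord x).
  apply: (@connect_trans _ _ (Ordinal n0)); first exact: T.
  by rewrite cS; apply: T.
move=> z0; have [n lx] := ubnP (x : nat); elim: n x lx => // n IH x.
rewrite ltnS leq_eqVlt => /predU1P [xn|/IH//].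
have [x0|x0] := posnP (x : nat).
  by rewrite (_ : x = z) ?connect0 //; apply: val_inj; rewrite /= x0 z0.
have [|j] := hasP (H x _).
  by rewrite mem_iota x0 add1n prednK ?ltn_ord // (leq_trans x0) // ltnW.
rewrite mem_iota add0n => /andP [_ jx] xj.
have jn : j < size c by apply: ltn_trans jx (ltn_ord x).
apply: (@connect_trans _ _ (Ordinal jn)); first by apply: connect1; exact: xj.
by apply: IH; rewrite -xn.
Qed.

Lemma neighbours_Cn n (i : Cn n) : 3 <= n -> #|neighbours i| = 2.
Proof.
move=> n3; have lt := ltn_ord i.
have E : neighbours i = [set ordS i; ord_pred i].
  apply/setP => j; rewrite !inE [_ -- _]/= /adj /= /sym_rel.
  have -> : (i == ordS j) = (j == ord_pred i).
    by apply/eqP/eqP => ->; rewrite ?ordSK ?ord_predK.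
  case: (i =P j) => //= <-; apply/esym/negbTE.
  apply/norP; split; apply/eqP => /(congr1 (@nat_of_ord n)).
    by rewrite val_ordS; case: eqP; lia.
  by rewrite val_ord_pred; case: eqP; lia.
rewrite E cards2; case: eqP => // /(congr1 (@nat_of_ord n)).
by rewrite val_ordS val_ord_pred; do 2!case: eqP; lia.
Qed.

Lemma card_neighbours_iso (G H : sgraph) (f : G -> H) (x : G) :
  bijective f -> (forall x y, (f x -- f y) = (x -- y)) ->
  #|neighbours (f x)| = #|neighbours x|.
Proof.
move=> fB fE; rewrite -(card_imset _ (bij_inj fB)); apply: eq_card => y.
have [g gK fK] := fB; rewrite -[y]fK (mem_imset _ _ (bij_inj fB)) !inE.
by rewrite fE.
Qed.

Definition code_degree (c : code) (i : nat) : nat :=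
  count (cadj c i) (iota 0 (size c)).

Lemma code_degreeE c (i : cgraph c) : #|neighbours i| = code_degree c i.
Proof.
rewrite /code_degree -val_enum_ord count_map cardE size_filter enumT.
by apply: eq_count => j; rewrite !inE.
Qed.

Definition code_no_cycle (c : code) : bool :=
  seq.has (fun i => code_degree c i != 2) (iota 0 (size c)).

Lemma code_no_cycleP c : code_no_cycle c -> ~ odd_cycle (cgraph c).
Proof.
move=> /hasP [i]; rewrite mem_iota add0n => /andP [_ lt] d.
move=> [n [n3 _ [f fB fE]]]; case/negP: d; apply/eqP.
by rewrite -(code_degreeE (Ordinal lt)) -(card_neighbours_iso _ fB fE) neighbours_Cn.
Qed.

Lemma cgraph_not_C5 c : size c != 5 -> ~ (cgraph c ≃ Cn 5).
Proof. by move=> n5 [f /bij_eq_card]; rewrite !card_ord => e; rewrite e in n5. Qed.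


(** ** The collections, for coded pairs *)

Definition pairb (h1 h2 p q : code) : bool :=
  (isob h1 p && isob h2 q) || (isob h1 q && isob h2 p).

Definition P1b (h1 h2 : code) : bool :=
  [|| emb h1 p_P4 || emb h2 p_P4, pairb h1 h2 p_3K1 p_K3,
      pairb h1 h2 p_3K1 p_paw, pairb h1 h2 p_3K1 p_diamond,
      pairb h1 h2 p_copaw p_K3, pairb h1 h2 p_copaw p_paw,
      pairb h1 h2 p_copaw p_diamond, pairb h1 h2 p_codiamond p_K3 |
      pairb h1 h2 p_codiamond p_paw].

Definition P2b (h1 h2 : code) : bool :=
  [|| P1b h1 h2, isob h1 p_3K1 || isob h2 p_3K1,
      isob h1 p_copaw && emb h2 p_coK3P4 |
      isob h2 p_copaw && emb h1 p_coK3P4].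

Definition P2cb (h1 h2 : code) : bool :=
  [|| P2b h1 h2, pairb h1 h2 p_claw p_2K2 | pairb h1 h2 p_claw p_P5].

Definition P3b (h1 h2 : code) : bool :=
  [|| P1b h1 h2, pairb h1 h2 p_claw p_K3, pairb h1 h2 p_claw p_paw,
      pairb h1 h2 p_fork p_K3 | pairb h1 h2 p_fork p_paw].

Definition P4b (h1 h2 : code) : bool :=
  [|| P2cb h1 h2, P3b h1 h2, pairb h1 h2 p_claw p_K1K3 |
      pairb h1 h2 p_claw p_hammer].

Definition O1b h1 h2 := P1b h1 h2 || pairb h1 h2 p_codiamond p_diamond.
Definition O2b h1 h2 := [|| P2b h1 h2, pairb h1 h2 p_codiamond p_diamond |
  pairb h1 h2 p_codiamond p_gem].
Definition O2cb h1 h2 := [|| P2cb h1 h2, pairb h1 h2 p_codiamond p_diamond |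
  pairb h1 h2 p_codiamond p_gem].
Definition O3b h1 h2 := P3b h1 h2 || pairb h1 h2 p_codiamond p_diamond.
Definition O4b h1 h2 := [|| P4b h1 h2, pairb h1 h2 p_codiamond p_diamond |
  pairb h1 h2 p_codiamond p_gem].

Lemma isobP (H K : sgraph) h p : coded H h -> coded K p -> isob h p -> H ≃ K.
Proof.
by move=> cH cK /(coded_isob cH) cH'; apply: coded_iso cK.
Qed.

Section Collections.
Variables (X : gpair) (h1 h2 : code).
Hypotheses (c1 : coded X.1 h1) (c2 : coded X.2 h2).

Lemma pairbP (K L : sgraph) p q :
  coded K p -> coded L q -> pairb h1 h2 p q -> is_pair X K L.
Proof.
by move=> cK cL /orP [] /andP [i1 i2]; [left|right]; split;
   apply: isobP; eassumption.
Qed.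

Lemma subbP (H K : sgraph) h p :
  coded H h -> coded K p -> emb h p -> induced_subgraph H K.
Proof.
move=> cH cK e; apply/induced_subgraphP/(coded_embeds _ cH).
exact/(coded_contains _ cK).
Qed.

Ltac pair_case := apply: pairbP; first
  [ exact: coded_3K1 | exact: coded_copaw | exact: coded_codiamond
  | exact: coded_claw | exact: coded_fork | exact: coded_Kn3 | exact: coded_paw
  | exact: coded_diamond | exact: coded_2K2 | exact: coded_Pn5
  | exact: coded_K1K3 | exact: coded_hammer | exact: coded_gem | eassumption ].

Lemma P1bP : P1b h1 h2 -> coll_P1 X.
Proof.
case/orP => [/orP H|H].
  by left; case: H => H; [left|right]; apply: subbP coded_Pn4 H.
do 7![right; move: H; case/orP => [H|H]; [by left; pair_case|]].
by right; pair_case.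
Qed.

Lemma P2bP : P2b h1 h2 -> coll_P2 X.
Proof.
case/or4P => [/P1bP|/orP H|/andP [H1 H2]|/andP [H1 H2]]; first by left.
- by right; left; case: H => H; [left|right]; apply: isobP coded_3K1 H.
- by do 2 right; left; split; [apply: isobP coded_copaw H1|apply: subbP coded_coK3P4 H2].
- by do 3 right; split; [apply: isobP coded_copaw H1|apply: subbP coded_coK3P4 H2].
Qed.

Lemma P2cbP : P2cb h1 h2 -> coll_P2c X.
Proof.
by case/or3P => [/P2bP|H|H]; [left|right; left|do 2 right]; pair_case || done.
Qed.

Lemma P3bP : P3b h1 h2 -> coll_P3 X.
Proof.
case/orP => [/P1bP|H]; first by left.
do 3![right; move: H; case/orP => [H|H]; [by left; pair_case|]].
by right; pair_case.
Qed.

Lemma P4bP : P4b h1 h2 -> coll_P4 X.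
Proof.
case/or4P => [/P2cbP|/P3bP|H|H]; first by left.
- by right; left.
- by do 2 right; left; pair_case.
- by do 3 right; pair_case.
Qed.

Lemma O1bP : O1b h1 h2 -> coll_Omega1 X.
Proof. by case/orP => [/P1bP|H]; [left|right; pair_case]. Qed.

Lemma O2bP : O2b h1 h2 -> coll_Omega2 X.
Proof.
by case/or3P => [/P2bP|H|H]; [left|right; left; pair_case|do 2 right; pair_case].
Qed.

Lemma O2cbP : O2cb h1 h2 -> coll_Omega2c X.
Proof.
by case/or3P => [/P2cbP|H|H]; [left|right; left; pair_case|do 2 right; pair_case].
Qed.

Lemma O3bP : O3b h1 h2 -> coll_Omega3 X.
Proof. by case/orP => [/P3bP|H]; [left|right; pair_case]. Qed.

Lemma O4bP : O4b h1 h2 -> coll_Omega4 X.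
Proof.
by case/or3P => [/P4bP|H|H]; [left|right; left; pair_case|do 2 right; pair_case].
Qed.

End Collections.

(** ** The finite search *)

(** One member of the pair has a code [h1] among those of the subgraphs of [b0].
    Unless this alone puts the pair in the collection, which is what [left] tells,
    the first graph of [bs] that avoids [h1] must contain the other member, so that
    finitely many pairs are left. *)
Definition search (left : pred code) (coll : rel code) (b0 : code)
    (bs : seq code) : bool :=
  all (fun h1 => if left h1 then true else
    (let M := [seq b <- bs | ~~ emb h1 b] in
     if M is b :: _ then
       all (fun h2 => if some (fun b' => ~~ emb h2 b') M then true
                      else coll h1 h2) (subcodes b)
     else false)) (subcodes b0).

Definition swap (X : gpair) : gpair := (X.2, X.1).

Lemma searchP (C : graph_class) (P : gpair -> Prop) (cl left : pred code)
    (coll : rel code) b0 bs X :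
  (forall c, cl c -> C (cgraph c)) -> (forall X, P (swap X) -> P X) ->
  (forall X h, coded X.1 h -> left h -> P X) ->
  (forall X h1 h2, coded X.1 h1 -> coded X.2 h2 -> coll h1 h2 -> P X) ->
  all (fun b => [&& wf b, code_bad b & cl b]) (b0 :: bs) ->
  search left coll b0 bs ->
  every_free_omega_colourable C X -> P X.
Proof.
move=> clP Psw leftP collP /allP badP srch H.
have F Y b : every_free_omega_colourable C Y -> b \in b0 :: bs ->
    embeds Y.1 (cgraph b) \/ embeds Y.2 (cgraph b).
  move=> HY /badP /and3P [wb bb /clP Cb].
  case: (embeds_dec Y.1 (cgraph b)) => [|n1]; first by left.
  case: (embeds_dec Y.2 (cgraph b)) => [|n2]; first by right.
  case: (code_badP (coded_cgraph wb) bb); apply: HY => //.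
  by split => /induced_subgraphP.
have Q Y : every_free_omega_colourable C Y -> embeds Y.1 (cgraph b0) -> P Y.
  move=> HY /embeds_subcodes [h1 h1s c1].
  move/allP: srch => /(_ _ h1s); case: ifP => [/(leftP _ _ c1)//|_].
  case E: [seq b <- bs | ~~ emb h1 b] => [//|b M].
  have G b' : b' \in b :: M -> embeds Y.2 (cgraph b').
    rewrite -E mem_filter => /andP [ne bs']; have b's : b' \in b0 :: bs.
      by rewrite inE bs' orbT.
    have [|//] := F Y b' HY b's; move/(coded_embeds _ c1).
    have /and3P [wb' _ _] := badP _ b's.
    by move/(coded_contains _ (coded_cgraph wb')); rewrite (negbTE ne).
  have [h2 h2s c2] := embeds_subcodes (G b (mem_head _ _)).
  move=> /allP /(_ _ h2s); rewrite some_has; case: ifP => [/hasP [b' b'M] + _|_ /(collP _ _ _ c1 c2)//].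
  move=> /negP []; have /(coded_embeds _ c2) := G _ b'M.
  have /and3P [wb' _ _] : [&& wf b', code_bad b' & cl b'].
    apply: badP; move: b'M; rewrite -E mem_filter inE => /andP [_ ->].
    by rewrite orbT.
  by move/(coded_contains _ (coded_cgraph wb')).
have [|E1|E2] := F X b0 H; first exact: mem_head.
  exact: Q.
by apply: Psw; apply: Q => // G CG fG; apply: H => //; case: fG.
Qed.

Definition in_P4 (h : code) : bool := emb h p_P4.
Definition in_P4_or_3K1 (h : code) : bool := emb h p_P4 || isob h p_3K1.

Lemma in_P4P X h : coded X.1 h -> in_P4 h -> coll_P1 X.
Proof. by move=> c e; left; left; apply: subbP c coded_Pn4 e. Qed.

Lemma in_P4_or_3K1P X h : coded X.1 h -> in_P4_or_3K1 h -> coll_P2 X.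
Proof.
move=> c /orP [/(in_P4P c)|e]; first by left.
by right; left; left; apply: isobP c coded_3K1 e.
Qed.

Lemma is_pair_swap X H K : is_pair (swap X) H K -> is_pair X H K.
Proof. by case=> -[]; [right | left]. Qed.

Lemma coll_P1_swap X : coll_P1 (swap X) -> coll_P1 X.
Proof.
case=> [[]|H]; [by left; right | by left; left | right].
by do 7![case: H => H; [by left; apply: is_pair_swap | right]]; apply: is_pair_swap.
Qed.

Lemma coll_P2_swap X : coll_P2 (swap X) -> coll_P2 X.
Proof.
case=> [/coll_P1_swap|[[]|[]]]; first by left.
- by right; left; right.
- by right; left; left.
- by do 3 right.
- by do 2 right; left.
Qed.

Lemma coll_P2c_swap X : coll_P2c (swap X) -> coll_P2c X.
Proof.
case=> [/coll_P2_swap|[|] /is_pair_swap]; [by left | by right; left | by right; right].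
Qed.

Lemma coll_P3_swap X : coll_P3 (swap X) -> coll_P3 X.
Proof.
case=> [/coll_P1_swap|H]; [by left | right].
by do 3![case: H => H; [by left; apply: is_pair_swap | right]]; apply: is_pair_swap.
Qed.

Lemma coll_P4_swap X : coll_P4 (swap X) -> coll_P4 X.
Proof.
case=> [/coll_P2c_swap|[/coll_P3_swap|[|] /is_pair_swap]].
- by left.
- by right; left.
- by do 2 right; left.
- by do 3 right.
Qed.

Section Necessity.
Variable X : gpair.

Lemma only_if_o : every_free_omega_colourable G_o X -> coll_Omega1 X.
Proof.
apply: (@searchP _ _ code_no_cycle in_P4 O1b b_C5_K1
  [:: b_C5_twin; b_coC7; b_spindle; b_C7_K1]) => [c|Y|Y h c|Y h1 h2||].
- exact: code_no_cycleP.
- by case=> [/coll_P1_swap|/is_pair_swap]; [left | right].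
- by move/(in_P4P c); left.
- exact: O1bP.
- by vm_compute.
- by vm_compute.
Qed.

Lemma only_if_c5 : every_free_omega_colourable G_c5 X -> coll_Omega1 X.
Proof.
apply: (@searchP _ _ (fun c => code_connected c && (size c != 5)) in_P4 O1b
  b_C5_pendant [:: b_C5_twin; b_wheel; b_coC7; b_spindle; b_C7])
  => [c|Y|Y h c|Y h1 h2||].
- by move=> /andP [/code_connectedP ? /cgraph_not_C5].
- by case=> [/coll_P1_swap|/is_pair_swap]; [left | right].
- by move/(in_P4P c); left.
- exact: O1bP.
- by vm_compute.
- by vm_compute.
Qed.

Lemma emb_independence c : wf c -> emb p_3K1 c -> independence_ge3 (cgraph c).
Proof.
by move=> /coded_cgraph cc e; apply/independence_ge3P/(coded_contains _ cc).
Qed.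

Lemma only_if_oalpha : every_free_omega_colourable G_oalpha X -> coll_Omega2 X.
Proof.
apply: (@searchP _ _ (fun c => [&& wf c, emb p_3K1 c & code_no_cycle c])
  in_P4_or_3K1 O2b b_C5_K1
  [:: b_C5_twin; b_wheel_triangle; b_C7_K1; b_C5_join_3K1; b_coC7_join_3K1])
  => [c|Y|Y h c|Y h1 h2||].
- by case/and3P=> w /(emb_independence w) ? /code_no_cycleP.
- by case=> [/coll_P2_swap|[|] /is_pair_swap]; [left | right; left | right; right].
- by move/(in_P4_or_3K1P c); left.
- exact: O2bP.
- by vm_compute.
- by vm_compute.
Qed.

Lemma only_if_calpha : every_free_omega_colourable G_calpha X -> coll_Omega2c X.
Proof.
apply: (@searchP _ _ (fun c => [&& wf c, code_connected c & emb p_3K1 c])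
  in_P4_or_3K1 O2cb b_C5_pendant
  [:: b_C5_twin; b_wheel_triangle; b_C7; b_wheel_pendant; b_C5_join_3K1;
      b_coC7_join_3K1]) => [c|Y|Y h c|Y h1 h2||].
- by case/and3P=> w /code_connectedP ? /(emb_independence w).
- by case=> [/coll_P2c_swap|[|] /is_pair_swap]; [left | right; left | right; right].
- by move/(in_P4_or_3K1P c); left; left.
- exact: O2cbP.
- by vm_compute.
- by vm_compute.
Qed.

Lemma only_if_co : every_free_omega_colourable G_co X -> coll_Omega3 X.
Proof.
apply: (@searchP _ _ (fun c => code_connected c && code_no_cycle c) in_P4 O3b
  b_C5_pendant
  [:: b_C5_twin; b_wheel; b_coC7; b_spindle; b_C7_pendant; b_line])
  => [c|Y|Y h c|Y h1 h2||].
- by move=> /andP [/code_connectedP ? /code_no_cycleP].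
- by case=> [/coll_P3_swap|/is_pair_swap]; [left | right].
- by move/(in_P4P c); left; left.
- exact: O3bP.
- by vm_compute.
- by vm_compute.
Qed.

Lemma only_if_coalpha : every_free_omega_colourable G_coalpha X -> coll_Omega4 X.
Proof.
apply: (@searchP _ _
  (fun c => [&& wf c, code_connected c, emb p_3K1 c & code_no_cycle c])
  in_P4_or_3K1 O4b b_C5_pendant
  [:: b_C5_twin; b_wheel_triangle; b_wheel_pendant; b_C5_join_3K1; b_C7_twin;
      b_coC7_join_3K1; b_C7_blowup; b_line]) => [c|Y|Y h c|Y h1 h2||].
- by case/and4P=> w /code_connectedP ? /(emb_independence w) ? /code_no_cycleP.
- by case=> [/coll_P4_swap|[|] /is_pair_swap]; [left | right; left | right; right].
- by move/(in_P4_or_3K1P c); left; left; left.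
- exact: O4bP.
- by vm_compute.
- by vm_compute.
Qed.

(** A [C_5] with a triangle erected on one edge is 3-colourable, yet imperfect.
    It rules out, for perfection, the pairs that only ensure omega-colourability. *)
Definition b_C5_triangle := edge_code 6 ([:: (2, 5); (3, 5)] ++ cycle_edges 5).

Lemma perfect_exclude (C : graph_class) q (H : sgraph) :
  C (cgraph b_C5_triangle) -> coded H q -> emb q b_C5_triangle = false ->
  every_free_perfect C X -> ~ is_pair X (copies 2 (Kn 1) ⊎ Kn 2) H.
Proof.
move=> CG cH eq pX XP; pose G := cgraph b_C5_triangle.
have cG : coded G b_C5_triangle by apply: coded_cgraph; vm_compute.
have nH : ~ embeds H G.
  by move=> /(coded_embeds _ cH) /(coded_contains _ cG); rewrite eq.
have nK : ~ embeds (copies 2 (Kn 1) ⊎ Kn 2) G.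
  by move=> /(coded_embeds _ coded_codiamond) /(coded_contains _ cG); vm_compute.
have N Y K : Y ≃ K -> ~ embeds K G -> ~ induced_subgraph Y G.
  move=> /iso_sym /iso_embeds KY nKG /induced_subgraphP YG.
  by apply: nKG; apply: embeds_trans YG.
have /perfect_embeds pG : perfect G.
  by apply: pX => //; case: XP => -[i1 i2]; split; apply: N; eassumption.
have bad : code_bad (edge_code 5 (cycle_edges 5)) by vm_compute.
have cC : coded (cgraph (edge_code 5 (cycle_edges 5))) (edge_code 5 (cycle_edges 5)).
  by apply: coded_cgraph; vm_compute.
apply: (code_badP cC bad); apply: pG.
by apply/(coded_embeds _ cC)/(coded_contains _ cG); vm_compute.
Qed.

End Necessity.

(** * From the collections to the classes *)

Lemma free_iso (Y H G : sgraph) p : coded H p -> Y ≃ H -> ~ induced_subgraph Y G ->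
  free p G.
Proof.
move=> cH /iso_embeds YH nY /(coded_embeds _ cH) HG; apply: nY.
by apply/induced_subgraphP; apply: embeds_trans HG.
Qed.

Lemma free_sub (Y H G : sgraph) p : coded H p -> induced_subgraph Y H ->
  ~ induced_subgraph Y G -> free p G.
Proof.
move=> cH /induced_subgraphP YH nY /(coded_embeds _ cH) HG; apply: nY.
by apply/induced_subgraphP; apply: embeds_trans HG.
Qed.

Lemma free_pair X (H K G : sgraph) p q p' q' : coded H p -> coded K q ->
  is_pair X H K -> X_free X G -> emb p p' -> emb q q' -> free p' G /\ free q' G.
Proof.
move=> cH cK P [n1 n2] ep eq; case: P => -[i1 i2].
  by split; [apply: free_emb ep (free_iso cH i1 n1)|apply: free_emb eq (free_iso cK i2 n2)].
by split; [apply: free_emb ep (free_iso cH i2 n2)|apply: free_emb eq (free_iso cK i1 n1)].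
Qed.

Lemma odd_cycle_C5 (G : sgraph) : G ≃ Cn 5 -> odd_cycle G.
Proof. by move=> e; exists 5. Qed.

Lemma stable3_not_C5 (G : sgraph) : contains p_3K1 G -> ~ (G ≃ Cn 5).
Proof.
move=> c3 /(fun e => coded_of_iso e coded_Cn5) c5.
by move/(coded_contains _ c5): c3; vm_compute.
Qed.

(** The pairs of the collection [coll_P1] are below three maximal ones, with
    respect to the induced subgraph relation in both members. *)
Lemma if_P1 X : coll_P1 X -> every_free_perfect G_5 X.
Proof.
case=> [[] sP4|H] G nC fX.
- by apply: P4_free_perfect; apply: free_sub coded_Pn4 sP4 _; case: fX.
- by apply: P4_free_perfect; apply: free_sub coded_Pn4 sP4 _; case: fX.
have pair K L p q := @free_pair X K L G p q.
case: H => [P|H].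
  have [F1 F2] := pair _ _ _ _ p_copaw p_paw coded_3K1 coded_Kn3 P fX isT isT; exact: copaw_paw.
case: H => [P|H].
  have [F1 F2] := pair _ _ _ _ p_copaw p_paw coded_3K1 coded_paw P fX isT isT; exact: copaw_paw.
case: H => [P|H].
  have [F1 F2] := pair _ _ _ _ p_copaw p_diamond coded_3K1 coded_diamond P fX isT isT; exact: copaw_diamond.
case: H => [P|H].
  have [F1 F2] := pair _ _ _ _ p_copaw p_paw coded_copaw coded_Kn3 P fX isT isT; exact: copaw_paw.
case: H => [P|H].
  have [F1 F2] := pair _ _ _ _ p_copaw p_paw coded_copaw coded_paw P fX isT isT; exact: copaw_paw.
case: H => [P|H].
  have [F1 F2] := pair _ _ _ _ p_copaw p_diamond coded_copaw coded_diamond P fX isT isT; exact: copaw_diamond.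
case: H => P.
  have [F1 F2] := pair _ _ _ _ p_codiamond p_paw coded_codiamond coded_Kn3 P fX isT isT; exact: codiamond_paw.
have [F1 F2] := pair _ _ _ _ p_codiamond p_paw coded_codiamond coded_paw P fX isT isT; exact: codiamond_paw.
Qed.

Lemma if_P2 X : coll_P2 X -> every_free_perfect G_alpha X.
Proof.
case=> [P1|[I|H]] G /independence_ge3P a3 fX.
- by apply: (if_P1 P1) => //; apply: stable3_not_C5.
- by case: I => i; case: fX => n1 n2;
    [case: (free_iso coded_3K1 i n1) | case: (free_iso coded_3K1 i n2)].
case: H => -[i sub]; case: fX => n1 n2.
  exact: (copaw_alpha3 (free_iso coded_copaw i n1) (free_sub coded_coK3P4 sub n2) a3).
exact: (copaw_alpha3 (free_iso coded_copaw i n2) (free_sub coded_coK3P4 sub n1) a3).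
Qed.

Lemma if_P2c X : coll_P2c X -> every_free_perfect G_calpha X.
Proof.
case=> [P2|H] G [conn a3] fX; first exact: (if_P2 P2).
have [F1 F2] : free p_claw G /\ free p_P5 G.
  case: H => P; first exact: (free_pair (p' := p_claw) (q' := p_P5) coded_claw coded_2K2 P fX isT isT).
  exact: (free_pair (p' := p_claw) (q' := p_P5) coded_claw coded_Pn5 P fX isT isT).
by apply: claw_P5 => //; apply/independence_ge3P.
Qed.

Lemma if_P3 X : coll_P3 X -> every_free_perfect G_co X.
Proof.
case=> [P1|H] G [conn nO] fX.
  by apply: (if_P1 P1) => // /odd_cycle_C5.
have [F1 F2] : free p_fork G /\ free p_paw G.
  case: H => [P|H]; first exact: (free_pair (p' := p_fork) (q' := p_paw) coded_claw coded_Kn3 P fX isT isT).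
  case: H => [P|H]; first exact: (free_pair (p' := p_fork) (q' := p_paw) coded_claw coded_paw P fX isT isT).
  case: H => P; first exact: (free_pair (p' := p_fork) (q' := p_paw) coded_fork coded_Kn3 P fX isT isT).
  exact: (free_pair (p' := p_fork) (q' := p_paw) coded_fork coded_paw P fX isT isT).
exact: fork_paw.
Qed.

Lemma if_P4 X : coll_P4 X -> every_free_perfect G_coalpha X.
Proof.
case=> [P2c|[P3|H]] G [conn a3 nO] fX; [exact: (if_P2c P2c) | exact: (if_P3 P3) |].
have [F1 F2] : free p_claw G /\ free p_hammer G.
  case: H => P; first exact: (free_pair (p' := p_claw) (q' := p_hammer) coded_claw coded_K1K3 P fX isT isT).
  exact: (free_pair (p' := p_claw) (q' := p_hammer) coded_claw coded_hammer P fX isT isT).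
by apply: claw_hammer => //; apply/independence_ge3P.
Qed.

Lemma if_gem X : is_pair X (copies 2 (Kn 1) ⊎ Kn 2) (compl (Kn 1 ⊎ Pn 4)) ->
  every_free_omega_colourable G_alpha X.
Proof.
move=> P G /independence_ge3P a3 fX.
have [F1 F2] : free p_codiamond G /\ free p_gem G.
  exact: (free_pair (p' := p_codiamond) (q' := p_gem) coded_codiamond coded_gem P fX isT isT).
exact: codiamond_gem.
Qed.

Lemma if_diamond X : is_pair X (copies 2 (Kn 1) ⊎ Kn 2) D ->
  every_free_omega_colourable G_5 X.
Proof.
move=> P G nC fX.
have [F1 F2] : free p_codiamond G /\ free p_diamond G.
  exact: (free_pair (p' := p_codiamond) (q' := p_diamond) coded_codiamond coded_diamond P fX isT isT).
case: (contains_dec G p_3K1) => [a3|n3].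
  by apply: codiamond_gem => //; apply: free_emb F2; vm_compute.
apply/perfect_omega/copaw_diamond => //.
by apply: (free_emb (p := p_3K1)).
Qed.

Section Classes.
Variables C C' : graph_class.
Hypothesis sub : forall G, C G -> C' G.

Lemma every_perfect_sub X : every_free_perfect C' X -> every_free_perfect C X.
Proof. by move=> H G /sub; apply: H. Qed.

Lemma every_omega_sub X :
  every_free_omega_colourable C' X -> every_free_omega_colourable C X.
Proof. by move=> H G /sub; apply: H. Qed.

End Classes.

Lemma perfect_to_omega C X : every_free_perfect C X -> every_free_omega_colourable C X.
Proof. by move=> H G CG fX; apply: perfect_omega; apply: H. Qed.

Lemma G_o_5 G : G_o G -> G_5 G.
Proof. by move=> nO /odd_cycle_C5. Qed.

Lemma G_c5_5 G : G_c5 G -> G_5 G.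
Proof. by case. Qed.

Lemma G_alpha_5 G : G_alpha G -> G_5 G.
Proof. by move/independence_ge3P/stable3_not_C5. Qed.

Lemma G_oalpha_alpha G : G_oalpha G -> G_alpha G.
Proof. by case. Qed.

Lemma G_calpha_alpha G : G_calpha G -> G_alpha G.
Proof. by case. Qed.

Lemma G_co_o G : G_co G -> G_o G.
Proof. by case. Qed.

Lemma G_coalpha_alpha G : G_coalpha G -> G_alpha G.
Proof. by case. Qed.

Lemma C5_triangle_class : G_coalpha (cgraph b_C5_triangle).
Proof.
split.
- by apply: code_connectedP; vm_compute.
- by apply: emb_independence; vm_compute.
- by apply: code_no_cycleP; vm_compute.
Qed.

Section Exclusion.
Variables (C : graph_class) (X : gpair).
Hypothesis sub : forall G, G_coalpha G -> C G.
Hypothesis pX : every_free_perfect C X.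

Lemma exclude_diamond : ~ is_pair X (copies 2 (Kn 1) ⊎ Kn 2) D.
Proof.
by apply: (perfect_exclude (sub C5_triangle_class) coded_diamond) pX; vm_compute.
Qed.

Lemma exclude_gem : ~ is_pair X (copies 2 (Kn 1) ⊎ Kn 2) (compl (Kn 1 ⊎ Pn 4)).
Proof.
by apply: (perfect_exclude (sub C5_triangle_class) coded_gem) pX; vm_compute.
Qed.

End Exclusion.

Theorem theorem2 (X : gpair) :
  ((every_free_perfect G_5 X <-> coll_P1 X) /\
   (every_free_perfect G_o X <-> coll_P1 X) /\
   (every_free_perfect G_c5 X <-> coll_P1 X)) /\
  ((every_free_perfect G_alpha X <-> coll_P2 X) /\
   (every_free_perfect G_oalpha X <-> coll_P2 X)) /\
  (every_free_perfect G_calpha X <-> coll_P2c X) /\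
  (every_free_perfect G_co X <-> coll_P3 X) /\
  (every_free_perfect G_coalpha X <-> coll_P4 X) /\
  ((every_free_omega_colourable G_5 X <-> coll_Omega1 X) /\
   (every_free_omega_colourable G_o X <-> coll_Omega1 X) /\
   (every_free_omega_colourable G_c5 X <-> coll_Omega1 X)) /\
  ((every_free_omega_colourable G_alpha X <-> coll_Omega2 X) /\
   (every_free_omega_colourable G_oalpha X <-> coll_Omega2 X)) /\
  (every_free_omega_colourable G_calpha X <-> coll_Omega2c X) /\
  (every_free_omega_colourable G_co X <-> coll_Omega3 X) /\
  (every_free_omega_colourable G_coalpha X <-> coll_Omega4 X).
Proof.
have o1 : coll_Omega1 X -> every_free_omega_colourable G_5 X.
  by case=> [/if_P1/perfect_to_omega|/if_diamond].
have o2 : coll_Omega2 X -> every_free_omega_colourable G_alpha X.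
  case=> [/if_P2/perfect_to_omega//|[/if_diamond|/if_gem//]].
  by move/(every_omega_sub G_alpha_5).
have o2c : coll_Omega2c X -> every_free_omega_colourable G_calpha X.
  case=> [/if_P2c/perfect_to_omega//|H].
  by apply/(every_omega_sub G_calpha_alpha)/o2; right.
have o3 : coll_Omega3 X -> every_free_omega_colourable G_co X.
  case=> [/if_P3/perfect_to_omega//|/if_diamond].
  by move/(every_omega_sub G_o_5)/(every_omega_sub G_co_o).
have o4 : coll_Omega4 X -> every_free_omega_colourable G_coalpha X.
  case=> [/if_P4/perfect_to_omega//|H].
  by apply/(every_omega_sub G_coalpha_alpha)/o2; right.
have p1 C : (forall G, G_coalpha G -> C G) -> every_free_perfect C X ->
    coll_Omega1 X -> coll_P1 X.
  by move=> sub pX [//|/(exclude_diamond sub pX)].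
have p2 C : (forall G, G_coalpha G -> C G) -> every_free_perfect C X ->
    coll_Omega2 X -> coll_P2 X.
  by move=> sub pX [//|[/(exclude_diamond sub pX)|/(exclude_gem sub pX)]].
have only1 : every_free_perfect G_o X -> coll_P1 X.
  move=> pX; apply: (p1 G_o) => //; first by move=> G [].
  exact/only_if_o/perfect_to_omega.
have only2 : every_free_perfect G_oalpha X -> coll_P2 X.
  move=> pX; apply: (p2 G_oalpha) => //; first by move=> G [].
  exact/only_if_oalpha/perfect_to_omega.
have onlyO1 : every_free_omega_colourable G_o X -> coll_Omega1 X := @only_if_o X.
have onlyO2 : every_free_omega_colourable G_oalpha X -> coll_Omega2 X.
  exact: only_if_oalpha.
do !split.
- by move=> /(every_perfect_sub G_o_5).
- exact: if_P1.
- exact: only1.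
- by move=> /if_P1/(every_perfect_sub G_o_5).
- move=> pX; apply: (p1 G_c5) => //; last exact/only_if_c5/perfect_to_omega.
  by move=> G [conn a3 nO]; split => // /odd_cycle_C5.
- by move=> /if_P1/(every_perfect_sub G_c5_5).
- by move=> /(every_perfect_sub G_oalpha_alpha).
- exact: if_P2.
- exact: only2.
- by move=> /if_P2/(every_perfect_sub G_oalpha_alpha).
- move=> pX; have sub G : G_coalpha G -> G_calpha G by case.
  case: (only_if_calpha (perfect_to_omega pX)) => //.
  by case=> [/(exclude_diamond sub pX)|/(exclude_gem sub pX)].
- exact: if_P2c.
- move=> pX; have sub G : G_coalpha G -> G_co G by case.
  by case: (only_if_co (perfect_to_omega pX)) => // /(exclude_diamond sub pX).
- exact: if_P3.
- move=> pX; case: (only_if_coalpha (perfect_to_omega pX)) => //.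
  by case=> [/(exclude_diamond (fun _ => id) pX)|/(exclude_gem (fun _ => id) pX)].
- exact: if_P4.
- by move=> /(every_omega_sub G_o_5).
- exact: o1.
- exact: onlyO1.
- by move=> /o1/(every_omega_sub G_o_5).
- exact: only_if_c5.
- by move=> /o1/(every_omega_sub G_c5_5).
- by move=> /(every_omega_sub G_oalpha_alpha).
- exact: o2.
- exact: onlyO2.
- by move=> /o2/(every_omega_sub G_oalpha_alpha).
- exact: only_if_calpha.
- exact: o2c.
- exact: only_if_co.
- exact: o3.
- exact: only_if_coalpha.
- exact: o4.
Qed.
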